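(* Let $\Lambda\subset\mathbb{R}$ be a discrete set and let $\phi(t)=e^{-\pi t^2}$ be the Gaussian function. Let $\Lambda^+=\Lambda\cap[0,\infty)$ and $\Lambda^-=\Lambda\cap(-\infty,0]$. (1) If $\Delta(\Lambda^+)<1/2$ and $\Delta(\Lambda^-)<1/2$, then $\{\phi(t-\lambda)\}_{\lambda\in\Lambda}$ does not span $L^2(\mathbb{R})$. (2) If $\Delta(\Lambda^+)>1/2$ or $\Delta(\Lambda^-)>1/2$, then $\{\phi(t-\lambda)\}_{\lambda\in\Lambda}$ spans $L^2(\mathbb{R})$. Both statements (1) and (2) also hold with $L^2(\mathbb{R})$ replaced by $L^1(\mathbb{R})$.
   Context: The spaces $L^p(\mathbb{R})$ consist of complex-valued functions. A family of functions in $L^p(\mathbb{R})$ ''spans'' $L^p(\mathbb{R})$ if its finite linear combinations are dense in $L^p(\mathbb{R})$. For a discrete set $M\subset\mathbb{R}$, its density is $$\Delta(M)=\lim_{r\to\infty}\frac{|M\cap(-r,r)|}{r^2},$$ with value in $[0,\infty]$, where $|\cdot|$ denotes cardinality. Only sets for which the limit exists are considered: each inequality such as $\Delta(\Lambda^+)<1/2$ or $\Delta(\Lambda^+)>1/2$ includes the assertion that the corresponding limit exists (possibly equal to $+\infty$ in the case $>$). *)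

(* Defs.v *)
From HB Require Import structures.
From mathcomp Require Import all_boot all_order all_algebra.
From mathcomp Require Import complex.
From mathcomp Require Import all_classical all_reals all_analysis.
Import Order.TTheory GRing.Theory Num.Theory.
Import numFieldNormedType.Exports.

Set Implicit Arguments.
Unset Strict Implicit.
Unset Printing Implicit Defensive.

Local Open Scope classical_set_scope.
Local Open Scope ring_scope.

(* Discrete in the subspace topology.  Accumulation points outside the set are
   not excluded, so this covers both usual meanings of "discrete subset of the
   line"; a bounded window may contain infinitely many points. *)
Definition discrete_set (T : topologicalType) (A : set T) : Prop :=
  A `<=` isolated A.

(* [counting] has value +oo on infinite sets. *)
Definition has_density (R : realType) (M : set R) (d : \bar R) : Prop :=
  (fun r : R => counting (M `&` `](- r)%R, r[) * ((r ^+ 2)^-1)%:E)%E @ +oo%R --> d.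

Definition density_lt (R : realType) (M : set R) (a : R) : Prop :=
  exists2 d : \bar R, has_density M d & (d < a%:E)%E.

Definition density_gt (R : realType) (M : set R) (a : R) : Prop :=
  exists2 d : \bar R, has_density M d & (a%:E < d)%E.

(* Complex-valued functions on the line, for Lebesgue measure.  As usual, L^p is
   represented by functions rather than by classes modulo a.e. equality. *)
Definition cLnorm (R : realType) (p : \bar R) (f : R -> R[i]) : \bar R :=
  Lnorm (@lebesgue_measure R) p (fun t => (Normc.normc (f t))%:E).

Definition cmeasurable_fun (R : realType) (f : R -> R[i]) : Prop :=
  measurable_fun [set: R] (fun t => complex.Re (f t)) /\
  measurable_fun [set: R] (fun t => complex.Im (f t)).

Definition cLp (R : realType) (p : \bar R) : set (R -> R[i]) :=
  [set f | cmeasurable_fun f /\ (cLnorm p f < +oo)%E].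

(* Density in L^p of the finite linear combinations of the [F i] with [A i]. *)
Definition spans_Lp (R : realType) (p : \bar R) (I : Type) (A : set I)
    (F : I -> R -> R[i]) : Prop :=
  forall f : R -> R[i], cLp p f -> forall e : R, 0 < e ->
  exists (n : nat) (i : 'I_n -> I) (c : 'I_n -> R[i]),
    (forall k, A (i k)) /\
    (cLnorm p (fun t => f t - \sum_(k < n) c k * F (i k) t)%R < e%:E)%E.

Definition gaussian (R : realType) (t : R) : R[i] :=
  (expR (- (pi * t ^+ 2)))%:C%C.

(* Main.v *)
Require Import Defs.
From mathcomp Require Import all_boot all_order all_algebra.
From mathcomp Require Import complex.
From mathcomp Require Import all_classical all_reals all_analysis.
From mathcomp Require Import measurable_realfun.
From mathcomp Require Import ring lra.
Import Order.TTheory GRing.Theory Num.Theory.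
Import numFieldNormedType.Exports.
Local Open Scope classical_set_scope.
Local Open Scope ring_scope.

Set Implicit Arguments.
Unset Strict Implicit.
Unset Printing Implicit Defensive.

(** Let [phi t = exp (- pi t^2)]. Its translates extend to a holomorphic family
    [cgauss z t = exp (- pi (t - z)^2)], and both halves of the theorem rest on it.

    Density above 1/2. Let [V] be the span of the translates over [Lambda], and let
    [N z] be the [L^p] distance from [cgauss z] to [V]. It plays the role of the
    modulus of [z |-> <cgauss z, u>] for a functional [u] vanishing on [V]: it vanishes
    on [Lambda], it is at most [C exp (pi (Im z)^2)], and it satisfies a sub-mean-value
    inequality on the four points [z + i^k r], also after multiplication by moduli of
    nonvanishing holomorphic functions ([dist_cgauss_submean]). This suffices for a
    maximum principle ([max_principle]). Under [w = z^2] the sector [|arg z| < pi/4]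
    becomes a half-plane, where [N] grows like [exp (pi |w| / 2)] on the boundary and
    has zeros of linear density above 1/2; by the argument of Carlson's theorem,
    with Blaschke factors and a truncated sine product, [N] vanishes
    ([vanish_sector]). Translating the sector, [N] vanishes everywhere, so the closure
    of [V] contains all [cgauss z]. Modulation by a character shifts [z] in the
    imaginary direction; starting from characters, algebra and bounded limits produce
    all bounded measurable multipliers, hence [V] is dense ([dist_cgauss_dense]).

    Densities below 1/2. A function orthogonal to the translates comes from the mean
    value property of entire functions for the Gaussian measure on the plane: if
    [f t] is the integral of [F (t + i y) phi y] over [y], then the integral of
    [f t * phi (t - x)] over [t] is [F x]. It suffices to find [F], not identically zero,
    vanishing on [Lambda], for which [f] has Gaussian decay. Take
    [F z = exp (- pi z^2 / 2) * z * G z] with [|G z| <= C exp ((pi / 2 - eta) |z|^2)].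
    Choose [d < 1/2] above both densities. Adding points to the positive and to the
    negative part of [Lambda] makes both asymptotic to [sqrt (j / d)]
    ([regular_enum_asymp]). Grouping the [j]-th positive and the [j]-th negative point
    with two more zeros gives factors [1 - al v^3 - ga v^4] with [v = z sqrt (d / j)],
    [al -> 0], [ga -> 1], so that [|G z|] is essentially at most
    [prod (1 + d^2 |z|^4 / j^2) <= exp (pi d |z|^2)] ([cprod_growth]). All integrals are
    taken of polynomial approximants first ([ceval_hermite_sum], [gmean_hermite_sum])
    and then passed to the limit ([annihilator_spec]). Since [f] has Gaussian decay it
    acts continuously on [L^p] for every [p >= 1] ([gauss_pairing_le]). *)

(** * Complex moduli and the complex exponential *)

Section ComplexModulus.
Context {R : realType}.

Lemma le_of_eq (x y : R) : x = y -> x <= y.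
Proof. by move->. Qed.

Implicit Types z w : R[i].

Lemma normc_sqr z : Normc.normc z ^+ 2 = complex.Re z ^+ 2 + complex.Im z ^+ 2.
Proof. by case: z => a b /=; rewrite sqr_sqrtr// addr_ge0 ?sqr_ge0. Qed.

Lemma normc_ge0 z : 0 <= Normc.normc z.
Proof. by case: z => a b /=; exact: sqrtr_ge0. Qed.

Lemma normr_Re_le z : `|complex.Re z| <= Normc.normc z.
Proof.
by rewrite -(@ler_pXn2r _ 2) ?nnegrE ?normc_ge0// normc_sqr -normrX ger0_norm ?sqr_ge0// lerDl sqr_ge0.
Qed.

Lemma normr_Im_le z : `|complex.Im z| <= Normc.normc z.
Proof.
by rewrite -(@ler_pXn2r _ 2) ?nnegrE ?normc_ge0// normc_sqr -normrX ger0_norm ?sqr_ge0// lerDr sqr_ge0.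
Qed.

Lemma normc_le_ReIm z : Normc.normc z <= `|complex.Re z| + `|complex.Im z|.
Proof.
rewrite -(@ler_pXn2r _ 2) ?nnegrE ?normc_ge0 ?addr_ge0// normc_sqr sqrrD.
by rewrite !real_normK ?num_real// lerD2r lerDl mulrn_wge0// mulr_ge0.
Qed.

Lemma normc_real (x : R) : Normc.normc x%:C%C = `|x|.
Proof. by rewrite /= expr0n /= addr0 sqrtr_sqr. Qed.

Lemma normcX z n : Normc.normc (z ^+ n) = Normc.normc z ^+ n.
Proof. by elim: n => [|n IH]; rewrite ?expr0 ?Normc.normc1// !exprS Normc.normcM IH. Qed.

Lemma normc_sum (I : Type) (r : seq I) (P : pred I) (F : I -> R[i]) :
  Normc.normc (\sum_(i <- r | P i) F i) <= \sum_(i <- r | P i) Normc.normc (F i).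
Proof.
elim/big_ind2 : _ => //; first by rewrite Normc.normc0.
by move=> a b c d h1 h2; exact: le_trans (le_normcD _ _) (lerD h1 h2).
Qed.

Lemma normc_prod (I : Type) (r : seq I) (P : pred I) (F : I -> R[i]) :
  Normc.normc (\prod_(i <- r | P i) F i) = \prod_(i <- r | P i) Normc.normc (F i).
Proof.
by elim/big_ind2 : _ => // [|a b c d <- <-]; rewrite ?Normc.normc1 ?Normc.normcM.
Qed.

Lemma normc_eq0 z : (Normc.normc z == 0) = (z == 0).
Proof. by apply/eqP/eqP => [/Normc.eq0_normc//|->]; rewrite Normc.normc0. Qed.

Lemma normc_gt0 z : (0 < Normc.normc z) = (z != 0).
Proof. by rewrite lt_def normc_ge0 andbT normc_eq0. Qed.

Lemma le_normcB z w : Normc.normc (z - w) <= Normc.normc z + Normc.normc w.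
Proof. by rewrite -(normcN w); exact: le_normcD. Qed.

Lemma normc_distC z w : Normc.normc (z - w) = Normc.normc (w - z).
Proof. by rewrite -normcN opprB. Qed.

Lemma ReM z w : complex.Re (z * w) = complex.Re z * complex.Re w - complex.Im z * complex.Im w.
Proof. by case: z; case: w. Qed.

Lemma ImM z w : complex.Im (z * w) = complex.Re z * complex.Im w + complex.Im z * complex.Re w.
Proof. by case: z => a b; case: w => c d /=; rewrite addrC. Qed.

Lemma ReD z w : complex.Re (z + w) = complex.Re z + complex.Re w.
Proof. by case: z; case: w. Qed.
Lemma ImD z w : complex.Im (z + w) = complex.Im z + complex.Im w.
Proof. by case: z; case: w. Qed.
Lemma ReN z : complex.Re (- z) = - complex.Re z.
Proof. by case: z. Qed.
Lemma ImN z : complex.Im (- z) = - complex.Im z.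
Proof. by case: z. Qed.

Lemma Re_sum (I : Type) (r : seq I) (P : pred I) (F : I -> R[i]) :
  complex.Re (\sum_(i <- r | P i) F i) = \sum_(i <- r | P i) complex.Re (F i).
Proof. by elim/big_ind2 : _ => // a b c d <- <-; rewrite ReD. Qed.

Lemma complex_ext z w : complex.Re z = complex.Re w -> complex.Im z = complex.Im w -> z = w.
Proof. by case: z => a b; case: w => c d /= -> ->. Qed.

Definition cexp z : R[i] :=
  Complex (expR (complex.Re z) * cos (complex.Im z)) (expR (complex.Re z) * sin (complex.Im z)).

Lemma cexpD z w : cexp (z + w) = cexp z * cexp w.
Proof.
apply: complex_ext; rewrite ?(ReM, ImM) /= ReD ImD expRD ?cosD ?sinD; ring.
Qed.

Lemma cexp0 : cexp 0 = 1.
Proof. by apply: complex_ext => /=; rewrite expR0 ?cos0 ?sin0 mul1r. Qed.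

Lemma normc_cexp z : Normc.normc (cexp z) = expR (complex.Re z).
Proof.
apply/eqP; rewrite -(@eqrXn2 _ 2) ?normc_ge0 ?expR_ge0// normc_sqr /= !exprMn -mulrDr.
by rewrite cos2Dsin2 mulr1.
Qed.

Lemma cexp_real (x : R) : cexp x%:C%C = (expR x)%:C%C.
Proof. by apply: complex_ext => /=; rewrite ?cos0 ?sin0 ?mulr1 ?mulr0. Qed.

Lemma cexpMn z n : cexp (n%:R * z) = cexp z ^+ n.
Proof.
elim: n => [|n IH]; first by rewrite mul0r cexp0 expr0.
by rewrite -natr1 mulrDl mul1r cexpD IH exprSr.
Qed.

Lemma le_derive01 (g dg : R -> R) (M : R) :
  (forall s : R, 0 <= s <= 1 -> is_derive s 1 g (dg s)) -> g 0 = 0 ->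
  (forall s, 0 <= s <= 1 -> `|dg s| <= M) -> `|g 1| <= M.
Proof.
move=> dgE g0 dgM.
have dg01 (x : R) : x \in `]0, 1[ -> is_derive x 1 g (dg x).
  by rewrite in_itv/= => /andP[/ltW x0 /ltW x1]; apply: dgE; rewrite x0 x1.
have gc : {within `[0, 1], continuous g}.
  apply: continuous_in_subspaceT => x; rewrite inE/= in_itv/= => x01.
  by apply/differentiable_continuous/derivable1_diffP; have [] := dgE _ x01.
have [c c01] := MVT ltr01 dg01 gc.
rewrite g0 !subr0 mulr1 => ->; apply: dgM.
by move: c01; rewrite in_itv/= => /andP[/ltW -> /ltW ->].
Qed.


Definition rem1 z := cexp z - 1.
Definition rem2 z := cexp z - 1 - z.
Definition rem3 z := cexp z - 1 - z - z ^+ 2 / 2.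

Lemma scaleRE (a b : R) : a *: (b : R^o) = a * b.
Proof. by []. Qed.

Lemma is_derive_Re_cexp (c z : R[i]) (s : R) :
  is_derive s 1 (fun s : R => complex.Re (c * cexp (s%:C%C * z)))
    (complex.Re (c * z * cexp (s%:C%C * z))).
Proof.
have -> : (fun s : R => complex.Re (c * cexp (s%:C%C * z))) =
  (fun s : R => expR (s * complex.Re z) * (complex.Re c * cos (s * complex.Im z) - complex.Im c * sin (s * complex.Im z))).
  apply/funext => t; rewrite ReM /= ReM ImM /= !mul0r subr0 addr0; ring.
apply: is_derive_eq; rewrite !ReM !ImM /= !ReM !ImM /=.
rewrite !scaleRE !mul0r !subr0 !addr0; ring.
Qed.

(** Differentiating a Taylor remainder along the segment from [0] to [z] gives
    the remainder of the next lower order, so each bound follows from the previous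
    one by the mean value inequality. *)
Lemma Re_rem_bound (k : nat) (c z : R[i]) : (k < 4)%N ->
  `|complex.Re (c * (if k is 0 then cexp z else if k is 1 then rem1 z else if k is 2 then rem2 z else rem3 z))|
  <= Normc.normc c * Normc.normc z ^+ k * expR (Normc.normc z).
Proof.
have b0 c' z' : `|complex.Re (c' * cexp z')| <= Normc.normc c' * expR (Normc.normc z').
  apply: le_trans (normr_Re_le _) _; rewrite Normc.normcM normc_cexp.
  rewrite ler_wpM2l ?normc_ge0// ler_expR.
  exact: le_trans (ler_norm _) (normr_Re_le _).
have nsz (s : R) z' : 0 <= s <= 1 -> Normc.normc (s%:C%C * z') <= Normc.normc z'.
  move=> /andP[s0 s1]; rewrite Normc.normcM normc_real ger0_norm//.
  by rewrite ler_piMl ?normc_ge0.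
have b1 c' z' : `|complex.Re (c' * rem1 z')| <= Normc.normc c' * Normc.normc z' * expR (Normc.normc z').
  pose g (s : R) := complex.Re (c' * cexp (s%:C%C * z')) - complex.Re c'.
  have -> : complex.Re (c' * rem1 z') = g 1.
    by rewrite /g /rem1 mul1r !ReM /= ?ReD ?ImD /=; ring.
  apply: (@le_derive01 g (fun s : R => complex.Re (c' * z' * cexp (s%:C%C * z')))).
  - move=> s _; rewrite /g; have ? := is_derive_Re_cexp c' z' s.
    by apply: is_derive_eq; rewrite subr0.
  - by rewrite /g mul0r cexp0 mulr1 subrr.
  - move=> s s01; apply: le_trans (b0 _ _) _; rewrite Normc.normcM.
    by rewrite ler_wpM2l ?mulr_ge0 ?normc_ge0// ler_expR nsz.
have b2 c' z' : `|complex.Re (c' * rem2 z')| <= Normc.normc c' * Normc.normc z' ^+ 2 * expR (Normc.normc z').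
  pose g (s : R) := complex.Re (c' * cexp (s%:C%C * z')) - complex.Re c' - s * complex.Re (c' * z').
  have -> : complex.Re (c' * rem2 z') = g 1.
    have -> : c' * rem2 z' = c' * cexp z' - c' - c' * z' by rewrite /rem2; ring.
    by rewrite /g !mul1r !ReD !ReN.
  apply: (@le_derive01 g (fun s : R => complex.Re (c' * z' * rem1 (s%:C%C * z')))).
  - move=> s _; rewrite /g; have ? := is_derive_Re_cexp c' z' s.
    apply: is_derive_eq; rewrite /rem1 !scaleRE !ReM /= !ReM /=; ring.
  - by rewrite /g mul0r cexp0 mulr1 subrr mul0r subrr.
  - move=> s s01; apply: le_trans (b1 _ _) _; rewrite Normc.normcM expr2 !mulrA.
    apply: ler_pM; rewrite ?mulr_ge0 ?normc_ge0 ?expR_ge0 ?ler_expR ?nsz//.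
    by rewrite ler_wpM2l ?mulr_ge0 ?normc_ge0 ?nsz.
case: k => [|[|[|[|//]]]] _; rewrite ?expr0 ?expr1 ?mulr1//.
pose g (s : R) := complex.Re (c * cexp (s%:C%C * z)) - complex.Re c - s * complex.Re (c * z) - s * s * complex.Re (c * z ^+ 2) / 2.
have -> : complex.Re (c * rem3 z) = g 1.
  have -> : c * rem3 z = c * cexp z - c - c * z - 2^-1%:C%C * (c * z ^+ 2).
    by rewrite /rem3 fmorphV rmorph_nat; field.
  rewrite /g !mul1r !ReD !ReN (ReM (_%:C)%C) /= ; ring.
apply: (@le_derive01 g (fun s : R => complex.Re (c * z * rem2 (s%:C%C * z)))).
- move=> s _; rewrite /g; have ? := is_derive_Re_cexp c z s.
  apply: is_derive_eq.
  have -> : c * z * rem2 (s%:C%C * z) = c * z * cexp (s%:C%C * z) - c * z - s%:C%C * (c * z ^+ 2).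
    by rewrite /rem2; ring.
  by rewrite !scaleRE !ReD !ReN (ReM (_%:C)%C) /=; field.
- by rewrite /g mul0r cexp0 mulr1 subrr !mul0r !subr0.
- move=> s s01; apply: le_trans (b2 _ _) _; rewrite Normc.normcM exprS !mulrA.
  apply: ler_pM; rewrite ?mulr_ge0 ?exprn_ge0 ?normc_ge0 ?expR_ge0 ?ler_expR ?nsz//.
  by rewrite expr1 !ler_pM ?mulr_ge0 ?normc_ge0 ?nsz.
Qed.

(** Lets complex remainders be bounded through real functions of one variable. *)
Lemma normc_le_Re2 (w : R[i]) (M : R) :
  (forall c, `|complex.Re (c * w)| <= Normc.normc c * M) -> Normc.normc w <= 2 * M.
Proof.
move=> h; apply: le_trans (normc_le_ReIm _) _; rewrite mulr2n mulrDl mul1r lerD//.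
  by have := h 1; rewrite mul1r Normc.normc1 mul1r.
have := h (Complex 0 1); rewrite ReM /= mul0r sub0r mul1r normrN.
by rewrite expr0n expr1n add0r sqrtr1 mul1r.
Qed.

Lemma cexp_taylor1 z : Normc.normc (cexp z - 1) <= 2 * (Normc.normc z * expR (Normc.normc z)).
Proof. by apply: normc_le_Re2 => c; have := @Re_rem_bound 1 c z isT; rewrite expr1 mulrA. Qed.

Lemma cexp_taylor2 z : Normc.normc (cexp z - 1 - z) <= 2 * (Normc.normc z ^+ 2 * expR (Normc.normc z)).
Proof. by apply: normc_le_Re2 => c; have := @Re_rem_bound 2 c z isT; rewrite mulrA. Qed.

Lemma cexp_taylor3 z :
  Normc.normc (cexp z - 1 - z - z ^+ 2 / 2) <= 2 * (Normc.normc z ^+ 3 * expR (Normc.normc z)).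
Proof. by apply: normc_le_Re2 => c; have := @Re_rem_bound 3 c z isT; rewrite mulrA. Qed.

Lemma normc_subXX z w n (M : R) : Normc.normc z <= M -> Normc.normc w <= M ->
  Normc.normc (z ^+ n - w ^+ n) <= n%:R * Normc.normc (z - w) * M ^+ n.-1.
Proof.
move=> zM wM; rewrite subrXX Normc.normcM mulrAC mulrC ler_wpM2r ?normc_ge0//.
apply: le_trans (normc_sum _ _ _) _.
apply: (@le_trans _ _ (\sum_(i < n) M ^+ n.-1)); last by rewrite sumr_const card_ord mulr_natl.
apply: ler_sum => i _; rewrite Normc.normcM !normcX.
have -> : M ^+ n.-1 = M ^+ (n.-1 - i) * M ^+ i.
  by rewrite -exprD subnK// -ltnS prednK//; case: n i => // -[].
by rewrite ler_pM ?exprn_ge0 ?normc_ge0// lerXn2r ?nnegrE ?normc_ge0 ?(le_trans (normc_ge0 _) zM)// .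
Qed.

(** Both sides are [n]-th powers, of [exp (z / n)] and of [1 + z / n], which differ
    by [O (1 / n^2)]. *)
Lemma cexp_lim z n : (0 < n)%N ->
  Normc.normc (cexp z - (1 + z / n%:R) ^+ n) <=
  2 * Normc.normc z ^+ 2 * expR (2 * Normc.normc z) / n%:R.
Proof.
move=> n0; have nR : (0 : R) < n%:R by rewrite ltr0n.
have nC : (n%:R : R[i]) != 0 by rewrite pnatr_eq0 -lt0n.
set a := Normc.normc z.
have nz : Normc.normc (z / n%:R) = a / n%:R.
  by rewrite Normc.normcM Normc.normcV -(rmorph_nat (real_complex R)) normc_real normr_nat.
have a0 : 0 <= a by exact: normc_ge0.
have -> : cexp z = cexp (z / n%:R) ^+ n by rewrite -cexpMn mulrC divfK.
apply: le_trans (@normc_subXX _ _ n (expR (a / n%:R)) _ _) _.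
- rewrite normc_cexp ler_expR -nz; exact: le_trans (ler_norm _) (normr_Re_le _).
- apply: le_trans (le_normcD _ _) _; rewrite Normc.normc1 nz; exact: expR_ge1Dx.
apply: (@le_trans _ _ (n%:R * (2 * ((a / n%:R) ^+ 2 * expR (a / n%:R))) * expR (a / n%:R) ^+ n.-1)).
  rewrite ler_wpM2r ?exprn_ge0 ?expR_ge0// ler_wpM2l ?ler0n//.
  have := cexp_taylor2 (z / n%:R); rewrite nz; apply: le_trans.
  by rewrite opprD addrA.
have -> : n%:R * (2 * ((a / n%:R) ^+ 2 * expR (a / n%:R))) * expR (a / n%:R) ^+ n.-1 =
          2 * a ^+ 2 / n%:R * expR a.
  have -> : expR a = expR (a / n%:R) * expR (a / n%:R) ^+ n.-1.
    by rewrite -exprS prednK// -expRM_natl mulrC divfK// gt_eqF.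
  by field; rewrite gt_eqF.
rewrite mulrAC ler_wpM2r ?invr_ge0 ?ler0n// ler_wpM2l ?mulr_ge0 ?exprn_ge0// ler_expR.
by rewrite ler_peMl// ler1n.
Qed.

End ComplexModulus.

(** * Logarithmic sums of the sine product *)

Section SineProduct.
Context {R : realType}.

Lemma atan_inv (x : R) : 0 < x -> atan x^-1 = pi / 2 - atan x.
Proof.
move=> x0; have a0 : 0 < atan x by rewrite -atan0 lt_atan.
have a1 := atan_ltpi2 x.
have sx : 0 < sin (atan x) by apply: sin_gt0_pihalf; rewrite a0 a1.
have cx : 0 < cos (atan x) by apply: cos_gt0_pihalf; rewrite atan_gtNpi2 a1.
have -> : x^-1 = tan (pi / 2 - atan x).
  rewrite -{1}(atanK x) /tan.
  rewrite -(opprB (atan x)) cosN sinN cosBpihalf sinBpihalf opprK invf_div //.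
by apply: tanK; rewrite in_itv /=; have := @pi_gt0 R; move: a0 a1; lra.
Qed.

Lemma atan_ge0 (x : R) : 0 <= x -> 0 <= atan x.
Proof. by move=> x0; rewrite -atan0 le_atan. Qed.

Lemma le0_of_derive (g dg : R -> R) : g 0 = 0 ->
  (forall x : R, is_derive x 1 g (dg x)) -> (forall x, 0 <= x -> 0 <= dg x) ->
  forall x, 0 <= x -> 0 <= g x.
Proof.
move=> g0 dgE dg0 x; rewrite le_eqVlt => /orP[/eqP<-|x0]; first by rewrite g0.
have gE (y : R) : y \in `]0, x[ -> is_derive y 1 g (dg y) by [].
have gc : {within `[0, x], continuous g}.
  apply: continuous_subspaceT => y.
  by apply/differentiable_continuous/derivable1_diffP; have [] := dgE y.
have [c c01] := MVT x0 gE gc; rewrite g0 !subr0 => ->.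
by move: c01; rewrite in_itv/= => /andP[/ltW c0 _]; rewrite mulr_ge0 ?dg0// ltW.
Qed.

Lemma atan_le (x : R) : 0 <= x -> atan x <= x.
Proof.
move=> x0; rewrite -subr_ge0.
apply: (@le0_of_derive (fun x => x - atan x) (fun x => 1 - (1 + x ^+ 2)^-1)) => //.
- by rewrite atan0 subr0.
- by move=> y _; rewrite subr_ge0 invf_le1 ?lerDl ?sqr_ge0// ltr_pwDl ?sqr_ge0.
Qed.

Lemma is_derive_comp_ln (g : R -> R) (dg x : R) : 0 < g x -> is_derive x 1 g dg ->
  is_derive x 1 (fun y => ln (g y)) (dg / g x).
Proof.
move=> gx h; have h2 := is_derive1_ln gx.
have := is_derive1_comp h2 h; by rewrite mulrC.
Qed.

Lemma is_derive_comp_atan (g : R -> R) (dg x : R) : is_derive x 1 g dg ->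
  is_derive x 1 (fun y => atan (g y)) (dg / (1 + g x ^+ 2)).
Proof.
move=> h; have h2 := is_derive1_atan (g x).
have := is_derive1_comp h2 h; by rewrite mulrC.
Qed.

Lemma ln1sqr_le (u : R) : 0 <= u -> ln (1 + u ^+ 2) <= 2 * u * atan u.
Proof.
move=> u0; rewrite -subr_ge0.
apply: (@le0_of_derive (fun x => 2 * x * atan x - ln (1 + x ^+ 2)) (fun x => 2 * atan x)); last exact: u0.
- by rewrite mulr0 mul0r expr0n addr0 ln1 subr0.
- move=> y; have ? := is_derive1_atan y.
  have y1 : 0 < 1 + y ^+ 2 by rewrite ltr_pwDl ?sqr_ge0.
  have h : is_derive y 1 (fun x : R => 1 + x ^+ 2) (2 * y).
    by apply: is_derive_eq; rewrite !scaleRE; ring.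
  have ? := is_derive_comp_ln (g := fun x : R => 1 + x ^+ 2) y1 h.
  apply: is_derive_eq; rewrite !scaleRE; field; by rewrite gt_eqF.
- by move=> x x0; rewrite mulr_ge0// atan_ge0.
Qed.

(** The primitive of [ln (1 + s^2/x^2)], with limit [pi * s] at infinity. *)
Definition lnprim (s x : R) := x * ln (1 + s ^+ 2 / x ^+ 2) + 2 * s * atan (x / s).

Lemma is_derive_lnprim (s x : R) : 0 < s -> 0 < x ->
  is_derive x 1 (lnprim s) (ln (1 + s ^+ 2 / x ^+ 2)).
Proof.
move=> s0 x0; rewrite /lnprim.
have y1 : 0 < 1 + s ^+ 2 / x ^+ 2 by rewrite ltr_pwDl ?divr_ge0 ?sqr_ge0.
have x2 : x ^+ 2 != 0 by rewrite expf_neq0 ?gt_eqF.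
have h : is_derive x 1 (fun x : R => 1 + s ^+ 2 / x ^+ 2) (- (2 * s ^+ 2 / x ^+ 3)).
  have ? : is_derive x 1 (fun x : R => (x ^+ 2)^-1) (- (x ^+ 2) ^- 2 *: (2 * x)).
    have hh : is_derive x 1 (fun x : R => x ^+ 2) (2 * x).
      by apply: is_derive_eq; rewrite !scaleRE; ring.
    exact: is_deriveV.
  apply: is_derive_eq; rewrite !scaleRE; by field; rewrite gt_eqF.
have ? := is_derive_comp_ln (g := fun x : R => 1 + s ^+ 2 / x ^+ 2) y1 h.
have h3 : is_derive x 1 (fun x : R => x / s) s^-1.
  by apply: is_derive_eq; rewrite !scaleRE; ring.
have ? := is_derive_comp_atan (g := fun x : R => x / s) h3.
apply: is_derive_eq; rewrite !scaleRE; field.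
rewrite !gt_eqF//= ?addr_gt0 ?exprn_gt0//.
Qed.

Lemma lnprim_step (s x : R) : 0 < s -> 0 < x ->
  ln (1 + s ^+ 2 / (x + 1) ^+ 2) <= lnprim s (x + 1) - lnprim s x <= ln (1 + s ^+ 2 / x ^+ 2).
Proof.
move=> s0 x0; have xx : x < x + 1 by rewrite ltrDl.
have gE (y : R) : y \in `]x, x + 1[ -> is_derive y 1 (lnprim s) (ln (1 + s ^+ 2 / y ^+ 2)).
  by rewrite in_itv/= => /andP[xy _]; apply: is_derive_lnprim => //; exact: lt_trans xy.
have gc : {within `[x, x + 1], continuous (lnprim s)}.
  apply: continuous_in_subspaceT => y; rewrite inE/= in_itv/= => /andP[xy _].
  apply/differentiable_continuous/derivable1_diffP.
  by have [] := is_derive_lnprim s0 (lt_le_trans x0 xy).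
have [c] := MVT xx gE gc; rewrite in_itv/= => /andP[xc cx] ->.
have c0 : 0 < c by exact: lt_trans xc.
have p (y : R) : 0 < y -> 1 + s ^+ 2 / y ^+ 2 \is Num.pos.
  by move=> y0; rewrite posrE ltr_pwDl ?divr_ge0 ?sqr_ge0.
rewrite addrAC subrr add0r mulr1 !ler_ln ?p ?addr_gt0// !lerD2l.
rewrite !ler_pM2l ?exprn_gt0// !lef_pV2 ?posrE ?exprn_gt0 ?addr_gt0// .
by rewrite !ler_pXn2r ?nnegrE ?ltW ?addr_gt0.
Qed.

(** The sum is at most the integral of the decreasing function
    [ln (1 + s^2 / x^2)] over the half-line. As [n] grows it increases to the
    logarithm of [sinh (pi s) / (pi s)], by the sine product. *)
Lemma sum_ln_le (s : R) n : 0 <= s ->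
  \sum_(1 <= j < n.+1) ln (1 + s ^+ 2 / j%:R ^+ 2) <= pi * s.
Proof.
rewrite le_eqVlt => /orP[/eqP<-|s0].
  by rewrite big1 ?mulr0// => j _; rewrite expr0n/= mul0r addr0 ln1.
case: n => [|n]; first by rewrite big_geq// mulr_ge0 ?pi_ge0 ?ltW.
have : \sum_(1 <= j < n.+2) ln (1 + s ^+ 2 / j%:R ^+ 2) <= lnprim s n.+1%:R.
  elim: n => [|n IH].
    rewrite big_nat1 /lnprim expr1n divr1 mul1r lerDl mulr_ge0 ?atan_ge0 ?divr_ge0 ?mulr_ge0 ?ltW//.
  rewrite big_nat_recr//= -lerBrDr; apply: le_trans IH _.
  have n0 : (0 : R) < n.+1%:R by rewrite ltr0n.
  by have /andP[h _] := lnprim_step s0 n0; move: h; rewrite (natr1 n.+1); lra.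
move=> /le_trans; apply; rewrite /lnprim.
have n0 : (0 : R) < n.+1%:R by rewrite ltr0n.
have := atan_inv (divr_gt0 s0 n0); rewrite invf_div => ->.
have := ln1sqr_le (ltW (divr_gt0 s0 n0)); rewrite expr_div_n => h.
have := ler_wpM2l (ltW n0) h.
have -> : n.+1%:R * (2 * (s / n.+1%:R) * atan (s / n.+1%:R)) = 2 * s * atan (s / n.+1%:R).
  by field; rewrite gt_eqF.
lra.
Qed.

(** The loss against [pi * s] consists of the tail of that integral beyond [n] and
    of its part near [0]. *)
Lemma sum_ln_ge (s : R) n : 0 < s -> (0 < n)%N ->
  pi * s - 2 * s ^+ 2 / n%:R - ln (1 + s ^+ 2) - 2 <=
  \sum_(1 <= j < n.+1) ln (1 + s ^+ 2 / j%:R ^+ 2).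
Proof.
move=> s0 n0; have nR : (0 : R) < n%:R by rewrite ltr0n.
have h m : lnprim s m.+1%:R - lnprim s 1 <= \sum_(1 <= j < m.+1) ln (1 + s ^+ 2 / j%:R ^+ 2).
  elim: m => [|m IH]; first by rewrite big_geq// subrr.
  rewrite big_nat_recr//=.
  have m0 : (0 : R) < m.+1%:R by rewrite ltr0n.
  by have /andP[_ h] := lnprim_step s0 m0; move: h IH; rewrite (natr1 m.+1); lra.
apply: le_trans (h n).
have h1 : lnprim s 1 <= ln (1 + s ^+ 2) + 2.
  rewrite /lnprim expr1n divr1 mul1r lerD2l.
  have := atan_le (ltW (divr_gt0 ltr01 s0)) => /(ler_wpM2l (ltW s0)).
  rewrite div1r mulfV ?gt_eqF// -mulrA; lra.
have h2 : lnprim s n%:R <= lnprim s n.+1%:R.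
  have /andP[h2 _] := lnprim_step s0 nR; rewrite -subr_ge0 -natr1.
  by apply: le_trans h2; rewrite ln_ge0// lerDl divr_ge0 ?sqr_ge0.
have h3 : pi * s - 2 * s ^+ 2 / n%:R <= lnprim s n%:R.
  rewrite /lnprim; have := atan_inv (divr_gt0 s0 nR); rewrite invf_div => ->.
  have := atan_le (ltW (divr_gt0 s0 nR)) => /(ler_wpM2l (ltW s0)) h3.
  have h4 : 0 <= n%:R * ln (1 + s ^+ 2 / n%:R ^+ 2).
    by rewrite mulr_ge0 ?ler0n// ln_ge0// lerDl divr_ge0 ?sqr_ge0.
  have -> : 2 * s ^+ 2 / n%:R = 2 * (s * (s / n%:R)) by ring.
  by move: h3 h4; lra.
by move: h1 h2 h3; lra.
Qed.

End SineProduct.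

(** * Harmonicity to second order *)

Section Harmonic.
Context {R : realType}.
Implicit Types (h g : R[i] -> R) (z w : R[i]).

(** Second order contact with the real part of a holomorphic function: all that
    the four-point maximum principle below uses of harmonicity. *)
Definition harmonic_at h z := exists a1 a2 : R[i], exists C r0 : R,
  [/\ 0 < r0, 0 <= C & forall k, Normc.normc k <= r0 ->
   `|h (z + k) - h z - complex.Re (a1 * k + a2 * k ^+ 2)| <= C * Normc.normc k ^+ 3].

Lemma harmonic_atD h g z : harmonic_at h z -> harmonic_at g z ->
  harmonic_at (fun w => h w + g w) z.
Proof.
move=> [a1 [a2 [C [r [r0 C0 hh]]]]] [b1 [b2 [D [s [s0 D0 hg]]]]].
exists (a1 + b1), (a2 + b2), (C + D), (Order.min r s).
split; [by rewrite lt_min r0 s0|exact: addr_ge0|move=> k].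
rewrite le_min => /andP[/hh h1 /hg h2].
have -> : (a1 + b1) * k + (a2 + b2) * k ^+ 2 = (a1 * k + a2 * k ^+ 2) + (b1 * k + b2 * k ^+ 2) by ring.
rewrite ReD.
set x := complex.Re _ in h1 *; set y := complex.Re _ in h2 *.
have -> : h (z + k) + g (z + k) - (h z + g z) - (x + y) =
  (h (z + k) - h z - x) + (g (z + k) - g z - y) by ring.
by rewrite mulrDl; exact: le_trans (ler_normD _ _) (lerD h1 h2).
Qed.

Lemma harmonic_atZ (c : R) h z : harmonic_at h z -> harmonic_at (fun w => c * h w) z.
Proof.
move=> [a1 [a2 [C [r [r0 C0 hh]]]]].
exists (c%:C%C * a1), (c%:C%C * a2), (`|c| * C), r.
split => //; first by rewrite mulr_ge0.
move=> k /hh h1; rewrite -!mulrA -mulrDr ReM /= mul0r subr0 -!mulrBr normrM.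
by rewrite ler_wpM2l.
Qed.

Lemma harmonic_at_cst (c : R) z : harmonic_at (fun=> c) z.
Proof.
exists 0, 0, 0, 1; split => // k _.
by rewrite !mul0r addr0 /= subr0 subrr normr0.
Qed.

Lemma harmonic_at_sum (I : Type) (s : seq I) (F : I -> R[i] -> R) z :
  (forall i, harmonic_at (F i) z) -> harmonic_at (fun w => \sum_(i <- s) F i w) z.
Proof.
move=> hF; elim: s => [|i s IH].
  have -> : (fun w => \sum_(i <- [::]) F i w) = fun=> 0 by apply/funext => w; rewrite big_nil.
  exact: harmonic_at_cst.
have -> : (fun w => \sum_(i <- i :: s) F i w) = fun w => F i w + \sum_(i <- s) F i w.
  by apply/funext => w; rewrite big_cons.
exact: harmonic_atD.
Qed.

Lemma harmonic_at_sum_seq (I : eqType) (s : seq I) (F : I -> R[i] -> R) z :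
  {in s, forall i, harmonic_at (F i) z} -> harmonic_at (fun w => \sum_(i <- s) F i w) z.
Proof.
move=> hF.
have -> : (fun w => \sum_(i <- s) F i w) = (fun w => \sum_(i <- s) if i \in s then F i w else 0).
  by apply/funext => w; rewrite big_seq [RHS]big_seq; apply: eq_bigr => i ->.
apply: harmonic_at_sum => i; case: (boolP (i \in s)) => [/hF//|_]; exact: harmonic_at_cst.
Qed.

Lemma harmonic_at_Re_sqr z : harmonic_at (fun w => complex.Re (w ^+ 2)) z.
Proof.
exists (2 * z), 1, 0, 1; split => // k _.
have -> : (z + k) ^+ 2 = z ^+ 2 + (2 * z * k + 1 * k ^+ 2) by ring.
by rewrite ReD mul0r [X in `|X|](_ : _ = 0) ?normr0//; ring.
Qed.

Lemma ln1D_taylor (s : R) : `|s| <= 3 / 4 -> `|ln (1 + s) - s + s ^+ 2 / 2| <= 4 * `|s| ^+ 3.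
Proof.
move=> s1.
have sp t : 0 <= t <= 1 -> 4^-1 <= 1 + t * s.
  move=> /andP[t0 t1]; have : `|t * s| <= 3 / 4.
    by rewrite normrM ger0_norm//; apply: le_trans s1; rewrite ler_piMl.
  by rewrite ler_norml => /andP[]; lra.
pose g (t : R) := ln (1 + t * s) - t * s + t * t * s ^+ 2 / 2.
have -> : ln (1 + s) - s + s ^+ 2 / 2 = g 1 by rewrite /g !mul1r.
apply: (@le_derive01 _ g (fun t : R => t * t * s ^+ 3 / (1 + t * s))).
- move=> t /sp t01; rewrite /g.
  have t0 : 0 < 1 + t * s by apply: lt_le_trans t01; rewrite invr_gt0.
  have hd : is_derive t 1 (fun t : R => 1 + t * s) s.
    by apply: is_derive_eq; rewrite !scaleRE; ring.
  have ? := is_derive_comp_ln (g := fun t : R => 1 + t * s) t0 hd.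
  by apply: is_derive_eq; rewrite !scaleRE; field; rewrite gt_eqF.
- by rewrite /g !mul0r !addr0 subr0 ln1.
- move=> t t01; have t4 := sp _ t01; have t0 : 0 < 1 + t * s by apply: lt_le_trans t4; rewrite invr_gt0.
  rewrite normrM normfV (gtr0_norm t0) ler_pdivrMr// normrM normrX.
  apply: (@le_trans _ _ (`|s| ^+ 3)).
    rewrite ler_piMl ?exprn_ge0// normrM.
    by case/andP: t01 => t0' t1; rewrite !ger0_norm// mulr_ile1.
  have : 0 <= `|s| ^+ 3 by rewrite exprn_ge0.
  set S := _ ^+ 3; move: t4; nra.
Qed.

Lemma ln_normc1D_taylor z : Normc.normc z <= 4^-1 ->
  `|ln (Normc.normc (1 + z)) - complex.Re (z - z ^+ 2 / 2)| <= 30 * Normc.normc z ^+ 3.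
Proof.
set t := Normc.normc z => t4.
have t0 : 0 <= t by exact: normc_ge0.
have nz : t ^+ 2 = complex.Re z ^+ 2 + complex.Im z ^+ 2 by exact: normc_sqr.
have rz : `|complex.Re z| <= t by exact: normr_Re_le.
pose s := 2 * complex.Re z + t ^+ 2.
have rz' := rz; move: rz'; rewrite ler_norml => /andP[rz1 rz2].
have s3 : `|s| <= 9 / 4 * t by rewrite /s ler_norml; apply/andP; split; nra.
have s34 : `|s| <= 3 / 4 by apply: le_trans s3 _; lra.
have -> : ln (Normc.normc (1 + z)) = ln (1 + s) / 2.
  have -> : 1 + s = Normc.normc (1 + z) ^+ 2.
    by rewrite normc_sqr ReD ImD /= /s nz; ring.
  have np : 0 < Normc.normc (1 + z).
    rewrite lt_def normc_ge0 andbT; apply/negP => /eqP h.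
    have : `|complex.Re (1 + z)| <= 0 by rewrite -h; exact: normr_Re_le.
    by rewrite ReD /= ler_norml; lra.
  by rewrite lnXn// mulrnAl mulr2n; field.
have -> : complex.Re (z - z ^+ 2 / 2) = (s - s ^+ 2 / 2) / 2 + (complex.Re z * t ^+ 2 + t ^+ 4 / 4).
  have -> : z - z ^+ 2 / 2 = z - 2^-1%:C%C * z ^+ 2 by rewrite fmorphV rmorph_nat mulrC.
  rewrite ReD ReN expr2 ReM /= mul0r subr0 ReM.
  have -> : t ^+ 4 = t ^+ 2 * t ^+ 2 by ring.
  have hi : complex.Im z * complex.Im z = t ^+ 2 - complex.Re z ^+ 2 by rewrite nz; ring.
  by rewrite hi /s; field.
set A := ln _; set B := complex.Re z * _ + _.
have -> : A / 2 - ((s - s ^+ 2 / 2) / 2 + B) = (A - s + s ^+ 2 / 2) / 2 - B by field.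
have h1 := ln1D_taylor s34; rewrite -/A in h1.
have h2 : `|B| <= 2 * t ^+ 3.
  rewrite /B; apply: le_trans (ler_normD _ _) _.
  have : `|complex.Re z * t ^+ 2| <= t ^+ 3.
    by rewrite normrM (ger0_norm (sqr_ge0 _)) exprS ler_wpM2r ?sqr_ge0.
  have : `|t ^+ 4 / 4| <= t ^+ 3.
    rewrite ger0_norm ?divr_ge0 ?exprn_ge0//.
    have -> : t ^+ 4 / 4 = t ^+ 3 * (t / 4) by ring.
    rewrite ler_piMr ?exprn_ge0//; lra.
  lra.
have h3 : `|s| ^+ 3 <= (9 / 4 * t) ^+ 3 by rewrite lerXn2r ?nnegrE ?mulr_ge0.
apply: le_trans (ler_normB _ _) _; rewrite normrM (@ger0_norm _ 2^-1)//.
rewrite exprMn in h3; have : 0 <= t ^+ 3 by rewrite exprn_ge0.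
move: h1 h2 h3; set T := t ^+ 3; set S := `|s| ^+ 3; lra.
Qed.

(** [w^2 + b = (z^2 + b) (1 + u)] with [u] small and quadratic in [w - z]. *)
Lemma harmonic_at_ln (b : R[i]) z : z ^+ 2 + b != 0 ->
  harmonic_at (fun w => ln (Normc.normc (w ^+ 2 + b))) z.
Proof.
set q := z ^+ 2 + b => q0.
have nq : 0 < Normc.normc q by rewrite normc_gt0.
set Z := Normc.normc z; have Z0 : 0 <= Z by exact: normc_ge0.
pose Q := Normc.normc q.
pose L := (2 * Z + 1) / Q.
have L0 : 0 < L by rewrite divr_gt0// ltr_wpDl ?mulr_ge0.
exists (2 * z / q), (q^-1 - 2 * z ^+ 2 / q ^+ 2), (30 * L ^+ 3 + (4 * Z + 1) / Q ^+ 2), (Order.min 1 (4^-1 / L)).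
split.
- by rewrite lt_min ltr01 divr_gt0// invr_gt0.
- by rewrite addr_ge0 ?mulr_ge0 ?exprn_ge0 ?(ltW L0) ?invr_ge0 ?exprn_ge0 ?(ltW nq)// addr_ge0 ?mulr_ge0.
move=> k; rewrite le_min => /andP[k1 kL].
set t := Normc.normc k in k1 kL *; have t0 : 0 <= t by exact: normc_ge0.
pose u := (2 * z * k + k ^+ 2) / q.
have -> : (z + k) ^+ 2 + b = q * (1 + u).
  have qu : q * u = 2 * z * k + k ^+ 2 by rewrite /u mulrC divfK.
  by rewrite mulrDr mulr1 qu /q; ring.
have n2 : Normc.normc (2 : R[i]) = 2.
  by rewrite -(rmorph_nat (real_complex R)) normc_real normr_nat.
have ut : Normc.normc u <= L * t.
  rewrite /u Normc.normcM Normc.normcV -/Q /L [leRHS]mulrAC ler_pM2r ?invr_gt0//.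
  apply: le_trans (le_normcD _ _) _; rewrite normcX !Normc.normcM n2 -/Z -/t; nra.
have u4 : Normc.normc u <= 4^-1.
  by apply: le_trans ut _; move: kL; rewrite ler_pdivlMr// mulrC.
have -> : ln (Normc.normc (q * (1 + u))) - ln Q = ln (Normc.normc (1 + u)).
  rewrite Normc.normcM lnM ?posrE//; first by rewrite /Q addrAC subrr add0r.
  rewrite lt_def normc_ge0 andbT; apply/negP => /eqP h.
  have : `|complex.Re (1 + u)| <= 0 by rewrite -h; exact: normr_Re_le.
  have := normr_Re_le u.
  by rewrite ReD /= !ler_norml; lra.
have h1 := ln_normc1D_taylor u4.
have e1 : u - u ^+ 2 / 2 = (2 * z / q * k + (q^-1 - 2 * z ^+ 2 / q ^+ 2) * k ^+ 2) - (4 * z * k ^+ 3 + k ^+ 4) / 2 / q ^+ 2.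
  by rewrite /u; field.
set v := (4 * z * k ^+ 3 + k ^+ 4) / 2 / q ^+ 2 in e1.
have hv : Normc.normc v <= (4 * Z + 1) / Q ^+ 2 * t ^+ 3.
  have n4 : Normc.normc (4 : R[i]) = 4.
    by rewrite -(rmorph_nat (real_complex R)) normc_real normr_nat.
  rewrite /v !(normcX, Normc.normcM, Normc.normcV) n2 -/Q [leRHS]mulrAC ler_pM2r ?invr_gt0 ?exprn_gt0//.
  apply: (@le_trans _ _ (Normc.normc (4 * z * k ^+ 3 + k ^+ 4))).
    by rewrite ler_pdivrMr// ler_peMr ?normc_ge0// ler1n.
  apply: le_trans (le_normcD _ _) _; rewrite !(normcX, Normc.normcM) n4 -/Z -/t [leRHS]mulrDl mul1r.
  by rewrite lerD// exprS ler_piMl// exprn_ge0.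
rewrite e1 ReD ReN in h1.
set X := complex.Re (_ * k + _) in h1 *.
have -> : ln (Normc.normc (1 + u)) - X = (ln (Normc.normc (1 + u)) - (X - complex.Re v)) - complex.Re v by ring.
apply: le_trans (ler_normB _ _) _; rewrite mulrDl lerD//.
  apply: le_trans h1 _; rewrite -mulrA ler_wpM2l// -exprMn lerXn2r ?nnegrE ?normc_ge0//.
  by rewrite mulr_ge0// ltW.
exact: le_trans (normr_Re_le _) hv.
Qed.

End Harmonic.

(** * A maximum principle *)

Section MaximumPrinciple.
Context {R : realType}.
Implicit Types (h g N : R[i] -> R) (z w : R[i]).

Lemma normc_i : Normc.normc ('i : R[i])%C = 1.
Proof. by rewrite /= expr0n expr1n add0r sqrtr1. Qed.

(** The four-point sub-mean-value inequality, stable under multiplication by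
    moduli of nonvanishing holomorphic functions. For a seminorm of a
    holomorphic vector-valued function it follows from the vanishing of the sums
    of [i^k] and [i^(2k)], so no integration over circles is needed. *)
Definition submean N := forall z (a1 a2 : R[i]), exists C r0 : R, 0 < r0 /\
  forall r, 0 < r <= r0 ->
   N z <= 4^-1 * \sum_(k < 4) expR (complex.Re (a1 * ('i%C ^+ k * r%:C%C) + a2 * ('i%C ^+ k * r%:C%C) ^+ 2))
                 * N (z + 'i%C ^+ k * r%:C%C) + C * r ^+ 3.

Lemma expRN_le (x : R) : 0 <= x <= 1 -> expR (- x) <= 1 - x / 2.
Proof.
move=> /andP[x0 x1]; rewrite expRN.
apply: (@le_trans _ _ (1 + x)^-1).
  by rewrite lef_pV2 ?posrE ?expR_gt0 ?expR_ge1Dx// ltr_wpDr.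
rewrite -div1r ler_pdivrMr; last by rewrite ltr_wpDr.
nra.
Qed.

(** Multiplying by [exp h] preserves the averaging over the four points, and
    [d * |z|^2] adds a gain of order [d * r^2], which beats the errors [O (r^3)]. *)
Lemma no_local_max N h z (d : R) : submean N -> (forall w, 0 <= N w) ->
  harmonic_at h z -> 0 < d -> 0 < N z ->
  ~ exists2 r0, 0 < r0 & forall k, Normc.normc k <= r0 ->
    N (z + k) * expR (h (z + k) + d * Normc.normc (z + k) ^+ 2) <=
    N z * expR (h z + d * Normc.normc z ^+ 2).
Proof.
move=> sN N0 [a1 [a2 [C [r1 [r10 C0 hh]]]]] d0 Nz [r2 r20 hmax].
pose zc := conjc z.
pose b1 := a1 + (2 * d)%:C%C * zc.
have [C' [r3 [r30 hs]]] := sN z b1 a2.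
pose D : R := `|C'| + 1.
have D0 : 0 < D by rewrite ltr_wpDl.
pose r := \big[Order.min/r1]_(x <- [:: r2; r3; 1; d^-1; d / 2 / (C + 1); N z * d / 8 / D]) x.
have [r0 [e1 e2 e3 e4 [e5 e6 e7]]] : 0 < r /\ [/\ r <= r1, r <= r2, r <= r3, r <= 1 & [/\ r <= d^-1, r <= d / 2 / (C + 1) & r <= N z * d / 8 / D]].
  split.
    rewrite /r !big_cons big_nil !lt_min r10 r20 r30 ltr01 invr_gt0 d0 !divr_gt0 ?mulr_gt0//.
    by rewrite ltr_wpDl.
  by split; [..|split]; rewrite /r !big_cons big_nil !ge_min ?lexx ?orbT.
have {hs} := hs r; rewrite r0 e3 => /(_ isT).
apply/negP; rewrite -ltNge.
have nk (k : nat) : Normc.normc ('i%C ^+ k * r%:C%C : R[i]) = r.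
  by rewrite Normc.normcM normcX normc_i expr1n mul1r normc_real gtr0_norm.
pose x := d * r ^+ 2 - C * r ^+ 3.
have term (k : nat) : expR (complex.Re (b1 * ('i%C ^+ k * r%:C%C) + a2 * ('i%C ^+ k * r%:C%C) ^+ 2))
                 * N (z + 'i%C ^+ k * r%:C%C) <= N z * expR (- x).
  have := nk k; set kk := 'i%C ^+ k * _ => nkk.
  have h1 := hmax kk; have h2 := hh kk; rewrite nkk in h1 h2.
  have {}h1 := h1 e2; have {}h2 := h2 e1.
  have ez : Normc.normc (z + kk) ^+ 2 = Normc.normc z ^+ 2 + 2 * complex.Re (zc * kk) + r ^+ 2.
    rewrite -nkk !normc_sqr /zc; case: (z) => u v; case: (kk) => u' v' /=; ring.
  have h3 : N (z + kk) <= N z * expR (h z + d * Normc.normc z ^+ 2 - (h (z + kk) + d * Normc.normc (z + kk) ^+ 2)).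
    rewrite [X in _ * X]expRD mulrA expRN -ler_pdivrMr ?invr_gt0 ?expR_gt0// invrK //.
  rewrite mulrC; apply: le_trans (ler_wpM2r (expR_ge0 _) h3) _.
  rewrite -mulrA -expRD ler_wpM2l// ler_expR ez /b1.
  have -> : (a1 + (2 * d)%:C%C * zc) * kk + a2 * kk ^+ 2 = (a1 * kk + a2 * kk ^+ 2) + (2 * d)%:C%C * (zc * kk) by ring.
  rewrite ReD (ReM (_ * _)%:C%C) /= mul0r subr0 /x.
  move: h2; rewrite ler_norml => /andP[h2 _]; move: h2.
  set RA := complex.Re (a1 * _ + _); set RB := complex.Re (zc * _); lra.
apply: (@le_lt_trans _ _ (N z * expR (- x) + C' * r ^+ 3)).
  rewrite lerD2r; apply: (@le_trans _ _ (4^-1 * \sum_(k < 4) (N z * expR (- x)))).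
    rewrite ler_wpM2l ?invr_ge0//; apply: ler_sum => k _; exact: term.
  by rewrite sumr_const card_ord -[_ *+ 4]mulr_natl; set E := N z * _; lra.
have x1 : d * r ^+ 2 / 2 <= x.
  have : r * (C + 1) <= d / 2 by rewrite -ler_pdivlMr// ltr_wpDl.
  move=> /(ler_wpM2r (sqr_ge0 r)); rewrite /x !exprS expr0; nra.
have x2 : x <= 1.
  have h1 : r * d <= 1 by rewrite -ler_pdivlMr// div1r.
  have h2 : d * r ^+ 2 <= 1.
    have -> : d * r ^+ 2 = (r * d) * r by ring.
    by apply: mulr_ile1 => //; first exact: mulr_ge0 (ltW r0) (ltW d0); exact: ltW.
  have : 0 <= C * r ^+ 3 by rewrite mulr_ge0// exprn_ge0// ltW.
  by rewrite /x; lra.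
have x0 : 0 <= x by apply: le_trans x1; rewrite !mulr_ge0 ?sqr_ge0 ?invr_ge0// ltW.
have : expR (- x) <= 1 - x / 2 by apply: expRN_le; rewrite x0 x2.
move=> /(ler_wpM2l (ltW Nz)) h1.
have h2 : N z * (d * r ^+ 2 / 2) <= N z * x by rewrite ler_wpM2l ?N0.
have h3 : C' * r ^+ 3 < D * r ^+ 3.
  by rewrite ltr_pM2r ?exprn_gt0// (le_lt_trans (ler_norm _))// ltrDl.
have h4 : D * r ^+ 3 <= N z * d / 8 * r ^+ 2.
  have -> : D * r ^+ 3 = (r * D) * r ^+ 2 by ring.
  by rewrite ler_wpM2r ?sqr_ge0// -ler_pdivlMr.
have h5 : 0 < N z * d * r ^+ 2 by rewrite !mulr_gt0.
move: h1 h2 h3 h4 h5; lra.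
Qed.

Lemma harmonic_at_near h z (e : R) : harmonic_at h z -> 0 < e ->
  exists2 r, 0 < r & forall k, Normc.normc k <= r -> `|h (z + k) - h z| <= e.
Proof.
move=> [a1 [a2 [C [r1 [r10 C0 hh]]]]] e0.
pose A := Normc.normc a1 + Normc.normc a2 + C + 1.
have A0 : 0 < A by rewrite ltr_wpDl ?addr_ge0 ?normc_ge0.
exists (Order.min r1 (Order.min 1 (e / A))); first by rewrite !lt_min r10 ltr01 divr_gt0.
move=> k; rewrite !le_min => /and3P[k1 k2 k3].
have h1 := hh _ k1; have t0 := normc_ge0 k.
have -> : h (z + k) - h z = (h (z + k) - h z - complex.Re (a1 * k + a2 * k ^+ 2)) + complex.Re (a1 * k + a2 * k ^+ 2) by ring.
apply: le_trans (ler_normD _ _) _.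
have h2 : `|complex.Re (a1 * k + a2 * k ^+ 2)| <= Normc.normc a1 * Normc.normc k + Normc.normc a2 * Normc.normc k ^+ 2.
  by apply: le_trans (normr_Re_le _) _; apply: le_trans (le_normcD _ _) _; rewrite !(normcX, Normc.normcM).
have k3' : Normc.normc k * A <= e by rewrite -ler_pdivlMr.
have h3 : Normc.normc k ^+ 2 <= Normc.normc k by rewrite expr2 ler_piMl.
have h4 : Normc.normc k ^+ 3 <= Normc.normc k by rewrite exprS ler_piMr// exprn_ile1.
apply: le_trans (lerD h1 h2) _; apply: le_trans k3'; rewrite /A.
have n1 := normc_ge0 a1; have n2 := normc_ge0 a2.
move: (ler_wpM2l C0 h4) (ler_wpM2l n2 h3) (mulr_ge0 n1 t0); nra.
Qed.

Definition pt (p : R * R) : R[i] := Complex p.1 p.2.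

Definition locally_lipschitz N := forall B, exists L : R, forall z w,
  Normc.normc z <= B -> Normc.normc w <= B -> `|N z - N w| <= L * Normc.normc (z - w).

Lemma continuous_pt (f : R[i] -> R) (p : R * R) :
  (forall e, 0 < e -> exists2 r, 0 < r & forall k, Normc.normc k <= r -> `|f (pt p + k) - f (pt p)| <= e) ->
  {for p, continuous (fun q => f (pt q))}.
Proof.
move=> hf; apply/cvgrPdist_le => e e0; have [r r0 hr] := hf e e0.
near=> q.
have -> : pt q = pt p + (pt q - pt p) by ring.
rewrite distrC; apply: hr; apply: le_trans (normc_le_ReIm _) _ => /=.
have -> : r = r / 2 + r / 2 by field.
rewrite lerD//.
- rewrite distrC; near: q; have : (fst q : R) @[q --> p] --> fst p by exact: cvg_fst.
  by move=> /cvgrPdist_le/(_ (r / 2)); apply; rewrite divr_gt0.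
- rewrite distrC; near: q; have : (snd q : R) @[q --> p] --> snd p by exact: cvg_snd.
  by move=> /cvgrPdist_le/(_ (r / 2)); apply; rewrite divr_gt0.
Unshelve. all: by end_near. Qed.

Lemma locally_lipschitz_near N z (e : R) : locally_lipschitz N -> 0 < e ->
  exists2 r, 0 < r & forall k, Normc.normc k <= r -> `|N (z + k) - N z| <= e.
Proof.
move=> /(_ (Normc.normc z + 1))[L hL] e0.
have D0 : 0 < `|L| + 1 by rewrite ltr_wpDl.
exists (Order.min 1 (e / (`|L| + 1))); first by rewrite lt_min ltr01 divr_gt0.
move=> k; rewrite le_min => /andP[k1 k2].
apply: le_trans (hL _ _ _ _) _.
- by apply: le_trans (le_normcD _ _) _; rewrite lerD2l.
- by rewrite lerDl.
rewrite addrAC subrr add0r; apply: (@le_trans _ _ ((`|L| + 1) * Normc.normc k)).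
  by rewrite ler_wpM2r ?normc_ge0// (le_trans (ler_norm _))// lerDl.
by rewrite mulrC -ler_pdivlMr.
Qed.

(** The product has a maximum on the compact set; where it is not already bounded
    by [M], the point is interior, against [no_local_max]. *)
Lemma max_principle N h (K : set R[i]) (d M : R) : submean N -> locally_lipschitz N ->
  (forall w, 0 <= N w) -> 0 < d -> 0 <= M -> compact [set p | K (pt p)] ->
  (forall z, K z -> harmonic_at h z) ->
  (forall z, K z -> N z * expR (h z + d * Normc.normc z ^+ 2) <= M \/
                    exists2 r, 0 < r & forall k, Normc.normc k <= r -> K (z + k)) ->
  forall z, K z -> N z * expR (h z + d * Normc.normc z ^+ 2) <= M.
Proof.
move=> sN lN N0 d0 M0 cK hK hb z Kz.
pose F z := N z * expR (h z + d * Normc.normc z ^+ 2).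
have [||c cK' hmax] := @compact_EVT_max _ R (fun p => F (pt p)) [set p | K (pt p)] _ cK.
- by exists (complex.Re z, complex.Im z); rewrite /= /pt /=; case: (z) Kz.
- apply: continuous_in_subspaceT => p; rewrite inE/= => Kp; rewrite /F.
  apply: cvgM; first by apply: continuous_pt => e; exact: locally_lipschitz_near.
  apply: continuous_comp; last exact: continuous_expR.
  apply: cvgD; first by apply: (@continuous_pt h) => e; exact: harmonic_at_near (hK _ Kp).
  have -> : (fun x => d * Normc.normc (pt x) ^+ 2) = (fun x : R * R => d * (x.1 ^+ 2 + x.2 ^+ 2)).
    by apply/funext => x; rewrite normc_sqr.
  rewrite normc_sqr /=.
  apply: cvgM; first exact: cvg_cst.
  by apply: cvgD; rewrite expr2; under eq_fun do rewrite expr2; apply: cvgM; (exact: cvg_fst || exact: cvg_snd).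
rewrite inE /= in cK'.
have {}hmax w : K w -> F w <= F (pt c).
  move=> Kw; have := hmax (complex.Re w, complex.Im w); rewrite inE /= /pt /=.
  by case: w Kw => a b /= Kw; apply.
apply: le_trans (hmax _ Kz) _.
have [//|[r r0 hr]] := hb _ cK'.
rewrite leNgt; apply/negP => MF.
have Nc : 0 < N (pt c).
  rewrite lt_def N0 andbT; apply/negP => /eqP h0.
  by move: MF; rewrite /F h0 mul0r ltNge M0.
apply: (no_local_max sN N0 (hK _ cK') d0 Nc).
by exists r => // k /hr /hmax.
Qed.

End MaximumPrinciple.

(** * Blaschke factors of the sector *)

Section Blaschke.
Context {R : realType}.
Implicit Types (h g N : R[i] -> R) (z w : R[i]).

Definition sector z := `|complex.Im z| <= complex.Re z.

(** Minus the logarithm of the modulus of the half-plane Blaschke factor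
    [(w - a^2) / (w + a^2)] at [w = z^2]. *)
Definition blaschke (a : R) z :=
  ln (Normc.normc (z ^+ 2 + (a ^+ 2)%:C%C)) - ln (Normc.normc (z ^+ 2 + (- a ^+ 2)%:C%C)).

Lemma ler_normc_dist z w : `|Normc.normc z - Normc.normc w| <= Normc.normc (z - w).
Proof.
have h a b : Normc.normc a - Normc.normc b <= Normc.normc (a - b).
  by rewrite lerBlDr -{1}(subrK b a) le_normcD.
by rewrite ler_norml h andbT lerNl opprB normc_distC h.
Qed.

Lemma Re_sqr z : complex.Re (z ^+ 2) = complex.Re z ^+ 2 - complex.Im z ^+ 2.
Proof. by rewrite expr2 ReM -!expr2. Qed.

Lemma sector_Re_sqr z : sector z -> 0 <= complex.Re (z ^+ 2).
Proof.
move=> hz; rewrite Re_sqr subr_ge0 -(real_normK (num_real (complex.Im z))).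
by rewrite ler_pXn2r ?nnegrE ?normr_ge0// (le_trans _ hz).
Qed.

Lemma ln_le_sub1 (x : R) : 0 < x -> ln x <= x - 1.
Proof. by move=> x0; have := @le_ln1Dx R (x - 1); rewrite (addrC 1) subrK; apply; lra. Qed.

Lemma lnB_le (p q : R) : 0 < p -> 0 < q -> ln p - ln q <= (p ^+ 2 - q ^+ 2) / (2 * q ^+ 2).
Proof.
move=> p0 q0.
have -> : ln p - ln q = ln ((p / q) ^+ 2) / 2.
  by rewrite lnXn ?divr_gt0// ln_div// -[_ *+ 2]mulr_natl; field.
have h : ln ((p / q) ^+ 2) <= (p / q) ^+ 2 - 1 by apply: ln_le_sub1; rewrite exprn_gt0 ?divr_gt0.
have -> : (p ^+ 2 - q ^+ 2) / (2 * q ^+ 2) = ((p / q) ^+ 2 - 1) / 2.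
  by field; rewrite gt_eqF.
by rewrite ler_pM2r ?invr_gt0.
Qed.

Lemma normc_sqrDr z (b : R) :
  Normc.normc (z ^+ 2 + b%:C%C) ^+ 2 = Normc.normc z ^+ 4 + b ^+ 2 + 2 * b * complex.Re (z ^+ 2).
Proof.
rewrite normc_sqr !ReD !ImD /= addr0.
have -> : Normc.normc z ^+ 4 = Normc.normc (z ^+ 2) ^+ 2 by rewrite normcX -exprM.
rewrite normc_sqr; ring.
Qed.

Lemma normc_sqrD_gt0 z (a : R) : sector z -> 1 <= a -> 0 < Normc.normc (z ^+ 2 + (a ^+ 2)%:C%C).
Proof.
move=> hz a1; apply: lt_le_trans (normr_Re_le _); rewrite ReD /=.
have := sector_Re_sqr hz; have : 1 <= a ^+ 2 by rewrite exprn_ege1.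
by move=> *; rewrite gtr0_norm; lra.
Qed.

Lemma normc_real_sub z (a : R) : z ^+ 2 + (- a ^+ 2)%:C%C = (z - a%:C%C) * (z + a%:C%C).
Proof. by rewrite rmorphN rmorphXn /=; ring. Qed.

Lemma normcD_ge1 z (a : R) : sector z -> 1 <= a -> 1 <= Normc.normc (z + a%:C%C).
Proof.
move=> hz a1; apply: le_trans (normr_Re_le _); rewrite ReD /=.
have : 0 <= complex.Re z by apply: le_trans hz.
by move=> *; rewrite ger0_norm; lra.
Qed.

Lemma normc_sqrB_gt0 z (a : R) : sector z -> 1 <= a -> z != a%:C%C ->
  0 < Normc.normc (z ^+ 2 + (- a ^+ 2)%:C%C).
Proof.
move=> hz a1 za; rewrite normc_real_sub Normc.normcM mulr_gt0 ?normc_gt0 ?subr_eq0//.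
by rewrite -normc_gt0 (lt_le_trans ltr01)// normcD_ge1.
Qed.

(** On the outer arc the factors are close enough to [1] for their total loss to be
    absorbed by a linear term in [Re (z^2)]. *)
Lemma blaschke_le z (a B : R) : sector z -> 1 <= a -> Normc.normc z = B -> 0 < B -> a ^+ 2 <= B ^+ 2 / 2 ->
  blaschke a z <= 4 / B ^+ 2 * complex.Re (z ^+ 2).
Proof.
move=> hz a1 zB B0 aB.
have X0 := sector_Re_sqr hz; set X := complex.Re _ in X0 *.
have XB : X <= B ^+ 2.
  rewrite /X -zB -normcX; exact: le_trans (ler_norm _) (normr_Re_le _).
have a2 : 1 <= a ^+ 2 by rewrite exprn_ege1.
have qq : B ^+ 4 / 4 <= Normc.normc (z ^+ 2 + (- a ^+ 2)%:C%C) ^+ 2.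
  rewrite normc_sqrDr zB -/X.
  have -> : B ^+ 4 = B ^+ 2 * B ^+ 2 by ring.
  move: XB aB a2; set b := B ^+ 2; set A := a ^+ 2; nra.
have B4 : 0 < B ^+ 4 / 4 by rewrite divr_gt0// exprn_gt0.
have q0 : 0 < Normc.normc (z ^+ 2 + (- a ^+ 2)%:C%C).
  rewrite lt_def normc_ge0 andbT; apply/negP => /eqP h.
  by move: qq; rewrite h expr0n/= leNgt B4.
apply: le_trans (lnB_le (normc_sqrD_gt0 hz a1) q0) _.
rewrite ler_pdivrMr ?mulr_gt0 ?exprn_gt0//.
have -> : Normc.normc (z ^+ 2 + (a ^+ 2)%:C%C) ^+ 2 - Normc.normc (z ^+ 2 + (- a ^+ 2)%:C%C) ^+ 2 = 4 * a ^+ 2 * X.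
  rewrite !normc_sqrDr -/X; ring.
have h1 : 4 / B ^+ 2 * X * (2 * (B ^+ 4 / 4)) <= 4 / B ^+ 2 * X * (2 * Normc.normc (z ^+ 2 + (- a ^+ 2)%:C%C) ^+ 2).
  by rewrite ler_wpM2l ?mulr_ge0 ?invr_ge0 ?sqr_ge0// ler_pM2l.
apply: le_trans h1.
have -> : 4 / B ^+ 2 * X * (2 * (B ^+ 4 / 4)) = 2 * B ^+ 2 * X by field; rewrite gt_eqF.
rewrite ler_wpM2r//; lra.
Qed.

(** On the boundary rays [z^2] is imaginary, so that numerator and denominator
    have the same modulus. *)
Lemma blaschke0 z (a : R) : complex.Re (z ^+ 2) = 0 -> blaschke a z = 0.
Proof.
move=> X0; rewrite /blaschke; apply/eqP; rewrite subr_eq0; apply/eqP; congr ln.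
apply/eqP; rewrite -(@eqrXn2 _ 2) ?normc_ge0// !normc_sqrDr X0 !mulr0 !addr0.
by rewrite sqrrN.
Qed.

(** The gain from one zero, comparable to [2 * Re (z^2) / a^2] when [a] is large. *)
Lemma blaschke_ge z (a : R) : sector z -> 1 <= a -> z != a%:C%C ->
  2 * complex.Re (z ^+ 2) * (a ^+ 2 / (Normc.normc z ^+ 2 + a ^+ 2) ^+ 2) <= blaschke a z.
Proof.
move=> hz a1 za.
have X0 := sector_Re_sqr hz.
have p0 := normc_sqrD_gt0 hz a1; have q0 := normc_sqrB_gt0 hz a1 za.
have h := lnB_le q0 p0.
rewrite /blaschke -[leRHS]opprB lerNr; apply: le_trans h _.
have a2 : 1 <= a ^+ 2 by rewrite exprn_ege1.
rewrite ler_pdivrMr ?mulr_gt0 ?exprn_gt0//.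
rewrite !normc_sqrDr.
set X := complex.Re _ in X0 *; set Z := Normc.normc z.
have XZ : X <= Z ^+ 2 by rewrite /X /Z -normcX; exact: le_trans (ler_norm _) (normr_Re_le _).
have e0 : 0 < (Z ^+ 2 + a ^+ 2) ^+ 2 by rewrite exprn_gt0// ltr_wpDl ?sqr_ge0// (lt_le_trans ltr01).
have -> : Z ^+ 4 + (- a ^+ 2) ^+ 2 + 2 * - a ^+ 2 * X - (Z ^+ 4 + (a ^+ 2) ^+ 2 + 2 * a ^+ 2 * X) = - (4 * a ^+ 2 * X) by ring.
rewrite mulNr lerN2.
have -> : 2 * X * (a ^+ 2 / (Z ^+ 2 + a ^+ 2) ^+ 2) * (2 * (Z ^+ 4 + (a ^+ 2) ^+ 2 + 2 * a ^+ 2 * X)) =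
   4 * a ^+ 2 * X * ((Z ^+ 4 + (a ^+ 2) ^+ 2 + 2 * a ^+ 2 * X) / (Z ^+ 2 + a ^+ 2) ^+ 2) by ring.
rewrite ler_piMr//; first by rewrite mulr_ge0// mulr_ge0// sqr_ge0.
rewrite ler_pdivrMr// mul1r.
have -> : (Z ^+ 2 + a ^+ 2) ^+ 2 = Z ^+ 4 + (a ^+ 2) ^+ 2 + 2 * a ^+ 2 * Z ^+ 2 by ring.
by rewrite lerD2l ler_wpM2l// mulr_ge0 ?sqr_ge0.
Qed.

Lemma harmonic_at_blaschke z (a : R) : sector z -> 1 <= a -> z != a%:C%C ->
  harmonic_at (blaschke a) z.
Proof.
move=> hz a1 za.
have p0 := normc_sqrD_gt0 hz a1; have q0 := normc_sqrB_gt0 hz a1 za.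
rewrite !normc_gt0 in p0 q0.
have -> : blaschke a = (fun w => ln (Normc.normc (w ^+ 2 + (a ^+ 2)%:C%C)) + (-1) * ln (Normc.normc (w ^+ 2 + (- a ^+ 2)%:C%C))).
  by apply/funext => w; rewrite /blaschke mulN1r.
by apply: harmonic_atD; [|apply: harmonic_atZ]; apply: harmonic_at_ln.
Qed.

Lemma seq_pos_lb (l : seq R) : {in l, forall x, 0 < x} -> exists2 e, 0 < e & {in l, forall x, e <= x}.
Proof.
elim: l => [|x l IH] hl; first by exists 1.
have [|e e0 he] := IH; first by move=> y yl; apply: hl; rewrite inE yl orbT.
exists (Order.min x e); first by rewrite lt_min e0 hl// mem_head.
by move=> y; rewrite inE => /orP[/eqP->|/he h]; rewrite ge_min ?lexx ?h ?orbT.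
Qed.

Lemma compact_sector (s : seq R) (B sg : R) :
  compact [set p : R * R | [/\ sector (pt p), Normc.normc (pt p) <= B
     & {in s, forall a, sg <= Normc.normc (pt p - a%:C%C)}]].
Proof.
have cn (a : R[i]) : continuous (fun p : R * R => Normc.normc (pt p - a)).
  move=> p; apply: (@continuous_pt _ (fun z => Normc.normc (z - a))) => e e0.
  exists e => // k ke; apply: le_trans ke; apply: le_trans (ler_normc_dist _ _) _.
  by rewrite [leLHS](_ : _ = Normc.normc k)//; congr Normc.normc; ring.
apply: (@subclosed_compact _ _ (`[- B, B] `*` `[- B, B])).
- have -> : [set p : R * R | [/\ sector (pt p), Normc.normc (pt p) <= B
     & {in s, forall a, sg <= Normc.normc (pt p - a%:C%C)}]] =
    ((fun p : R * R => p.1 - `|p.2|) @^-1` [set x | 0 <= x]) `&`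
    ((fun p : R * R => Normc.normc (pt p - 0)) @^-1` [set x | x <= B]) `&`
    \bigcap_(a in [set` s]) ((fun p : R * R => Normc.normc (pt p - a%:C%C)) @^-1` [set x | sg <= x]).
    apply/seteqP; split => p.
      move=> [h1 h2 h3]; split; first split.
      - by rewrite /preimage/mkset subr_ge0.
      - by rewrite /preimage/mkset subr0.
      - by move=> a sa; exact: h3.
    move=> [[h1 h2] h3]; split.
    - by move: h1; rewrite /preimage/mkset subr_ge0.
    - by move: h2; rewrite /preimage/mkset subr0.
    - by move=> a sa; exact: (h3 a sa).
  apply: closedI; first apply: closedI.
  + apply: preimage_closed; last exact: closed_ge.
    move=> p _; apply: cvgB; first exact: cvg_fst.
    by apply: cvg_norm; exact: cvg_snd.
  + by apply: preimage_closed; [move=> p _; exact: cn|exact: closed_le].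
  + apply: closed_bigI => a _.
    by apply: preimage_closed; [move=> p _; exact: cn|exact: closed_ge].
- by apply: compact_setX; exact: segment_compact.
- move=> [x y] [_ /= h _]; rewrite /= !in_itv /= -!ler_norml; split.
    exact: le_trans (normr_Re_le (pt (x, y))) h.
  exact: le_trans (normr_Im_le (pt (x, y))) h.
Qed.

End Blaschke.

(** * The Blaschke estimate *)

Section BlaschkeEstimate.
Context {R : realType}.
Implicit Types (h g N : R[i] -> R) (z w : R[i]).

Lemma expRN_leV (x : R) : 0 < x -> expR (- x) <= x^-1.
Proof.
move=> x0; rewrite expRN lef_pV2 ?posrE ?expR_gt0//.
by apply: le_trans (expR_ge1Dx x); rewrite lerDr.
Qed.

(** The singular factor at the nearby zero [a] contributes [(1 - eps) * t], and the
    distance [ga] to the other zeros keeps all other factors bounded. *)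
Lemma blaschke_near_zero (s : seq R) z (a B ga t eps : R) :
  uniq s -> {in s, forall b, 1 <= b} -> a \in s -> sector z -> Normc.normc z <= B ->
  {in s, forall b, b ^+ 2 <= B ^+ 2} ->
  0 < ga -> 0 <= t -> 0 <= eps <= 1 -> expR (- t) <= ga / 2 -> Normc.normc (z - a%:C%C) = expR (- t) ->
  {in s, forall b, b != a -> ga <= `|b - a|} ->
  (1 - eps) * \sum_(b <- s) blaschke b z <= (size s)%:R * (`|ln (2 * B ^+ 2)| + `|ln (ga / 2)|) + (1 - eps) * t.
Proof.
move=> us s1 sa hz zB sB ga0 t0 /andP[e0 e1] tg za hga.
set Q : R := `|_| + `|_|.
have Q0 : 0 <= Q by rewrite addr_ge0.
have term b : b \in s -> blaschke b z <= Q + (if b == a then t else 0).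
  move=> sb; have b1 := s1 _ sb.
  have zb : Normc.normc (z - b%:C%C) >= if b == a then expR (- t) else ga / 2.
    case: eqP => [->|/eqP ba]; first by rewrite za.
    have := hga _ sb ba.
    have h2 : `|b - a| <= Normc.normc (z - b%:C%C) + expR (- t).
      rewrite -za normc_distC; apply: le_trans (le_normcD _ _).
      have -> : b%:C%C - z + (z - a%:C%C) = (b - a)%:C%C :> R[i] by rewrite rmorphB; ring.
      by rewrite normc_real.
    move: h2 tg; lra.
  have zb0 : 0 < Normc.normc (z - b%:C%C).
    by apply: lt_le_trans zb; case: ifP; rewrite ?expR_gt0// divr_gt0.
  rewrite /blaschke normc_real_sub Normc.normcM.
  have nb : 1 <= Normc.normc (z + b%:C%C) by apply: normcD_ge1.
  rewrite lnM ?posrE// ?(lt_le_trans ltr01)// opprD.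
  have h1 : 0 <= ln (Normc.normc (z + b%:C%C)) by apply: ln_ge0.
  have B2 : 0 < 2 * B ^+ 2.
    have : 1 <= b ^+ 2 by rewrite exprn_ege1.
    by move=> h3; have := sB _ sb; lra.
  have h2 : ln (Normc.normc (z ^+ 2 + (b ^+ 2)%:C%C)) <= `|ln (2 * B ^+ 2)|.
    apply: le_trans (ler_norm _); rewrite ler_ln ?posrE ?normc_sqrD_gt0//.
    apply: le_trans (le_normcD _ _) _; rewrite normcX normc_real ger0_norm ?sqr_ge0//.
    rewrite mulr2n mulrDl mul1r; apply: lerD; last exact: sB.
    by rewrite lerXn2r ?nnegrE ?normc_ge0// (le_trans (normc_ge0 _) zB).
  have h3 : - ln (Normc.normc (z - b%:C%C)) <= `|ln (ga / 2)| + (if b == a then t else 0).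
    move: zb; case: eqP => _ zb.
      have h3 : - t <= ln (Normc.normc (z - b%:C%C)) by rewrite -(expRK (- t)) ler_ln ?posrE ?expR_gt0.
      by have := normr_ge0 (ln (ga / 2)); lra.
    have h4 : ln (ga / 2) <= ln (Normc.normc (z - b%:C%C)) by rewrite ler_ln ?posrE// divr_gt0.
    have := ler_norm (- ln (ga / 2)); rewrite normrN; lra.
  by rewrite /Q; move: h1 h2 h3; lra.
apply: (@le_trans _ _ ((1 - eps) * \sum_(b <- s) (Q + (if b == a then t else 0)))).
  rewrite ler_wpM2l ?subr_ge0// big_seq [leRHS]big_seq; exact: ler_sum.
rewrite big_split /= mulrDr; apply: lerD.
  rewrite big_const_seq count_predT iter_addr_0 -[_ *+ _]mulr_natl.
  by rewrite ler_piMl ?mulr_ge0// gerBl.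
rewrite -big_mkcond /= big_const_seq iter_addr_0 (_ : count _ s = 1%N)//.
by rewrite (count_uniq_mem a us) sa.
Qed.

(** Maximum principle for [N * exp h] on the truncated sector minus small discs
    around the zeros, [h] containing the Blaschke sum with weight [1 - eps]. On the
    rays the Blaschke sum vanishes, on the arc [blaschke_le] applies, and on the
    circle of radius [exp (- t)] around a zero the Lipschitz bound [N = O (exp (- t))]
    beats [exp ((1 - eps) * t)]. *)
Lemma blaschke_estimate N g (s : seq R) (B M0 G : R) z0 :
  submean N -> locally_lipschitz N -> (forall z, 0 <= N z) ->
  (forall z, sector z -> Normc.normc z <= B -> harmonic_at g z) ->
  (forall z, sector z -> Normc.normc z <= B -> g z <= G) ->
  uniq s -> {in s, forall a, [/\ 1 <= a, a ^+ 2 <= B ^+ 2 / 2 & N a%:C%C = 0]} ->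
  0 < B -> 0 < M0 ->
  (forall z, sector z -> Normc.normc z <= B ->
    N z * expR (g z) <= M0 * expR (- (4 * (size s)%:R / B ^+ 2) * complex.Re (z ^+ 2))) ->
  sector z0 -> Normc.normc z0 <= B -> {in s, forall a, z0 != a%:C%C} ->
  N z0 * expR (g z0 + \sum_(a <- s) blaschke a z0) <= M0 * expR 2.
Proof.
move=> sN lN N0 hg gG us hs B0 M00 hM sz0 z0B z0s.
have s1 : {in s, forall b, 1 <= b} by move=> b /hs[].
have sB : {in s, forall b, b ^+ 2 <= B ^+ 2} by move=> b /hs[_ h _]; have := sqr_ge0 B; lra.
set S := \sum_(a <- s) _.
have S0 : 0 <= S.
  rewrite /S big_seq sumr_ge0// => a sa; apply: le_trans (blaschke_ge sz0 (s1 _ sa) (z0s _ sa)).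
  by rewrite mulr_ge0 ?divr_ge0 ?sqr_ge0// mulr_ge0 ?sector_Re_sqr.
(* then eps * S <= 1, so that the weight 1 - eps costs a factor exp 1 at z0 *)
pose eps : R := (1 + S)^-1.
have S1 : 0 < 1 + S by rewrite ltr_pwDl.
have eps0 : 0 < eps by rewrite invr_gt0.
have eps1 : eps <= 1 by rewrite invf_le1// lerDl.
pose h z := g z + (1 - eps) * \sum_(a <- s) blaschke a z.
pose l := [seq `|x.1 - x.2| | x <- [seq (a, b) | a <- s, b <- s] & x.1 != x.2] ++ [seq Normc.normc (z0 - a%:C%C) | a <- s].
have [ga ga0 hga] : exists2 e, 0 < e & {in l, forall x, e <= x}.
  apply: seq_pos_lb => x; rewrite mem_cat => /orP[/mapP[[a b]]|/mapP[a sa ->]].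
    by rewrite mem_filter /= => /andP[ab _] ->; rewrite normr_gt0 subr_eq0.
  by rewrite normc_gt0 subr_eq0 z0s.
have hga1 a b : a \in s -> b \in s -> a != b -> ga <= `|a - b|.
  move=> sa sb ab; apply: hga; rewrite mem_cat; apply/orP; left.
  apply/mapP; exists (a, b) => //; rewrite mem_filter /= ab /=.
  by apply/allpairsP; exists (a, b).
have hga2 a : a \in s -> ga <= Normc.normc (z0 - a%:C%C).
  by move=> sa; apply: hga; rewrite mem_cat; apply/orP; right; apply/mapP; exists a.
have [L0 hL] := lN B; pose L : R := `|L0|.
pose A := G + (size s)%:R * (`|ln (2 * B ^+ 2)| + `|ln (ga / 2)|).
pose t := L * expR A / (M0 * eps) + 2 / ga.
have L00 : 0 <= L by exact: normr_ge0.
have t1 : 0 <= L * expR A / (M0 * eps) by exact: divr_ge0 (mulr_ge0 L00 (expR_ge0 _)) (ltW (mulr_gt0 M00 eps0)).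
have t0 : 0 < t by rewrite ltr_wpDl ?divr_gt0.
have tg : expR (- t) <= ga / 2.
  apply: le_trans (expRN_leV t0) _; rewrite -[leRHS]invrK lef_pV2 ?posrE ?invr_gt0 ?divr_gt0//.
  by rewrite invf_div /t lerDr.
pose K : set R[i] := [set z | [/\ sector z, Normc.normc z <= B & {in s, forall a, expR (- t) <= Normc.normc (z - a%:C%C)}]].
have Kne z a : K z -> a \in s -> z != a%:C%C.
  move=> [_ _ hz] sa; rewrite -subr_eq0 -normc_gt0; apply: lt_le_trans (hz _ sa); exact: expR_gt0.
have hS z : sector z -> Normc.normc z = B -> \sum_(a <- s) blaschke a z <= 4 * (size s)%:R / B ^+ 2 * complex.Re (z ^+ 2).
  move=> hz zB.
  apply: (@le_trans _ _ (\sum_(a <- s) (4 / B ^+ 2 * complex.Re (z ^+ 2)))).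
    rewrite big_seq [leRHS]big_seq; apply: ler_sum => a /hs[a1 aB _]; exact: blaschke_le.
  rewrite big_const_seq count_predT iter_addr_0.
  by have -> : 4 * (size s)%:R / B ^+ 2 * complex.Re (z ^+ 2) = (4 / B ^+ 2 * complex.Re (z ^+ 2)) *+ size s
    by rewrite -[RHS]mulr_natl; ring.
have key z : K z -> N z * expR (h z + B ^- 2 * Normc.normc z ^+ 2) <= M0 * expR 1.
  apply: (@max_principle _ N h K (B ^- 2) (M0 * expR 1)) => //.
  - by rewrite invr_gt0 exprn_gt0.
  - by rewrite mulr_ge0 ?expR_ge0// ltW.
  - exact: compact_sector.
  - move=> w Kw; have [sw wB _] := Kw; apply: harmonic_atD; first exact: hg.
    apply: harmonic_atZ; apply: harmonic_at_sum_seq => a sa.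
    by apply: harmonic_at_blaschke => //; [exact: s1|exact: Kne].
  - move=> w Kw; have [sw wB ws] := Kw.
    have wB1 : B ^- 2 * Normc.normc w ^+ 2 <= 1.
      rewrite mulrC ler_pdivrMr ?exprn_gt0// mul1r lerXn2r ?nnegrE ?normc_ge0//; exact: ltW.
    have bnd : (1 - eps) * \sum_(a <- s) blaschke a w <= 4 * (size s)%:R / B ^+ 2 * complex.Re (w ^+ 2) ->
        N w * expR (h w + B ^- 2 * Normc.normc w ^+ 2) <= M0 * expR 1.
      move=> hb; rewrite expRD mulrA; apply: ler_pM; rewrite ?mulr_ge0 ?expR_ge0 ?ler_expR//.
      rewrite /h expRD mulrA.
      apply: le_trans (ler_wpM2r (expR_ge0 _) (hM _ sw wB)) _.
      by rewrite -(mulrA M0) -expRD ler_piMr ?expR_le1 ?(ltW M00)// mulNr addrC subr_le0.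
    have [e1|ne1] := eqVneq `|complex.Im w| (complex.Re w).
      left; apply: bnd.
      have X0 : complex.Re (w ^+ 2) = 0.
        by rewrite Re_sqr -e1 real_normK ?num_real// subrr.
      by rewrite X0 mulr0 big1 ?mulr0// => a _; rewrite blaschke0.
    have [e2|ne2] := eqVneq (Normc.normc w) B.
      left; apply: bnd; apply: le_trans (ler_wpM2l _ (hS _ sw e2)) _; first by rewrite subr_ge0.
      have Y0 : 0 <= 4 * (size s)%:R / B ^+ 2 * complex.Re (w ^+ 2).
        by rewrite mulr_ge0 ?sector_Re_sqr// divr_ge0 ?sqr_ge0// mulr_ge0.
      by rewrite mulrBl mul1r gerBl mulr_ge0// ltW.
    have [/hasP[a sa /eqP wa]|/hasPn ne3] := boolP (has (fun a => Normc.normc (w - a%:C%C) == expR (- t)) s).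
      left.
      have Nw : N w <= L * expR (- t).
        have [_ aB Na] := hs _ sa.
        have := hL w a%:C%C wB; rewrite Na subr0 wa ger0_norm// => /(_ _)/le_trans; apply.
          have a1 := s1 _ sa.
          rewrite normc_real ger0_norm ?(le_trans ler01)// -(@ler_pXn2r _ 2) ?nnegrE ?(ltW B0) ?(le_trans ler01)//.
          by move: (sB _ sa).
        by rewrite ler_wpM2r ?expR_ge0// ler_norm.
      have hb := @blaschke_near_zero s w a B ga t eps us s1 sa sw wB sB ga0 (ltW t0) _ tg wa.
      have {}hb : (1 - eps) * (\sum_(b <- s) blaschke b w) <= (size s)%:R * (`|ln (2 * B ^+ 2)| + `|ln (ga / 2)|) + (1 - eps) * t.
        apply: hb; first by rewrite (ltW eps0).
        by move=> b sb; exact: hga1.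
      have hw : h w + B ^- 2 * Normc.normc w ^+ 2 <= A + (1 - eps) * t + 1.
        by rewrite /h /A; have := gG _ sw wB; move: hb wB1; clear -R; lra.
      rewrite -ler_expR in hw.
      apply: le_trans (ler_pM (N0 _) (expR_ge0 _) Nw hw) _.
      have -> : L * expR (- t) * expR (A + (1 - eps) * t + 1) = L * expR A * expR (- (eps * t)) * expR 1.
        by rewrite -!mulrA -!expRD; congr (_ * expR _); ring.
      rewrite ler_wpM2r ?expR_ge0//.
      apply: le_trans (ler_wpM2l _ (expRN_leV (mulr_gt0 eps0 t0))) _; first by rewrite mulr_ge0 ?expR_ge0// normr_ge0.
      rewrite ler_pdivrMr ?mulr_gt0// /t mulrDr mulrDr.
      have -> : M0 * (eps * (L * expR A / (M0 * eps))) = L * expR A.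
        by field; rewrite !gt_eqF.
      by rewrite lerDl !mulr_ge0 ?invr_ge0// ltW.
    right.
    have {}ne1 : `|complex.Im w| < complex.Re w by rewrite lt_neqAle ne1.
    have {}ne2 : Normc.normc w < B by rewrite lt_neqAle ne2.
    pose ll := [:: (complex.Re w - `|complex.Im w|) / 2, B - Normc.normc w & [seq Normc.normc (w - a%:C%C) - expR (- t) | a <- s]].
    have [r r0 hr] : exists2 e, 0 < e & {in ll, forall x, e <= x}.
      apply: seq_pos_lb => x; rewrite !inE => /or3P[/eqP->|/eqP->|/mapP[a sa ->]].
      - by rewrite divr_gt0// subr_gt0.
      - by rewrite subr_gt0.
      - by rewrite subr_gt0 lt_neqAle ws// andbT eq_sym ne3.
    exists r => // k kr; split.
    - have := hr _ (mem_head _ _); rewrite /sector ReD ImD.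
      have := normr_Re_le k; have := normr_Im_le k; have := ler_normD (complex.Im w) (complex.Im k).
      by have := ler_norm (- complex.Re k); rewrite normrN; move: kr; clear -R; lra.
    - have := hr (B - Normc.normc w); rewrite !inE eqxx orbT => /(_ isT).
      by have := le_normcD w k; move: kr; clear -R; lra.
    - move=> a sa; have := hr (Normc.normc (w - a%:C%C) - expR (- t)).
      have -> : Normc.normc (w - a%:C%C) - expR (- t) \in ll.
        by rewrite !inE; apply/orP; right; apply/orP; right; apply/mapP; exists a.
      move=> /(_ isT).
      have := le_normcB (w + k - a%:C%C) k.
      have -> : w + k - a%:C%C - k = w - a%:C%C by ring.
      by move: kr; clear -R; lra.
have Kz0 : K z0.
  split => // a sa; apply: le_trans (hga2 _ sa); apply: le_trans tg _; lra.
have := key _ Kz0; rewrite /h -/S => {}key.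
have -> : g z0 + S = g z0 + (1 - eps) * S + eps * S by ring.
have -> : expR 2 = expR 1 * expR 1 :> R by rewrite -expRD -mulr2n.
rewrite (expRD _ (eps * S)) !mulrA.
apply: ler_pM; rewrite ?mulr_ge0 ?expR_ge0//; last first.
  by rewrite ler_expR /eps mulrC ler_pdivrMr// mul1r lerDr.
apply: le_trans key; rewrite ler_wpM2l// ler_expR lerDl mulr_ge0 ?sqr_ge0//.
by rewrite invr_ge0 exprn_ge0// ltW.
Qed.

End BlaschkeEstimate.

(** * Comparison sums *)

Section SectorVanishing.
Context {R : realType}.
Implicit Types (N : R[i] -> R) (z w : R[i]).

Lemma ln_ge1BV (x : R) : 0 < x -> 1 - x^-1 <= ln x.
Proof. by move=> x0; have := @ln_le_sub1 R x^-1; rewrite invr_gt0 lnV ?posrE// => /(_ x0); lra. Qed.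

Lemma ln_step (k : R) : 0 < k -> (k + 1)^-1 <= ln (k + 1) - ln k <= k^-1.
Proof.
move=> k0; have k1 : 0 < k + 1 by rewrite addr_gt0.
rewrite -ln_div ?posrE//; have q0 : 0 < (k + 1) / k by rewrite divr_gt0.
apply/andP; split.
  apply: le_trans (ln_ge1BV q0); apply: le_of_eq; by field; rewrite !gt_eqF.
by apply: le_trans (ln_le_sub1 q0) _; apply: le_of_eq; field; rewrite gt_eqF.
Qed.

Lemma harmonic_sum_le n : (0 < n)%N -> \sum_(1 <= j < n.+1) (j%:R : R)^-1 <= 1 + ln n%:R.
Proof.
case: n => // n _; elim: n => [|n IH]; first by rewrite big_nat1 ln1 invr1 addr0.
rewrite big_nat_recr//=; have n0 : (0 : R) < n.+1%:R by rewrite ltr0n.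
have /andP[h _] := ln_step n0; move: h IH; rewrite (natr1 n.+1).
by move: (_%:R^-1) (ln _) (ln _) (\sum_(_ <= _ < _) _) => *; lra.
Qed.

Lemma harmonic_sum_ge (k m : nat) : (0 < k)%N ->
  ln (k + m)%:R - ln k%:R <= \sum_(0 <= j < m) ((k + j)%:R : R)^-1.
Proof.
move=> k0; elim: m => [|m IH]; first by rewrite big_geq// addn0 subrr.
rewrite big_nat_recr//=; have n0 : (0 : R) < (k + m)%:R by rewrite ltr0n addn_gt0 k0.
have /andP[_ h] := ln_step n0; move: IH h; rewrite addnS -natr1.
by move: (_%:R^-1) (ln _) (ln _) (ln _) (\sum_(_ <= _ < _) _) => *; lra.
Qed.

Lemma sqr_sum_le (k m : nat) : (0 < k)%N ->
  \sum_(0 <= j < m) ((k + j)%:R ^+ 2 : R)^-1 <= 2.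
Proof.
move=> k0; have kR : (1 : R) <= k%:R by rewrite ler1n.
suff h : \sum_(0 <= j < m) ((k + j)%:R ^+ 2 : R)^-1 <= 2 * (k%:R^-1 - (k + m)%:R^-1).
  apply: le_trans h _; rewrite ler_piMr//.
  have : k%:R^-1 <= (1 : R) by rewrite invf_le1 ?ltr0n.
  have : 0 <= (k + m)%:R^-1 :> R by rewrite invr_ge0.
  by lra.
elim: m => [|m IH]; first by rewrite big_geq// addn0 subrr mulr0.
rewrite big_nat_recr//= addnS -(natr1 (k + m)); set x : R := (k + m)%:R in IH *.
have x1 : 1 <= x by rewrite ler1n addn_gt0 k0.
have : (x ^+ 2)^-1 <= 2 * (x^-1 - (x + 1)^-1).
  have -> : x^-1 - (x + 1)^-1 = (x * (x + 1))^-1 by field; rewrite !gt_eqF//; lra.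
  rewrite -[2 in leRHS]invrK -invfM lef_pV2 ?posrE; [|nra|nra]; nra.
by move: IH; move: (x^-1) (x + 1)^-1 (x ^- 2) => *; lra.
Qed.

(** The factor [ka > 1] pays for truncating the sine product at [n]. *)
Lemma sine_lower (ka : R) : 1 < ka <= 3 / 2 -> exists C1, forall (rho r : R) n, 0 <= rho <= r -> (0 < n)%N ->
  2 * ka / (ka - 1) * r <= n%:R ->
  pi / 2 * rho <= C1 + \sum_(1 <= j < n.+1) ln (1 + (ka * rho / 2) ^+ 2 / j%:R ^+ 2).
Proof.
move=> /andP[k1 k2]; pose e := ka - 1; have e0 : 0 < e by rewrite subr_gt0.
exists (2 + e / 2 + 2 * `|ln (e / 4)|) => rho r n /andP[p0 pr] n0 hn.
have nR : (0 : R) < n%:R by rewrite ltr0n.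
have := p0; rewrite le_eqVlt => /orP[/eqP <-|p1].
  rewrite mulr0; apply: addr_ge0; first by have := normr_ge0 (ln (e / 4)); lra.
  by apply: sumr_ge0 => j _; rewrite ln_ge0// lerDl divr_ge0 ?sqr_ge0.
set s := ka * rho / 2; have s0 : 0 < s by rewrite /s; nra.
have h := sum_ln_ge s0 n0.
have h1 : 2 * s ^+ 2 / n%:R <= s * (e / 2).
  rewrite ler_pdivrMr//.
  have h2 : ka * r <= e / 2 * n%:R.
    have := ler_wpM2l (ltW (divr_gt0 e0 (ltr0n R 2))) hn; apply: le_trans.
    by apply: le_of_eq; rewrite /e; field; rewrite gt_eqF// subr_gt0.
  have -> : 2 * s ^+ 2 = s * (ka * rho) by rewrite /s; field.
  rewrite -[leRHS]mulrA ler_pM2l//; apply: le_trans h2; rewrite ler_pM2l//; lra.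
have h2 : ln (1 + s ^+ 2) <= e / 2 * s + e / 2 + 2 * `|ln (e / 4)|.
  have s1 : 0 < 1 + s by rewrite addr_gt0.
  apply: (@le_trans _ _ (ln ((1 + s) ^+ 2))).
    by rewrite ler_ln ?posrE ?exprn_gt0 ?ltr_pwDl ?sqr_ge0//; nra.
  rewrite lnXn//.
  have e4 : 0 < e / 4 by rewrite divr_gt0.
  have := @ln_le_sub1 R (e / 4 * (1 + s)); rewrite mulr_gt0// lnM ?posrE// => /(_ isT).
  have := ler_norm (- ln (e / 4)); rewrite normrN -[_ *+ 2]mulr_natl; lra.
have h3 : pi / 2 * rho + e * s <= pi * s.
  have p2 := @pi_ge2 R; rewrite /s -/e.
  have : 0 <= rho * ((pi - ka) * e) by apply: mulr_ge0 => //; apply: mulr_ge0; [lra|exact: ltW].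
  rewrite /e; nra.
move: h h1 h2 h3; lra.
Qed.

(** [2 * ln |1 + w / b|] at [w = z^2]. *)
Definition lnfactor (b : R) z := 2 * (ln (Normc.normc (z ^+ 2 + b%:C%C)) - ln b).

Lemma lnfactorE (b : R) z : 0 < b -> sector z ->
  lnfactor b z = ln (1 + (Normc.normc z ^+ 4 + 2 * b * complex.Re (z ^+ 2)) / b ^+ 2).
Proof.
move=> b0 sz; have X0 := sector_Re_sqr sz.
have n0 : 0 < Normc.normc (z ^+ 2 + b%:C%C).
  apply: lt_le_trans (normr_Re_le _); rewrite ReD /=.
  by rewrite gtr0_norm; lra.
have -> : 1 + (Normc.normc z ^+ 4 + 2 * b * complex.Re (z ^+ 2)) / b ^+ 2 = (Normc.normc (z ^+ 2 + b%:C%C) / b) ^+ 2.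
  by rewrite expr_div_n normc_sqrDr; field; rewrite gt_eqF.
by rewrite lnXn ?divr_gt0// ln_div// /lnfactor mulr_natl.
Qed.

Lemma lnfactor_ge (b : R) z : 0 < b -> sector z ->
  ln (1 + Normc.normc z ^+ 4 / b ^+ 2) <= lnfactor b z.
Proof.
move=> b0 sz; have X0 := sector_Re_sqr sz; rewrite lnfactorE//.
have h1 : 0 <= Normc.normc z ^+ 4 / b ^+ 2 by rewrite divr_ge0 ?sqr_ge0 ?exprn_ge0 ?normc_ge0.
have h2 : 0 <= 2 * b * complex.Re (z ^+ 2) / b ^+ 2 by rewrite divr_ge0 ?sqr_ge0// !mulr_ge0// ltW.
by rewrite mulrDl ler_ln ?posrE; lra.
Qed.

Lemma lnfactor_le (b : R) z : 0 < b -> sector z ->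
  lnfactor b z <= Normc.normc z ^+ 4 / b ^+ 2 + 2 * complex.Re (z ^+ 2) / b.
Proof.
move=> b0 sz; have X0 := sector_Re_sqr sz; rewrite lnfactorE//.
have h1 : 0 <= Normc.normc z ^+ 4 / b ^+ 2 by rewrite divr_ge0 ?sqr_ge0 ?exprn_ge0 ?normc_ge0.
have h2 : 0 <= 2 * b * complex.Re (z ^+ 2) / b ^+ 2 by rewrite divr_ge0 ?sqr_ge0// !mulr_ge0// ltW.
apply: le_trans (ln_le_sub1 _) _; first by rewrite mulrDl; lra.
by apply: le_of_eq; field; rewrite gt_eqF.
Qed.

Lemma harmonic_at_lnfactor (b : R) z : 0 < b -> sector z -> harmonic_at (lnfactor b) z.
Proof.
move=> b0 sz; apply: harmonic_atZ.
apply: (@harmonic_atD _ _ (fun=> - ln b)); last exact: harmonic_at_cst.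
apply: harmonic_at_ln; rewrite -normc_gt0; apply: lt_le_trans (normr_Re_le _); rewrite ReD /=.
by have X0 := sector_Re_sqr sz; rewrite gtr0_norm; lra.
Qed.

Lemma blaschke_term_ge (a A rho : R) : 1 <= a -> a <= A -> 0 < rho -> 4 * rho ^+ 2 <= A ->
  A^-1 - 2 * rho / A ^+ 2 <= a / (rho + a) ^+ 2.
Proof.
move=> a1 aA p0 pA.
have a0 : 0 < a by lra. have A0 : 0 < A by lra.
have s0 : 0 < (rho + a) ^+ 2 by rewrite exprn_gt0// addr_gt0.
have [ap|pa] := leP rho a.
  have S0 : 0 < (rho + A) ^+ 2 by rewrite exprn_gt0// addr_gt0.
  apply: (@le_trans _ _ (A / (rho + A) ^+ 2)).
    rewrite ler_pdivlMr//.
    have -> : (A^-1 - 2 * rho / A ^+ 2) * (rho + A) ^+ 2 = A - (3 * rho ^+ 2 * A + 2 * rho ^+ 3) / A ^+ 2.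
      by field; rewrite gt_eqF.
    rewrite gerBl divr_ge0 ?sqr_ge0// addr_ge0 ?mulr_ge0 ?sqr_ge0 ?exprn_ge0// ltW//.
  rewrite ler_pdivrMr// mulrAC ler_pdivlMr//.
  have : 0 <= (A - a) * (a * A - rho ^+ 2).
    rewrite mulr_ge0 ?subr_ge0// expr2 ler_pM//; try exact: ltW; exact: le_trans aA.
  nra.
have h0 : 0 <= 2 * rho / A ^+ 2 by rewrite divr_ge0 ?sqr_ge0// mulr_ge0// ltW.
apply: (@le_trans _ _ A^-1); first by lra.
apply: (@le_trans _ _ (4 * rho ^+ 2)^-1).
  by rewrite lef_pV2 ?posrE// mulr_gt0 ?exprn_gt0.
rewrite ler_pdivlMr// mulrC ler_pdivrMr ?mulr_gt0 ?exprn_gt0//.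
have : (rho + a) ^+ 2 <= (2 * rho) ^+ 2 by rewrite lerXn2r ?nnegrE; lra.
nra.
Qed.

End SectorVanishing.

(** * Uniqueness in the sector *)

Section VanishSector.
Context {R : realType}.
Implicit Types (N : R[i] -> R) (z w : R[i]).

Lemma ln_unbounded (T : R) (k : nat) : exists m : nat, T <= ln ((k + m)%:R : R).
Proof.
pose m := (Num.truncn (expR T)).+1; exists m.
have h : expR T <= m%:R by exact/ltW/truncnS_gt.
rewrite -(expRK T) ler_ln ?posrE ?expR_gt0//.
  by apply: le_trans h _; rewrite ler_nat leq_addl.
by rewrite ltr0n addn_gt0 orbT.
Qed.

(** Carlson's theorem in the variable [w = z^2], which maps the sector to the right
    half-plane, the growth on the rays to [exp (pi |w| / 2)] and the zeros to points
    of linear density [d]. A truncated sine product with zeros at [- 2 j / ka]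
    removes the growth on the imaginary axis; at a fixed point this costs
    [ka * Re w * ln m], while the Blaschke factors of [m] zeros gain
    [2 * d * Re w * ln m]. Since [2 * d > ka], letting [m] grow forces [N = 0]. *)
Lemma vanish_sector N (C0 d : R) (k1 : nat) :
  submean N -> locally_lipschitz N -> (forall z, 0 <= N z) ->
  (forall z, N z <= C0 * expR (pi * complex.Im z ^+ 2)) -> 1 / 2 < d ->
  (forall k m, (k1 <= k)%N -> exists s : seq R, [/\ uniq s, size s = m &
     forall j, (j < m)%N -> [/\ 1 <= s`_j, s`_j ^+ 2 <= (k + j)%:R / d & N (s`_j)%:C%C = 0]]) ->
  forall z, `|complex.Im z| < complex.Re z -> N z = 0.
Proof.
move=> sN lN N0 hC d1 hs z0 hz0.
have sz0 : sector z0 by exact: ltW.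
(* any ka with 1 < ka < 2 d; the bound 3 / 2 is for sine_lower *)
pose ka := Order.min ((1 + 2 * d) / 2) (3 / 2).
have [ka1 ka2 ka3] : [/\ 1 < ka, ka <= 3 / 2 & ka < 2 * d].
  by rewrite /ka lt_min ge_min lexx orbT gt_min; split => //; [apply/andP; split|apply/orP; left]; lra.
have [|C1 hC1] := @sine_lower R ka; first by rewrite ka1.
pose C0' := `|C0| + 1.
have C0p : 0 < C0' by rewrite ltr_wpDl.
pose K := 2 * ka / (ka - 1).
have K0 : 0 < K by rewrite /K divr_gt0 ?subr_gt0// mulr_gt0//; lra.
have d0 : 0 < d by lra.
set X0 := complex.Re (z0 ^+ 2).
have Xp : 0 < X0.
  rewrite /X0 Re_sqr subr_gt0 -(real_normK (num_real (complex.Im z0))) ltr_pXn2r// ?nnegrE//.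
  exact: le_trans (normr_ge0 _) (ltW hz0).
pose rho := Normc.normc z0 ^+ 2.
have rX : X0 <= rho by rewrite /rho -normcX; exact: le_trans (ler_norm _) (normr_Re_le _).
have rho0 : 0 < rho by exact: lt_le_trans rX.
apply/eqP; rewrite eq_le N0 andbT leNgt; apply/negP => Nz.
pose k := maxn (maxn k1 1) (Num.truncn (d * (4 * rho ^+ 2 + rho))).+1.
have kk1 : (k1 <= k)%N by rewrite !leq_max leqnn.
have k0 : (0 < k)%N by rewrite /k leq_max orbT.
have kbig : 4 * rho ^+ 2 + rho <= k%:R / d.
  rewrite ler_pdivlMr// mulrC; apply: le_trans (ltW (truncnS_gt _)) _.
  by rewrite ler_nat /k leq_maxr.
pose D := ln (1 + 2 * K / d).
pose C2 := 2 * d * X0 + ka * X0 * (1 + D) + ka ^+ 2 * rho ^+ 2 / 2 + 2 * X0 * (d * ln k%:R + 4 * rho * d ^+ 2).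
pose T := (ln (C0' * expR C1 * expR 2 / N z0) + C2) / (X0 * (2 * d - ka)) + 1.
have Y0 : 0 < X0 * (2 * d - ka) by rewrite mulr_gt0// subr_gt0.
have [m hm] := ln_unbounded T k.
have [s [us sm sP]] := hs k m kk1.
have ns a : a \in s -> z0 != a%:C%C.
  move=> /(nthP 0)[j]; rewrite sm => /sP[_ _ Na] <-.
  by apply: contraTneq Nz => ->; rewrite Na ltxx.
pose r := 2 * (k + m)%:R / d.
have km0 : (1 : R) <= (k + m)%:R by rewrite ler1n addn_gt0 k0.
have r0 : 0 < r by rewrite divr_gt0// mulr_gt0//; move: km0; clear -R; lra.
pose B := Num.sqrt r.
have B0 : 0 < B by rewrite sqrtr_gt0.
have B2 : B ^+ 2 = r by rewrite sqr_sqrtr// ltW.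
pose n := (Num.truncn (K * r)).+1.
have nK : K * r <= n%:R by exact/ltW/truncnS_gt.
have nle : n%:R <= (k + m)%:R * (1 + 2 * K / d).
  have h := @truncn_le R (K * r).
  have : (Num.truncn (K * r))%:R <= K * r by rewrite h// mulr_ge0 ?ltW.
  rewrite /n -natr1 /r.
  have -> : K * (2 * (k + m)%:R / d) = (k + m)%:R * (2 * K / d) by ring.
  move: km0; move: (2 * K / d) => u; clear -R; lra.
pose b (j : nat) := 2 * j%:R / ka.
have ka0 : 0 < ka by clear -ka1; lra.
have b0 j : (0 < j)%N -> 0 < b j by move=> j0; rewrite /b divr_gt0// mulr_gt0// ltr0n.
pose c := 4 * (size s)%:R / B ^+ 2.
have c0 : 0 <= c by rewrite divr_ge0 ?sqr_ge0// mulr_ge0.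
have cd : c <= 2 * d.
  rewrite /c B2 /r sm ler_pdivrMr; last by rewrite divr_gt0// mulr_gt0//; move: km0; clear -R; lra.
  have -> : 2 * d * (2 * (k + m)%:R / d) = 4 * (k + m)%:R by field; rewrite gt_eqF.
  by rewrite ler_pM2l// ler_nat leq_addl.
pose g z := (pi / 2 - c) * complex.Re (z ^+ 2) + -1 * \sum_(1 <= j < n.+1) lnfactor (b j) z.
have zB z : Normc.normc z <= B -> Normc.normc z ^+ 2 <= r.
  by move=> h; rewrite -B2 lerXn2r ?nnegrE ?normc_ge0// ltW.
have sumge z : sector z -> Normc.normc z <= B ->
    pi / 2 * Normc.normc z ^+ 2 <= C1 + \sum_(1 <= j < n.+1) lnfactor (b j) z.
  move=> sz hz; have := hC1 (Normc.normc z ^+ 2) r n _ isT nK; rewrite sqr_ge0 zB// => /(_ isT).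
  move=> /le_trans; apply; rewrite lerD2l.
  apply: ler_sum_nat => j /andP[j1 _].
  have := lnfactor_ge (b0 j j1) sz; apply: le_trans; apply: le_of_eq; congr (ln (1 + _)).
  by rewrite /b; field; rewrite !gt_eqF// ltr0n.
have main : N z0 * expR (g z0 + \sum_(a <- s) blaschke a z0) <= (C0' * expR C1) * expR 2.
  apply: (@blaschke_estimate _ N g s B (C0' * expR C1) (pi / 2 * r)) => //.
  - move=> z sz hz; apply: harmonic_atD; first by apply: harmonic_atZ; exact: harmonic_at_Re_sqr.
    apply: harmonic_atZ; rewrite /index_iota; apply: harmonic_at_sum_seq => j.
    by rewrite mem_iota => /andP[j1 _]; apply: harmonic_at_lnfactor => //; exact: b0.
  - move=> z sz hz; have X := sector_Re_sqr sz.
    have XB : complex.Re (z ^+ 2) <= r.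
      by apply: le_trans (zB _ hz); rewrite -normcX; exact: le_trans (ler_norm _) (normr_Re_le _).
    have S0 : 0 <= \sum_(1 <= j < n.+1) lnfactor (b j) z.
      rewrite big_nat_cond sumr_ge0// => j /andP[/andP[j1 _] _].
      apply: le_trans (lnfactor_ge (b0 j j1) sz); rewrite ln_ge0// lerDl.
      by rewrite divr_ge0 ?sqr_ge0 ?exprn_ge0 ?normc_ge0.
    have h1 : 0 <= c * complex.Re (z ^+ 2) by rewrite mulr_ge0.
    have h2 : pi / 2 * complex.Re (z ^+ 2) <= pi / 2 * r.
      by rewrite ler_wpM2l// divr_ge0// pi_ge0.
    by rewrite /g; clear -h1 h2 S0; lra.
  - move=> a /(nthP 0)[j]; rewrite sm => jm <-; have [h1 h2 h3] := sP _ jm; split => //.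
    rewrite B2 /r; apply: le_trans h2 _.
    have -> : 2 * (k + m)%:R / d / 2 = (k + m)%:R / d by field; rewrite gt_eqF.
    by rewrite ler_pM2r ?invr_gt0// ler_nat leq_add2l ltnW.
  - by rewrite mulr_gt0// expR_gt0.
  - move=> z sz hz.
    have h1 : N z <= C0' * expR (pi * complex.Im z ^+ 2).
      apply: le_trans (hC z) _; rewrite ler_wpM2r ?expR_ge0// /C0'.
      by apply: le_trans (ler_norm _) _; rewrite lerDl.
    apply: le_trans (ler_wpM2r (expR_ge0 _) h1) _.
    rewrite -!(mulrA C0') ler_wpM2l ?(ltW C0p)// -!expRD ler_expR /g -/c.
    have := sumge _ sz hz; rewrite normc_sqr Re_sqr; clear -R; lra.
  - rewrite -(@ler_pXn2r _ 2) ?nnegrE ?normc_ge0 ?(ltW B0)// B2 -/rho /r.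
    have h1 : k%:R / d <= 2 * (k + m)%:R / d.
      rewrite ler_pM2r ?invr_gt0// natrD; have : (0 : R) <= k%:R by []; have : (0 : R) <= m%:R by []; clear -R; lra.
    apply: le_trans h1; apply: le_trans kbig; rewrite lerDr mulr_ge0 ?sqr_ge0//.
have bl : 2 * X0 * (d * (ln (k + m)%:R - ln k%:R) - 4 * rho * d ^+ 2) <= \sum_(a <- s) blaschke a z0.
  rewrite (big_nth 0) sm.
  apply: (@le_trans _ _ (\sum_(0 <= j < m) (2 * X0 * (d * (k + j)%:R^-1 - 2 * rho * d ^+ 2 * ((k + j)%:R ^+ 2)^-1)))).
    rewrite -mulr_sumr; rewrite ler_pM2l ?mulr_gt0// sumrB -!mulr_sumr.
    have h1 : d * (ln (k + m)%:R - ln k%:R) <= d * \sum_(0 <= j < m) ((k + j)%:R : R)^-1.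
      by rewrite ler_pM2l// harmonic_sum_ge.
    have h2 : 2 * rho * d ^+ 2 * \sum_(0 <= j < m) ((k + j)%:R ^+ 2 : R)^-1 <= 2 * rho * d ^+ 2 * 2.
      by rewrite ler_wpM2l ?sqr_sum_le// mulr_ge0 ?sqr_ge0// mulr_ge0// ltW.
    clear -h1 h2; lra.
  apply: ler_sum_nat => j /andP[_ jm].
  have [s1 s2 s3] := sP _ jm.
  apply: le_trans (blaschke_ge sz0 s1 (ns _ (mem_nth _ _))); last by rewrite sm.
  rewrite -/X0 -/rho ler_pM2l ?mulr_gt0//.
  have kj : (0 : R) < (k + j)%:R by rewrite ltr0n addn_gt0 k0.
  have e1 : 1 <= s`_j ^+ 2 by rewrite exprn_ege1.
  have := @blaschke_term_ge R (s`_j ^+ 2) ((k + j)%:R / d) rho e1 s2 rho0.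
  have -> : ((k + j)%:R / d)^-1 - 2 * rho / ((k + j)%:R / d) ^+ 2 = d * (k + j)%:R^-1 - 2 * rho * d ^+ 2 * ((k + j)%:R ^+ 2)^-1.
    by move: ((k + j)%:R : R) kj => u u0; field; rewrite !gt_eqF.
  apply; apply: (@le_trans _ _ (k%:R / d)).
    by apply: le_trans kbig; rewrite lerDl ltW.
  by rewrite ler_pM2r ?invr_gt0// ler_nat leq_addr.
have lf : \sum_(1 <= j < n.+1) lnfactor (b j) z0 <= ka * X0 * (1 + D + ln (k + m)%:R) + ka ^+ 2 * rho ^+ 2 / 2.
  have h1 : \sum_(1 <= j < n.+1) (j%:R : R)^-1 <= 1 + D + ln (k + m)%:R.
    apply: le_trans (harmonic_sum_le _) _ => //; rewrite -addrA lerD2l /D addrC -lnM ?posrE.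
    + rewrite ler_ln ?posrE ?ltr0n// mulr_gt0//; first by move: km0; clear -R; lra.
      by rewrite addr_gt0// divr_gt0// mulr_gt0.
    + by move: km0; clear -R; lra.
    + by rewrite addr_gt0// divr_gt0// mulr_gt0.
  have h2 : \sum_(1 <= j < n.+1) (j%:R ^+ 2 : R)^-1 <= 2.
    have := @sqr_sum_le R 1 n isT; apply: le_trans; apply: le_of_eq.
    by rewrite big_add1 /=; apply: eq_bigr => j _; rewrite add1n.
  apply: (@le_trans _ _ (\sum_(1 <= j < n.+1) (ka ^+ 2 * rho ^+ 2 / 4 * (j%:R ^+ 2)^-1 + ka * X0 * j%:R^-1))).
    apply: ler_sum_nat => j /andP[j1 _].
    apply: le_trans (lnfactor_le (b0 j j1) sz0) _; apply: le_of_eq.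
    by rewrite -/X0 /rho /b; field; rewrite !gt_eqF// ltr0n.
  rewrite big_split -!mulr_sumr /= addrC; apply: lerD; first by rewrite ler_pM2l// mulr_gt0.
  have : ka ^+ 2 * rho ^+ 2 / 4 * \sum_(1 <= j < n.+1) (j%:R ^+ 2 : R)^-1 <= ka ^+ 2 * rho ^+ 2 / 4 * 2.
    by rewrite ler_wpM2l// divr_ge0// mulr_ge0 ?sqr_ge0.
  by clear -R; lra.
have fin : X0 * (2 * d - ka) * ln (k + m)%:R - C2 <= g z0 + \sum_(a <- s) blaschke a z0.
  have h1 : c * X0 <= 2 * d * X0 by rewrite ler_pM2r.
  have h2 : 0 <= pi / 2 * X0 by rewrite mulr_ge0 ?divr_ge0 ?pi_ge0// ltW.
  rewrite /g -/X0 /C2; move: bl lf h1 h2.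
  set L := ln (k + m)%:R; set S1 := \sum_(a <- s) _; set S2 := \sum_(1 <= j < n.+1) _.
  move: (ln k%:R) => lk; clear -R; lra.
have hT : ln (C0' * expR C1 * expR 2 / N z0) < X0 * (2 * d - ka) * ln (k + m)%:R - C2.
  have := ler_wpM2l (ltW Y0) hm; rewrite /T mulrDr mulr1.
  rewrite (mulrC _ (_ / _)) divfK ?gt_eqF//.
  by move: Y0; move: (X0 * (2 * d - ka)) (ln _); clear -R => *; lra.
have Q0 : 0 < C0' * expR C1 * expR 2 by rewrite !mulr_gt0 ?expR_gt0.
have := lt_le_trans hT fin.
rewrite -ltr_expR lnK ?posrE ?divr_gt0// ltr_pdivrMr// [ltRHS]mulrC ltNge.
by rewrite main.
Qed.

End VanishSector.

(** * Complex-valued functions in L^p *)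

Section ComplexLp.
Context {R : realType}.
Variables (p : R) (p1 : 1 <= p).
Notation mu := (@lebesgue_measure R).
Implicit Types f g : R -> R[i].

Let p0 : 0 < p. Proof. exact: lt_le_trans p1. Qed.
Let pn0 : p != 0. Proof. by rewrite gt_eqF. Qed.

Lemma cmeasurable_normc f : cmeasurable_fun f -> measurable_fun [set: R] (fun t => Normc.normc (f t)).
Proof.
move=> [mr mi].
have -> : (fun t => Normc.normc (f t)) = (fun t => Num.sqrt (complex.Re (f t) ^+ 2 + complex.Im (f t) ^+ 2)).
  by apply/funext => t; case: (f t).
apply: (measurableT_comp (f := @Num.sqrt R)).
  by apply: continuous_measurable_fun; exact: sqrt_continuous.
by apply: measurable_funD; apply: measurable_funX.
Qed.

Lemma cmeasurableD f g : cmeasurable_fun f -> cmeasurable_fun g -> cmeasurable_fun (fun t => f t + g t).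
Proof.
move=> [f1 f2] [g1 g2]; split.
  by under eq_fun do rewrite ReD; exact: measurable_funD.
by under eq_fun do rewrite ImD; exact: measurable_funD.
Qed.

Lemma cmeasurableM f g : cmeasurable_fun f -> cmeasurable_fun g -> cmeasurable_fun (fun t => f t * g t).
Proof.
move=> [f1 f2] [g1 g2]; split.
  by under eq_fun do rewrite ReM; apply: measurable_funB; exact: measurable_funM.
by under eq_fun do rewrite ImM; apply: measurable_funD; exact: measurable_funM.
Qed.

Lemma cmeasurable_cst (c : R[i]) : cmeasurable_fun (fun=> c).
Proof. by split; exact: measurable_cst. Qed.

Lemma cmeasurableZ c f : cmeasurable_fun f -> cmeasurable_fun (fun t => c * f t).
Proof. exact/cmeasurableM/cmeasurable_cst. Qed.

Lemma cmeasurableB f g : cmeasurable_fun f -> cmeasurable_fun g -> cmeasurable_fun (fun t => f t - g t).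
Proof.
move=> hf hg; have := cmeasurableD hf (cmeasurableZ (-1) hg).
by under eq_fun do rewrite mulN1r.
Qed.

Lemma cmeasurable_real (f : R -> R) : measurable_fun [set: R] f -> cmeasurable_fun (fun t => (f t)%:C%C).
Proof. by move=> mf; split => //=; exact: measurable_cst. Qed.

Lemma cLnormE f : cLnorm p%:E f = ((\int[mu]_t (Normc.normc (f t) `^ p)%:E) `^ p^-1)%E.
Proof.
rewrite /cLnorm unlock; under eq_integral do rewrite /= ger0_norm ?normc_ge0//.
by [].
Qed.

Let mpow (h : R -> R) : measurable_fun [set: R] h -> measurable_fun [set: R] (fun t => (h t `^ p)%:E).
Proof.
move=> mh; apply/measurable_EFinP.
by apply: (measurableT_comp (f := fun x => x `^ p)) => //; exact: measurable_powR.
Qed.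

Lemma le_cLnorm f (h : R -> R) : cmeasurable_fun f -> measurable_fun [set: R] h ->
  (forall t, Normc.normc (f t) <= h t) ->
  (cLnorm p%:E f <= (\int[mu]_t (h t `^ p)%:E) `^ p^-1)%E.
Proof.
move=> mf mh fh; rewrite cLnormE; apply: gt0_ler_poweR; first by rewrite invr_ge0 ltW.
- by rewrite in_itv/= leey integral_ge0// => t _; rewrite lee_fin powR_ge0.
- by rewrite in_itv/= leey integral_ge0// => t _; rewrite lee_fin powR_ge0.
apply: ge0_le_integral => //.
- by move=> t _; rewrite lee_fin powR_ge0.
- exact: (mpow (cmeasurable_normc mf)).
- exact: (mpow mh).
- move=> t _; rewrite lee_fin; apply: ge0_ler_powR; rewrite ?(ltW p0) ?nnegrE ?normc_ge0//.
  exact: le_trans (normc_ge0 _) (fh t).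
Qed.

Lemma cLnormD f g : cmeasurable_fun f -> cmeasurable_fun g ->
  (cLnorm p%:E (fun t => f t + g t)%R <= cLnorm p%:E f + cLnorm p%:E g)%E.
Proof.
move=> mf mg.
have m1 := cmeasurable_normc mf; have m2 := cmeasurable_normc mg.
apply: le_trans (le_cLnorm (h := fun t => Normc.normc (f t) + Normc.normc (g t)) _ _ _) _.
- exact: cmeasurableD.
- exact: measurable_funD.
- by move=> t; exact: le_normcD.
have := minkowski_EFin mu m1 m2 p1; rewrite /cLnorm; apply: le_trans.
rewrite unlock; apply: gt0_ler_poweR; first by rewrite invr_ge0 ltW.
- by rewrite in_itv/= leey integral_ge0// => t _; rewrite lee_fin powR_ge0.
- by rewrite in_itv/= leey integral_ge0// => t _; rewrite poweR_ge0.
apply: ge0_le_integral => //.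
- by move=> t _; rewrite lee_fin powR_ge0.
- exact: (mpow (measurable_funD m1 m2)).
- exact: (mpow (measurableT_comp (@normr_measurable R setT) (measurable_funD m1 m2))).
- by move=> t _; rewrite /= ger0_norm// addr_ge0// normc_ge0.
Qed.

Lemma cLnormZ c f : cmeasurable_fun f ->
  cLnorm p%:E (fun t => c * f t)%R = ((Normc.normc c)%:E * cLnorm p%:E f)%E.
Proof.
move=> mf; rewrite !cLnormE.
under eq_integral do rewrite Normc.normcM powRM ?normc_ge0// EFinM.
rewrite ge0_integralZl_EFin ?powR_ge0//.
- rewrite poweRM ?integral_ge0 ?lee_fin ?powR_ge0//; last by move=> t _; rewrite lee_fin powR_ge0.
  by rewrite poweR_EFin -powRrM mulfV// powRr1 ?normc_ge0.
- by move=> t _; rewrite lee_fin powR_ge0.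
- exact: (mpow (cmeasurable_normc mf)).
Qed.

Lemma cLnorm_ge0 f : (0 <= cLnorm p%:E f)%E.
Proof. exact: Lnorm_ge0. Qed.

Lemma cLnorm0 : cLnorm p%:E (fun=> 0) = 0%E.
Proof.
rewrite cLnormE; under eq_integral do rewrite Normc.normc0 powR0//.
by rewrite integral0 poweR0r// invr_neq0.
Qed.

Lemma cLp0 : cLp p%:E (fun=> 0).
Proof. by split; [exact: cmeasurable_cst|rewrite cLnorm0 ltry]. Qed.

Lemma cLpD f g : cLp p%:E f -> cLp p%:E g -> cLp p%:E (fun t => f t + g t).
Proof.
move=> [mf hf] [mg hg]; split; first exact: cmeasurableD.
by apply: le_lt_trans (cLnormD mf mg) _; exact: lte_add_pinfty.
Qed.

Lemma cLpZ c f : cLp p%:E f -> cLp p%:E (fun t => c * f t).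
Proof.
move=> [mf hf]; split; first exact: cmeasurableZ.
by rewrite cLnormZ// lte_mul_pinfty// lee_fin normc_ge0.
Qed.

Lemma cLpB f g : cLp p%:E f -> cLp p%:E g -> cLp p%:E (fun t => f t - g t).
Proof. by move=> hf hg; have := cLpD hf (cLpZ (-1) hg); under eq_fun do rewrite mulN1r. Qed.

Lemma cLnorm_lt_pow f (e : R) : 0 < e -> (\int[mu]_t (Normc.normc (f t) `^ p)%:E < (e `^ p)%:E)%E ->
  (cLnorm p%:E f < e%:E)%E.
Proof.
move=> e0 h; rewrite cLnormE.
have i0 : (0 <= \int[mu]_t (Normc.normc (f t) `^ p)%:E)%E.
  by rewrite integral_ge0// => t _; rewrite lee_fin powR_ge0.
have ifin : (\int[mu]_t (Normc.normc (f t) `^ p)%:E)%E \is a fin_num.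
  by rewrite ge0_fin_numE// (lt_trans h)// ltry.
move: h; rewrite -(fineK ifin) poweR_EFin !lte_fin => h.
have -> : e = (e `^ p) `^ p^-1 by rewrite -powRrM mulfV// powRr1// ltW.
by apply: gt0_ltr_powR; rewrite ?invr_gt0 ?nnegrE ?powR_ge0 ?fine_ge0.
Qed.

(** The integrand [|F n - f|^p] is dominated by [(2 * H)^p]. *)
Lemma cLnorm_dominated (F : nat -> R -> R[i]) f (H : R -> R) :
  (forall n, cmeasurable_fun (F n)) -> cmeasurable_fun f -> measurable_fun [set: R] H ->
  (\int[mu]_t (H t `^ p)%:E < +oo)%E ->
  (forall n t, Normc.normc (F n t) <= H t) -> (forall t, Normc.normc (f t) <= H t) ->
  (forall t, Normc.normc (F n t - f t) @[n --> \oo] --> (0 : R)) ->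
  forall e, 0 < e -> exists n, (cLnorm p%:E (fun t => F n t - f t)%R < e%:E)%E.
Proof.
move=> mF mf mH iH FH fH Ff e e0.
have H0 t : 0 <= H t by exact: le_trans (normc_ge0 _) (fH t).
pose G n t : \bar R := (Normc.normc (F n t - f t) `^ p)%:E.
have mG n : measurable_fun [set: R] (G n).
  by apply: mpow; apply: cmeasurable_normc; exact: cmeasurableB.
have iG : mu.-integrable [set: R] (fun t => ((2 * H t) `^ p)%:E).
  apply/integrableP; split; first by apply: mpow; exact: measurable_funM.
  under eq_integral do rewrite gee0_abs ?lee_fin ?powR_ge0// powRM// EFinM.
  rewrite ge0_integralZl_EFin ?powR_ge0//; last 2 first.
    by move=> t _; rewrite lee_fin powR_ge0.
    exact: mpow.
  by rewrite lte_mul_pinfty ?lee_fin ?powR_ge0.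
have ae1 : {ae mu, forall t, setT t -> G ^~ t @ \oo --> (cst 0%E : R -> \bar R) t}.
  apply: aeW => t _; apply: cvg_EFin; first exact: nearW.
    have := Ff t => /cvgrPdist_lt h; apply/cvgrPdist_lt => d d0.
    have d1 : 0 < d `^ p^-1 by rewrite powR_gt0.
    have := h _ d1; apply: filterS => n; rewrite !sub0r !normrN !ger0_norm ?powR_ge0 ?normc_ge0// => hn.
    have -> : d = (d `^ p^-1) `^ p by rewrite -powRrM mulVf// powRr1// ltW.
    by apply: gt0_ltr_powR; rewrite ?nnegrE ?normc_ge0 ?powR_ge0.
have ae2 : {ae mu, forall t n, setT t -> (`|G n t| <= ((2 * H t) `^ p)%:E)%E}.
  apply: aeW => t n _; rewrite gee0_abs ?lee_fin ?powR_ge0//.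
    apply: ge0_ler_powR; rewrite ?(ltW p0) ?nnegrE ?normc_ge0 ?mulr_ge0//.
    by apply: le_trans (le_normcB _ _) _; rewrite mulr2n mulrDl mul1r lerD.
have [_ _] := @dominated_convergence _ _ R mu setT measurableT G (cst 0%E) _ mG (measurable_cst _) ae1 iG ae2.
rewrite integral0.
move=> /fine_cvgP[h1 /cvgrPdist_lt/(_ (e `^ p))].
rewrite powR_gt0// => /(_ isT) h2.
have [n _ hn] : \forall n \near \oo, (\int[mu]_t G n t)%E \is a fin_num /\ `|0 - fine (\int[mu]_t G n t)%E| < e `^ p.
  by near=> n; split; [near: n|near: n; exact: h2].
exists n; apply: cLnorm_lt_pow => //; have [h3 h4] := hn n (leqnn n).
rewrite -(fineK h3) lte_fin; apply: le_lt_trans h4.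
by rewrite sub0r normrN ler_norm.
Unshelve. all: by end_near. Qed.

End ComplexLp.

(** * Distance to a subspace of L^p *)

Section LpDistance.
Context {R : realType}.
Variables (p : R) (p1 : 1 <= p).
Notation mu := (@lebesgue_measure R).
Notation Lp := (@cLp R p%:E).
Implicit Types f g u v : R -> R[i].
Implicit Types V : set (R -> R[i]).

Let p0 : 0 < p. Proof. exact: lt_le_trans p1. Qed.

Definition rnorm f : R := fine (cLnorm p%:E f).

Lemma rnormK f : Lp f -> (rnorm f)%:E = cLnorm p%:E f.
Proof. by move=> [_ h]; rewrite fineK// ge0_fin_numE// cLnorm_ge0. Qed.

Lemma rnorm_ge0 f : 0 <= rnorm f.
Proof. by rewrite fine_ge0// cLnorm_ge0. Qed.

Lemma rnormD f g : Lp f -> Lp g -> rnorm (fun t => f t + g t) <= rnorm f + rnorm g.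
Proof.
move=> hf hg; rewrite -lee_fin EFinD !rnormK//; last exact: cLpD.
by apply: cLnormD => //; [case: hf|case: hg].
Qed.

Lemma rnormZ c f : Lp f -> rnorm (fun t => c * f t) = Normc.normc c * rnorm f.
Proof.
move=> hf; apply: EFin_inj; rewrite EFinM !rnormK//; last exact: cLpZ.
by rewrite cLnormZ//; case: hf.
Qed.

Lemma rnorm0 : rnorm (fun=> 0) = 0.
Proof. by rewrite /rnorm cLnorm0. Qed.

(** The [L^p]-distance to a set of functions, used as a seminorm on the quotient
    by a subspace; it stands in for the dual space in uniqueness arguments. *)
Definition dist V f : R := inf [set rnorm (fun t => f t - v t) | v in V].

Definition subspaceLp V := [/\ V `<=` Lp, V (fun=> 0),
  forall u v, V u -> V v -> V (fun t => u t + v t) & forall c u, V u -> V (fun t => c * u t)].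

Lemma dist_le V f v : V v -> dist V f <= rnorm (fun t => f t - v t).
Proof.
move=> Vv; apply: ge_inf; last by exists v.
by exists 0 => _ [w _ <-]; exact: rnorm_ge0.
Qed.

Lemma dist_ge0 V f : V (fun=> 0) -> 0 <= dist V f.
Proof.
move=> V0; apply: lb_le_inf; first by exists (rnorm (fun t => f t - 0)), (fun=> 0).
by move=> _ [w _ <-]; exact: rnorm_ge0.
Qed.

Lemma dist_lt V f e : V (fun=> 0) -> 0 < e -> exists2 v, V v & rnorm (fun t => f t - v t) < dist V f + e.
Proof.
move=> V0 e0; have [|_ [v Vv <-] h] := @inf_adherent _ [set rnorm (fun t => f t - v t) | v in V] _ e0.
  split; first by exists (rnorm (fun t => f t - 0)), (fun=> 0).
  by exists 0 => _ [w _ <-]; exact: rnorm_ge0.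
by exists v.
Qed.

Lemma dist_le_norm V f : V (fun=> 0) -> dist V f <= rnorm f.
Proof. by move=> /(dist_le f); under eq_fun do rewrite subr0. Qed.

Lemma dist0 V f : subspaceLp V -> V f -> dist V f = 0.
Proof.
move=> [_ V0 _ _] Vf; apply/eqP; rewrite eq_le dist_ge0// andbT.
by have := dist_le f Vf; under eq_fun do rewrite subrr; rewrite rnorm0.
Qed.

Lemma distD V f g : subspaceLp V -> Lp f -> Lp g ->
  dist V (fun t => f t + g t) <= dist V f + dist V g.
Proof.
move=> [VL V0 VD _] hf hg; apply/ler_addgt0Pr => e e0.
have e2 : 0 < e / 2 by rewrite divr_gt0.
have [u Vu hu] := dist_lt f V0 e2; have [v Vv hv] := dist_lt g V0 e2.
apply: le_trans (dist_le _ (VD _ _ Vu Vv)) _.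
have -> : (fun t => f t + g t - (u t + v t)) = (fun t => (f t - u t) + (g t - v t)).
  by apply/funext => t; ring.
apply: le_trans (rnormD _ _) _; try by apply: cLpB => //; exact: VL.
by move: hu hv; lra.
Qed.

Lemma distZ V c f : subspaceLp V -> Lp f -> dist V (fun t => c * f t) <= Normc.normc c * dist V f.
Proof.
move=> [VL V0 _ VZ] hf; apply/ler_addgt0Pr => e e0.
have c0 := normc_ge0 c; have c1 : 0 < Normc.normc c + 1 by rewrite ltr_wpDl.
have e2 : 0 < e / (Normc.normc c + 1) by rewrite divr_gt0.
have [u Vu hu] := dist_lt f V0 e2.
apply: le_trans (dist_le _ (VZ c _ Vu)) _.
have -> : (fun t => c * f t - c * u t) = (fun t => c * (f t - u t)).
  by apply/funext => t; ring.
rewrite rnormZ; last by apply: cLpB => //; exact: VL.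
apply: le_trans (ler_wpM2l c0 (ltW hu)) _; rewrite mulrDr lerD2l mulrCA ler_piMr ?(ltW e0)//.
by rewrite ler_pdivrMr// mul1r lerDl.
Qed.

Lemma cLp_sum (I : Type) (s : seq I) (F : I -> R -> R[i]) : (forall i, Lp (F i)) ->
  Lp (fun t => \sum_(i <- s) F i t).
Proof.
move=> hF; elim: s => [|i s IH]; first by under eq_fun do rewrite big_nil; exact: cLp0.
by under eq_fun do rewrite big_cons; exact: cLpD.
Qed.

Lemma dist_sum V (I : Type) (s : seq I) (c : I -> R[i]) (F : I -> R -> R[i]) :
  subspaceLp V -> (forall i, Lp (F i)) ->
  dist V (fun t => \sum_(i <- s) c i * F i t) <= \sum_(i <- s) Normc.normc (c i) * dist V (F i).
Proof.
move=> hV hF; elim: s => [|i s IH].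
  under eq_fun do rewrite big_nil; rewrite big_nil dist0//; by case: hV.
under eq_fun do rewrite big_cons; rewrite big_cons.
apply: le_trans (distD hV _ _) _; first exact: cLpZ.
  by apply: cLp_sum => j; exact: cLpZ.
by rewrite lerD// distZ.
Qed.

Lemma dist_dist V f g : subspaceLp V -> Lp f -> Lp g ->
  `|dist V f - dist V g| <= rnorm (fun t => f t - g t).
Proof.
have h f' g' : subspaceLp V -> Lp f' -> Lp g' -> dist V f' <= rnorm (fun t => f' t - g' t) + dist V g'.
  move=> hV hf hg; have V0 : V (fun=> 0) by case: hV.
  have -> : dist V f' = dist V (fun t => (f' t - g' t) + g' t).
    by congr dist; apply/funext => t; rewrite subrK.
  by apply: le_trans (distD hV _ hg) _; rewrite ?lerD2r ?dist_le_norm//; exact: cLpB.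
move=> hV hf hg; rewrite ler_norml; apply/andP; split; last by rewrite lerBlDr; exact: h.
rewrite lerNl opprB lerBlDr; have := h _ _ hV hg hf.
rewrite (_ : rnorm _ = rnorm (fun t => f t - g t))//.
have -> : (fun t => g t - f t) = (fun t => (-1) * (f t - g t)) by apply/funext => t; ring.
by rewrite rnormZ ?normcN ?Normc.normc1 ?mul1r//; exact: cLpB.
Qed.

Lemma gauss_integral (a x : R) : 0 < a ->
  (\int[mu]_t (expR (- (a * (t - x) ^+ 2)))%:E = (Num.sqrt (pi / a))%:E)%E.
Proof.
move=> a0; pose s : R := (Num.sqrt (2 * a))^-1.
have s0 : s != 0 by rewrite invr_eq0 sqrtr_eq0 -ltNge mulr_gt0.
have s2 : s ^+ 2 *+ 2 = a^-1.
  by rewrite exprVn sqr_sqrtr ?mulr_ge0 ?ltW// -[_ *+ 2]mulr_natl; field; rewrite gt_eqF.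
have pk : 0 < normal_peak s by exact: normal_peak_gt0.
have -> : Num.sqrt (pi / a) = (normal_peak s)^-1.
  by rewrite /normal_peak invrK -s2 -mulrnAl -[_ *+ 2]mulr_natr; congr Num.sqrt; ring.
have := integral_normal_pdf x s; rewrite normal_pdfE//.
under eq_integral do rewrite EFinM /normal_fun s2 invrK.
rewrite ge0_integralZl_EFin ?(ltW pk)//.
- move=> h.
  have -> : (\int[mu]_t (expR (- (a * (t - x) ^+ 2)))%:E = (normal_peak s)^-1%:E * ((normal_peak s)%:E * \int[mu]_t (expR (- (t - x) ^+ 2 * a))%:E))%E.
    rewrite muleA -EFinM mulVf ?gt_eqF// mul1e; apply: eq_integral => t _.
    by rewrite mulNr mulrC.
  by rewrite h mule1.
- apply/measurable_EFinP; apply: continuous_measurable_fun => t.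
  apply/differentiable_continuous/derivable1_diffP; exact: ex_derive.
Qed.

Lemma measurable_gauss (a x : R) : measurable_fun [set: R] (fun t => expR (- (a * (t - x) ^+ 2))).
Proof.
apply: continuous_measurable_fun => t.
apply/differentiable_continuous/derivable1_diffP; exact: ex_derive.
Qed.

Lemma gauss_norm (a : R) : 0 < a -> exists2 A : R, 0 <= A & forall K x f, 0 <= K -> cmeasurable_fun f ->
  (forall t, Normc.normc (f t) <= K * expR (- (a * (t - x) ^+ 2))) -> Lp f /\ rnorm f <= K * A.
Proof.
move=> a0; pose c := Num.sqrt (pi / (p * a)); have c0 : 0 <= c by exact: sqrtr_ge0.
have hc x := gauss_integral x (mulr_gt0 p0 a0).
exists (c `^ p^-1); first exact: powR_ge0.
move=> K x f K0 mf hf.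
have mh : measurable_fun [set: R] (fun t => K * expR (- (a * (t - x) ^+ 2))).
  by apply: measurable_funM => //; exact: measurable_gauss.
have := le_cLnorm p1 mf mh hf.
have -> : (\int[mu]_t ((K * expR (- (a * (t - x) ^+ 2))) `^ p)%:E =
           \int[mu]_t ((K `^ p)%:E * (expR (- (p * a * (t - x) ^+ 2)))%:E))%E.
  apply: eq_integral => t _; rewrite powRM ?expR_ge0// -expRM -EFinM.
  by congr (_ * expR _)%:E; ring.
rewrite ge0_integralZl_EFin ?powR_ge0// ?hc; last first.
  by apply/measurable_EFinP; exact: measurable_gauss.
rewrite -EFinM poweR_EFin powRM ?powR_ge0// -powRrM mulfV ?gt_eqF// powRr1// => h.
have Lf : Lp f by split => //; apply: le_lt_trans h _; rewrite ltry.
by split => //; rewrite -lee_fin rnormK.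
Qed.

(** Completing the square, uniformly in the centre [x]. *)
Lemma gauss_absorb (B c : R) : 0 <= B -> 0 <= c -> exists2 K : R, 0 <= K & forall t x, `|x| <= B ->
  expR (- (pi * (t - x) ^+ 2) + c * `|t|) <= K * expR (- (1 * (t - 0) ^+ 2)).
Proof.
move=> B0 c0; pose c' := 2 * pi * B + c.
exists (expR (c' ^+ 2)); first exact: expR_ge0.
move=> t x xB; rewrite -expRD ler_expR mul1r subr0.
have p2 := @pi_ge2 R.
have t2 : t ^+ 2 = `|t| ^+ 2 by rewrite real_normK ?num_real.
have h1 : t * x <= `|t| * B by apply: le_trans (ler_norm _) _; rewrite normrM ler_wpM2l.
have h2 : 2 * pi * (t * x) <= 2 * pi * (`|t| * B) by rewrite ler_wpM2l// mulr_ge0//; lra.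
have h3 : 0 <= pi * x ^+ 2 by rewrite mulr_ge0 ?sqr_ge0//; lra.
have h4 : c' * `|t| <= t ^+ 2 + c' ^+ 2 by rewrite t2; have := sqr_ge0 (`|t| - c' / 2); nra.
have h5 : 0 <= (pi - 2) * t ^+ 2 by rewrite mulr_ge0 ?sqr_ge0//; lra.
move: h4; rewrite {1}/c'; nra.
Qed.

End LpDistance.

(** * Translates of the Gaussian by complex numbers *)

Section ComplexGaussian.
Context {R : realType}.
Implicit Types (z w : R[i]).

Lemma cmeasurable_cexp_poly (a b c : R[i]) :
  cmeasurable_fun (fun t : R => cexp (a * t%:C%C ^+ 2 + b * t%:C%C + c)).
Proof.
have hre t : complex.Re (a * t%:C%C ^+ 2 + b * t%:C%C + c) = complex.Re a * t ^+ 2 + complex.Re b * t + complex.Re c.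
  by rewrite expr2 !ReD !ReM /= ?ImM /=; ring.
have him t : complex.Im (a * t%:C%C ^+ 2 + b * t%:C%C + c) = complex.Im a * t ^+ 2 + complex.Im b * t + complex.Im c.
  by rewrite expr2 !ImD !ImM /= ?ReM /=; ring.
split => /=.
  under eq_fun do rewrite /= hre him.
  apply: continuous_measurable_fun => t.
  apply/differentiable_continuous/derivable1_diffP; exact: ex_derive.
under eq_fun do rewrite /= hre him.
apply: continuous_measurable_fun => t.
apply/differentiable_continuous/derivable1_diffP; exact: ex_derive.
Qed.

(** The Gaussian translate [phi (t - z)] continued to complex [z]. *)
Definition cgauss z (t : R) : R[i] := cexp (- (pi%:C%C * (t%:C%C - z) ^+ 2)).

Lemma cgauss_real (x t : R) : cgauss x%:C%C t = gaussian (t - x).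
Proof. by rewrite /cgauss /gaussian -rmorphB -rmorphXn -rmorphM -rmorphN cexp_real. Qed.

Lemma cmeasurable_cgauss z : cmeasurable_fun (cgauss z).
Proof.
rewrite (_ : cgauss z = fun t => cexp ((- pi%:C%C) * t%:C%C ^+ 2 + (2 * pi%:C%C * z) * t%:C%C + (- (pi%:C%C * z ^+ 2)))).
  exact: cmeasurable_cexp_poly.
by apply/funext => t; rewrite /cgauss; congr cexp; ring.
Qed.

Lemma normc_cgauss z t :
  Normc.normc (cgauss z t) = expR (pi * complex.Im z ^+ 2) * expR (- (pi * (t - complex.Re z) ^+ 2)).
Proof.
rewrite normc_cexp -expRD; congr expR; rewrite ReN ReM /= mul0r subr0 expr2 ReM !ReD !ImD !ReN !ImN /=; ring.
Qed.

Lemma normc_natr n : Normc.normc (n%:R : R[i]) = n%:R.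
Proof. by rewrite -(rmorph_nat (real_complex R)) normc_real normr_nat. Qed.

Lemma powx_le_expR (n : nat) (x : R) : 0 <= x -> x ^+ n <= n`!%:R * expR x.
Proof.
case: n => [|n] x0; first by rewrite expr0 fact0 mul1r -expR0 ler_expR.
have := expR_ge1Dxn n x0; move=> h.
have {}h : x ^+ n.+1 / (n.+1)`!%:R <= expR x by apply: le_trans h; rewrite lerDr.
by rewrite mulrC -ler_pdivrMr ?ltr0n ?fact_gt0.
Qed.

Lemma cgaussB z w t : cgauss z t - cgauss w t =
  cgauss w t * (cexp (pi%:C%C * (z - w) * (2 * t%:C%C - z - w)) - 1).
Proof. by rewrite mulrBr mulr1 /cgauss -cexpD; congr (cexp _ - _); ring. Qed.

Lemma cgauss_lipschitz (B : R) : 0 <= B -> exists2 K : R, 0 <= K & forall z w t,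
  Normc.normc z <= B -> Normc.normc w <= B ->
  Normc.normc (cgauss z t - cgauss w t) <= K * Normc.normc (z - w) * expR (- (1 * (t - 0) ^+ 2)).
Proof.
move=> B0; have pp := @pi_gt0 R.
pose c : R := 2 + 2 * B * pi * 2.
have c0 : 0 <= c by rewrite /c addr_ge0// !mulr_ge0// ltW.
have [K K0 hK] := gauss_absorb B0 c0.
pose L := expR (pi * B ^+ 2) * (2 * pi) * (expR (2 * B) * expR (2 * B * pi * 2 * B)).
have L0 : 0 <= L by rewrite !mulr_ge0 ?expR_ge0// ltW.
exists (L * K); first exact: mulr_ge0.
move=> z w t zB wB; rewrite cgaussB Normc.normcM normc_cgauss.
set u := _ * _ * _; set D := Normc.normc (z - w); set s := `|t|.
have D0 : 0 <= D by exact: normc_ge0.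
have s0 : 0 <= s by exact: normr_ge0.
have DB : D <= 2 * B by apply: le_trans (le_normcB _ _) _; lra.
have hu : Normc.normc u <= pi * D * (2 * s + 2 * B).
  rewrite /u !Normc.normcM normc_real (gtr0_norm pp) -/D; apply: ler_pM; rewrite ?normc_ge0//.
    by rewrite mulr_ge0// ltW.
  apply: le_trans (le_normcB _ _) _; apply: le_trans (lerD (le_normcB _ _) (lexx _)) _.
  by rewrite Normc.normcM normc_natr normc_real -/s; lra.
have hu2 : Normc.normc u <= 2 * B * pi * (2 * s + 2 * B).
  apply: le_trans hu _; rewrite ler_wpM2r ?addr_ge0 ?mulr_ge0// mulrC ler_wpM2r//; exact: ltW.
have h2 : 2 * s + 2 * B <= expR (2 * s) * expR (2 * B).
  by rewrite -expRD; apply: le_trans (expR_ge1Dx _); lra.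
have h1 : Normc.normc (cexp u - 1) <= 2 * (pi * D * (expR (2 * s) * expR (2 * B)) * expR (2 * B * pi * (2 * s + 2 * B))).
  apply: le_trans (cexp_taylor1 _) _; rewrite ler_pM2l// ler_pM ?normc_ge0 ?expR_ge0 ?ler_expR//.
  apply: le_trans hu _; rewrite ler_wpM2l// mulr_ge0// ltW//.
have h3 : expR (pi * complex.Im w ^+ 2) <= expR (pi * B ^+ 2).
  rewrite ler_expR ler_pM2l// -(real_normK (num_real (complex.Im w))) lerXn2r ?nnegrE//.
  by apply: le_trans (normr_Im_le _) _.
have h4 := hK t (complex.Re w) (le_trans (normr_Re_le _) wB).
apply: le_trans (ler_pM _ _ (ler_wpM2r (expR_ge0 _) h3) h1) _; rewrite ?mulr_ge0 ?expR_ge0 ?normc_ge0//.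
have -> : expR (pi * B ^+ 2) * expR (- (pi * (t - complex.Re w) ^+ 2)) *
  (2 * (pi * D * (expR (2 * s) * expR (2 * B)) * expR (2 * B * pi * (2 * s + 2 * B)))) =
  L * D * expR (- (pi * (t - complex.Re w) ^+ 2) + c * s).
  have -> : - (pi * (t - complex.Re w) ^+ 2) + c * s = - (pi * (t - complex.Re w) ^+ 2) + (2 * s) + (2 * B * pi * 2 * s) by rewrite /c; ring.
  have -> : 2 * B * pi * (2 * s + 2 * B) = 2 * B * pi * 2 * s + 2 * B * pi * 2 * B by ring.
  by rewrite !expRD /L; ring.
have -> : L * K * D * expR (- (1 * (t - 0) ^+ 2)) = L * D * (K * expR (- (1 * (t - 0) ^+ 2))) by ring.
by rewrite ler_wpM2l// mulr_ge0.
Qed.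

Lemma cexp_quad_taylor (b1 b2 k : R[i]) : Normc.normc k <= 1 ->
  Normc.normc (cexp (b1 * k + b2 * k ^+ 2) - (1 + b1 * k + (b2 + b1 ^+ 2 / 2) * k ^+ 2)) <=
  Normc.normc k ^+ 3 * (16 * expR (2 * (Normc.normc b1 + Normc.normc b2))).
Proof.
move=> k1; set m1 := Normc.normc b1; set m2 := Normc.normc b2; set r := Normc.normc k in k1 *.
have m10 : 0 <= m1 by exact: normc_ge0.
have m20 : 0 <= m2 by exact: normc_ge0.
have r0 : 0 <= r by exact: normc_ge0.
pose u := b1 * k + b2 * k ^+ 2; pose M := m1 + m2.
have M0 : 0 <= M by exact: addr_ge0.
have r2 : r ^+ 2 <= r by rewrite expr2 ler_piMr.
have uM : Normc.normc u <= M * r.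
  apply: le_trans (le_normcD _ _) _; rewrite !(normcX, Normc.normcM) -/m1 -/m2 -/r [leRHS]mulrDl lerD2l.
  by rewrite ler_wpM2l.
have uM1 : Normc.normc u <= M by apply: le_trans uM _; rewrite ler_piMr.
have -> : cexp u - (1 + b1 * k + (b2 + b1 ^+ 2 / 2) * k ^+ 2) =
  (cexp u - 1 - u - u ^+ 2 / 2) + k ^+ 3 * (b1 * b2 + b2 ^+ 2 / 2 * k) by rewrite /u; field.
have h1 : Normc.normc (cexp u - 1 - u - u ^+ 2 / 2) <= r ^+ 3 * (2 * (M ^+ 3 * expR M)).
  apply: le_trans (cexp_taylor3 _) _.
  have -> : r ^+ 3 * (2 * (M ^+ 3 * expR M)) = 2 * ((M * r) ^+ 3 * expR M) by ring.
  by rewrite ler_pM2l// ler_pM ?exprn_ge0 ?normc_ge0 ?expR_ge0 ?ler_expR// lerXn2r ?nnegrE ?normc_ge0 ?mulr_ge0.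
have h2 : Normc.normc (k ^+ 3 * (b1 * b2 + b2 ^+ 2 / 2 * k)) <= r ^+ 3 * (2 * M ^+ 2).
  rewrite Normc.normcM normcX -/r ler_wpM2l ?exprn_ge0//.
  apply: le_trans (le_normcD _ _) _; rewrite !(normcX, Normc.normcM, Normc.normcV) normc_natr -/m1 -/m2 -/r.
  have : m2 ^+ 2 / 2 * r <= m2 ^+ 2 / 2 by rewrite ler_piMr// divr_ge0// sqr_ge0.
  have := mulr_ge0 m10 m20; have := sqr_ge0 m1; have := sqr_ge0 m2; rewrite /M; nra.
apply: le_trans (le_normcD _ _) _; apply: le_trans (lerD h1 h2) _.
rewrite -mulrDr ler_wpM2l ?exprn_ge0//.
have e1 : M ^+ 3 <= 6 * expR M by have := powx_le_expR 3 M0.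
have e2 : M ^+ 2 <= 2 * expR M by have := powx_le_expR 2 M0.
have -> : expR (2 * M) = expR M * expR M by rewrite -expRD mulr2n mulrDl mul1r.
have e3 : 1 <= expR M by rewrite -expR0 ler_expR.
have := ler_wpM2r (expR_ge0 M) e1; nra.
Qed.

Lemma sum_i_powers (r : R) : \sum_(k < 4) ('i%C ^+ k * r%:C%C : R[i]) = 0 /\
  \sum_(k < 4) ('i%C ^+ k * r%:C%C : R[i]) ^+ 2 = 0.
Proof.
have i2 : ('i%C : R[i]) ^+ 2 = -1 by exact: sqr_i.
rewrite !big_ord_recl !big_ord0 /= /bump /= !addn0 !add1n.
have i3 : ('i%C : R[i]) ^+ 3 = - 'i%C by rewrite exprS i2 mulrN1.
rewrite i3 i2 !expr0 !expr1; split; first ring.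
by rewrite !exprMn !sqrrN expr1n i2; ring.
Qed.

End ComplexGaussian.

Section GaussianDistance.
Context {R : realType}.
Variables (p : R) (p1 : 1 <= p) (V : set (R -> R[i])).
Hypothesis hV : subspaceLp p V.
Implicit Types (z w : R[i]).
Notation Lp := (@cLp R p%:E).

Let V0 : V (fun=> 0). Proof. by case: hV. Qed.

Lemma cgauss_norm : exists2 C : R, 0 <= C &
  forall z, Lp (cgauss z) /\ rnorm p (cgauss z) <= C * expR (pi * complex.Im z ^+ 2).
Proof.
have [A A0 hA] := gauss_norm p1 (@pi_gt0 R).
exists A => // z; have [|||h1 h2] := hA (expR (pi * complex.Im z ^+ 2)) (complex.Re z) (cgauss z).
- exact: expR_ge0.
- exact: cmeasurable_cgauss.
- by move=> t; rewrite normc_cgauss.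
- by split => //; rewrite mulrC.
Qed.

Lemma cLp_cgauss z : Lp (cgauss z).
Proof. by have [C _ h] := cgauss_norm; case: (h z). Qed.

Lemma dist_cgauss_growth : exists C : R, forall z, dist p V (cgauss z) <= C * expR (pi * complex.Im z ^+ 2).
Proof.
have [C _ h] := cgauss_norm; exists C => z; case: (h z) => _; apply: le_trans.
exact: dist_le_norm.
Qed.

Lemma dist_cgauss_lipschitz : locally_lipschitz (fun z => dist p V (cgauss z)).
Proof.
move=> B; have [A A0 hA] := gauss_norm p1 (@ltr01 R).
have [B0|B0] := leP 0 B; last first.
  by exists 0 => z w zB; have := le_lt_trans zB B0; rewrite ltNge normc_ge0.
have [K K0 hK] := cgauss_lipschitz B0.
exists (K * A) => z w zB wB.
apply: le_trans (dist_dist p1 hV (cLp_cgauss z) (cLp_cgauss w)) _.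
have [|||_ h2] := hA (K * Normc.normc (z - w)) 0 (fun t => cgauss z t - cgauss w t).
- by rewrite mulr_ge0// normc_ge0.
- by apply: cmeasurableB; exact: cmeasurable_cgauss.
- by move=> t; exact: hK.
- by rewrite mulrAC.
Qed.

(** For fixed [t] the product of [exp (a1 h + a2 h^2)] and [cgauss (z + h) t] is
    holomorphic in [h], so its average over the four points [h = i^k r] is its value
    at [h = 0] up to [O (r^3)], in [L^p] norm; the distance is a seminorm. *)
Lemma dist_cgauss_submean : submean (fun z => dist p V (cgauss z)).
Proof.
move=> z a1 a2; have pp := @pi_gt0 R.
have [A A0 hA] := gauss_norm p1 (@ltr01 R).
pose c0 : R := Normc.normc a1 + 2 * pi * Normc.normc z + (Normc.normc a2 + pi).
have [K K0 hK] := gauss_absorb (normc_ge0 z) (mulr_ge0 (ler0n R 4) (ltW pp)).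
pose L := expR (pi * complex.Im z ^+ 2) * (16 * expR (2 * c0)).
have L0 : 0 <= L by rewrite !mulr_ge0 ?expR_ge0.
exists (L * K * A), 1; split => // r /andP[r0 r1].
pose h (k : 'I_4) : R[i] := 'i%C ^+ k * r%:C%C.
have nh k : Normc.normc (h k) = r.
  by rewrite /h Normc.normcM normcX normc_i expr1n mul1r normc_real gtr0_norm.
pose w (k : 'I_4) := cexp (a1 * h k + a2 * h k ^+ 2).
pose b1 (t : R) : R[i] := a1 + 2 * pi%:C%C * (t%:C%C - z).
pose b2 : R[i] := a2 - pi%:C%C.
pose T (k : 'I_4) t := cexp (b1 t * h k + b2 * h k ^+ 2) - (1 + b1 t * h k + (b2 + b1 t ^+ 2 / 2) * h k ^+ 2).
have wE k t : w k * cgauss (z + h k) t = cgauss z t * cexp (b1 t * h k + b2 * h k ^+ 2).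
  by rewrite /w /cgauss -!cexpD; congr cexp; rewrite /b1 /b2; ring.
pose rem t := - (4^-1 * \sum_(k < 4) (cgauss z t * T k t)).
have Ez t : cgauss z t = \sum_(k < 4) (4^-1 * w k) * cgauss (z + h k) t + rem t.
  have -> : \sum_(k < 4) (4^-1 * w k) * cgauss (z + h k) t = 4^-1 * \sum_(k < 4) (cgauss z t * (1 + b1 t * h k + (b2 + b1 t ^+ 2 / 2) * h k ^+ 2) + cgauss z t * T k t).
    rewrite mulr_sumr; apply: eq_bigr => k _; rewrite -mulrA wE /T; ring.
  rewrite big_split mulrDr /rem addrK -mulr_sumr !big_split /= -!mulr_sumr.
  have [s1 s2] := sum_i_powers r; rewrite /h s1 s2 !mulr0 !addr0 sumr_const card_ord.
  by rewrite -[1 *+ 4]/(4%:R); field.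
have mw k : Lp (cgauss (z + h k)) by exact: cLp_cgauss.
have Lsum : Lp (fun t => \sum_(k < 4) (4^-1 * w k) * cgauss (z + h k) t).
  by apply: (cLp_sum p1) => k; exact: (cLpZ p1).
have mrem : cmeasurable_fun rem.
  have -> : rem = fun t => cgauss z t - \sum_(k < 4) (4^-1 * w k) * cgauss (z + h k) t.
    by apply/funext => t; rewrite {1}Ez addrAC subrr add0r.
  apply: cmeasurableB; first exact: cmeasurable_cgauss.
  by case: Lsum.
have hrem t : Normc.normc (rem t) <= (L * K * r ^+ 3) * expR (- (1 * (t - 0) ^+ 2)).
  have hT k : Normc.normc (cgauss z t * T k t) <= r ^+ 3 * (L * K) * expR (- (1 * (t - 0) ^+ 2)).
    rewrite Normc.normcM normc_cgauss.
    have := @cexp_quad_taylor R (b1 t) b2 (h k); rewrite nh => /(_ r1) hT.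
    have hb : 2 * (Normc.normc (b1 t) + Normc.normc b2) <= 2 * c0 + 4 * pi * `|t|.
      have e1 : Normc.normc (b1 t) <= Normc.normc a1 + 2 * pi * (`|t| + Normc.normc z).
        apply: le_trans (le_normcD _ _) _; rewrite lerD2l !Normc.normcM normc_natr normc_real gtr0_norm//.
        by rewrite ler_pM2l ?mulr_gt0// (le_trans (le_normcB _ _))// normc_real.
      have e2 : Normc.normc b2 <= Normc.normc a2 + pi.
        by apply: le_trans (le_normcB _ _) _; rewrite normc_real gtr0_norm.
      by move: e1 e2; rewrite /c0; lra.
    have {}hT : Normc.normc (T k t) <= r ^+ 3 * (16 * (expR (2 * c0) * expR (4 * pi * `|t|))).
      by apply: le_trans hT _; rewrite ler_wpM2l ?exprn_ge0 ?(ltW r0)// ler_pM2l// -expRD ler_expR.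
    apply: le_trans (ler_wpM2l _ hT) _; first by rewrite mulr_ge0 ?expR_ge0.
    have := hK t (complex.Re z) (normr_Re_le z); rewrite expRD => hK'.
    have -> : expR (pi * complex.Im z ^+ 2) * expR (- (pi * (t - complex.Re z) ^+ 2)) *
       (r ^+ 3 * (16 * (expR (2 * c0) * expR (4 * pi * `|t|)))) =
       r ^+ 3 * L * (expR (- (pi * (t - complex.Re z) ^+ 2)) * expR (4 * pi * `|t|)) by rewrite /L; ring.
    have -> : r ^+ 3 * (L * K) * expR (- (1 * (t - 0) ^+ 2)) = r ^+ 3 * L * (K * expR (- (1 * (t - 0) ^+ 2))) by ring.
    by rewrite ler_wpM2l// mulr_ge0 ?exprn_ge0// ltW.
  rewrite /rem normcN Normc.normcM Normc.normcV normc_natr mulrC ler_pdivrMr//.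
  apply: le_trans (normc_sum _ _ _) _.
  apply: le_trans (ler_sum _ (fun k _ => hT k)) _.
  rewrite sumr_const card_ord -[_ *+ 4]mulr_natl; apply: le_of_eq; ring.
have [|||Lrem nrem] := hA (L * K * r ^+ 3) 0 rem.
- by rewrite mulr_ge0 ?exprn_ge0 ?mulr_ge0// ltW.
- exact: mrem.
- exact: hrem.
have -> : dist p V (cgauss z) = dist p V (fun t => \sum_(k < 4) (4^-1 * w k) * cgauss (z + h k) t + rem t).
  by congr dist; apply/funext => t; exact: Ez.
apply: le_trans (distD p1 hV Lsum Lrem) _; apply: lerD.
  apply: le_trans (dist_sum p1 _ _ hV mw) _; rewrite mulr_sumr; apply: ler_sum => k _.
  by rewrite Normc.normcM Normc.normcV normc_natr normc_cexp -mulrA.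
apply: le_trans (@dist_le_norm R p V rem V0) _; apply: le_trans nrem _.
by rewrite mulrAC.
Qed.

End GaussianDistance.

(** * Density of the complex translates *)

Section Multipliers.
Import HBNNSimple.
Context {R : realType}.
Variables (p : R) (p1 : 1 <= p) (V : set (R -> R[i])).
Hypothesis hV : subspaceLp p V.
Hypothesis Vgauss : forall z : R[i], dist p V (cgauss z) = 0.
Notation mu := (@lebesgue_measure R).
Notation Lp := (@cLp R p%:E).
Implicit Types (f : R -> R[i]) (g : R -> R).

Let V0 : V (fun=> 0). Proof. by case: hV. Qed.
Let p0 : 0 < p. Proof. exact: lt_le_trans p1. Qed.

Definition cis (s t : R) : R[i] := cexp ('i%C * (s * t)%:C%C).

Lemma cisE s t : cis s t = (cos (s * t) +i* sin (s * t))%C.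
Proof.
by rewrite /cis /cexp /= !mul0r !mul1r subr0 add0r expR0 !mul1r.
Qed.

Lemma cisD s s' t : cis (s + s') t = cis s t * cis s' t.
Proof. by rewrite /cis -cexpD -mulrDr -rmorphD -mulrDl. Qed.

Lemma cis0 t : cis 0 t = 1.
Proof. by rewrite /cis mul0r mulr0 cexp0. Qed.

Lemma normc_cis s t : Normc.normc (cis s t) = 1.
Proof. by rewrite normc_cexp ReM /= mul0r mul1r subrr expR0. Qed.

Lemma cmeasurable_cis s : cmeasurable_fun (cis s).
Proof.
rewrite (_ : cis s = fun t => cexp (0 * t%:C%C ^+ 2 + ('i%C * s%:C%C) * t%:C%C + 0)).
  exact: cmeasurable_cexp_poly.
by apply/funext => t; rewrite /cis mul0r add0r addr0 rmorphM mulrA.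
Qed.

Lemma cLp_normc f h : cmeasurable_fun h -> (forall t, Normc.normc (h t) <= Normc.normc (f t)) ->
  Lp f -> Lp h.
Proof.
move=> mh hf [mf nf]; split => //.
apply: le_lt_trans (le_cLnorm p1 mh (cmeasurable_normc mf) hf) _.
by rewrite -cLnormE.
Qed.

Lemma cLp_int f : Lp f -> (\int[mu]_t (Normc.normc (f t) `^ p)%:E < +oo)%E.
Proof.
move=> [_ nf]; rewrite ltNge; apply/negP => h.
move: nf; rewrite cLnormE; move: h; rewrite leye_eq => /eqP ->.
by rewrite /poweR invr_eq0 gt_eqF// ltxx.
Qed.

Lemma rnorm_normc f h : cmeasurable_fun h -> Lp f ->
  (forall t, Normc.normc (h t) <= Normc.normc (f t)) -> rnorm p h <= rnorm p f.
Proof.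
move=> mh Lf hf; have Lh := cLp_normc mh hf Lf; case: (Lf) => mf _.
rewrite -lee_fin !rnormK//.
apply: le_trans (le_cLnorm p1 mh (cmeasurable_normc mf) hf) _.
by rewrite -cLnormE.
Qed.

(** Asking for all modulates at once makes the class stable under
    multiplication by characters. *)
Definition modclosure f := Lp f /\ forall s, dist p V (fun t => cis s t * f t) = 0.

Lemma cis_Lp s f : Lp f -> Lp (fun t => cis s t * f t).
Proof.
move=> Lf; apply: (cLp_normc _ _ Lf); first by apply: cmeasurableM (cmeasurable_cis s) _; case: Lf.
by move=> t; rewrite Normc.normcM normc_cis mul1r.
Qed.

Lemma dist_eq0 f : dist p V f <= 0 -> dist p V f = 0.
Proof. by move=> h; apply/eqP; rewrite eq_le h dist_ge0. Qed.

Lemma modclosureD f h : modclosure f -> modclosure h -> modclosure (fun t => f t + h t).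
Proof.
move=> [Lf cf] [Lh ch]; split; first exact: cLpD.
move=> s; apply: dist_eq0; under eq_fun do rewrite mulrDr.
by apply: le_trans (distD p1 hV (cis_Lp s Lf) (cis_Lp s Lh)) _; rewrite cf ch addr0.
Qed.

Lemma modclosureZ c f : modclosure f -> modclosure (fun t => c * f t).
Proof.
move=> [Lf cf]; split; first exact: cLpZ.
move=> s; apply: dist_eq0; under eq_fun do rewrite mulrCA.
by apply: le_trans (distZ p1 c hV (cis_Lp s Lf)) _; rewrite cf mulr0.
Qed.

Lemma modclosure_cis s f : modclosure f -> modclosure (fun t => cis s t * f t).
Proof.
move=> [Lf cf]; split; first exact: cis_Lp.
by move=> s'; under eq_fun do rewrite mulrA -cisD; exact: cf.
Qed.

Lemma modclosure_lim f : Lp f ->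
  (forall e, 0 < e -> exists2 h, modclosure h & (cLnorm p%:E (fun t => h t - f t)%R < e%:E)%E) ->
  modclosure f.
Proof.
move=> Lf hlim; split => // s; apply: dist_eq0; apply/ler_addgt0Pr => e e0; rewrite add0r.
have [h [Lh ch] hh] := hlim e e0.
have := dist_dist p1 hV (cis_Lp s Lh) (cis_Lp s Lf); rewrite ch sub0r normrN.
move=> /(le_trans (ler_norm _))/le_trans; apply.
have Ld : Lp (fun t => h t - f t) by exact: cLpB.
apply: (@le_trans _ _ (rnorm p (fun t => h t - f t))).
  apply: rnorm_normc => //.
    apply: cmeasurableB; apply: cmeasurableM; try exact: cmeasurable_cis; by [case: Lh|case: Lf].
  by move=> t; rewrite -mulrBr Normc.normcM normc_cis mul1r.
by rewrite -lee_fin rnormK// ltW.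
Qed.

(** A modulation moves the centre of a Gaussian in the imaginary direction. *)
Lemma modclosure_cgauss z : modclosure (cgauss z).
Proof.
split => [|s]; first exact: cLp_cgauss.
pose w : R[i] := 'i%C * (s / (2 * pi))%:C%C.
have p2 : pi != 0 :> R by rewrite gt_eqF// pi_gt0.
apply: dist_eq0.
have -> : (fun t => cis s t * cgauss z t) =
   (fun t => cexp (pi%:C%C * (w * (2 * z + w))) * cgauss (z + w) t).
  apply/funext => t; rewrite /cis /cgauss -!cexpD; congr cexp.
  have -> : (s * t)%:C%C = (2 * pi%:C%C) * (s / (2 * pi))%:C%C * t%:C%C :> R[i].
    rewrite -[2](rmorph_nat (real_complex R)) -!rmorphM; congr (_%:C%C).
    by rewrite mulrCA mulfV ?mulr1// mulf_neq0.
  by rewrite /w; ring.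
by apply: le_trans (distZ p1 _ hV (cLp_cgauss p1 _)) _; rewrite Vgauss mulr0.
Qed.

Definition multiplier g := [/\ measurable_fun [set: R] g, exists B, forall t, `|g t| <= B &
  forall f, modclosure f -> modclosure (fun t => (g t)%:C%C * f t)].

Lemma multiplier_cst c : multiplier (fun=> c).
Proof. by split; [exact: measurable_cst|exists `|c| |move=> f; exact: modclosureZ]. Qed.

Lemma multiplierD g h : multiplier g -> multiplier h -> multiplier (fun t => g t + h t).
Proof.
move=> [mg [B Bg] cg] [mh [B' Bh] ch]; split; first exact: measurable_funD.
  by exists (B + B') => t; apply: le_trans (ler_normD _ _) _; exact: lerD.
move=> f cf; under eq_fun do rewrite rmorphD mulrDl.
by apply: modclosureD; [exact: cg|exact: ch].
Qed.

Lemma multiplierM g h : multiplier g -> multiplier h -> multiplier (fun t => g t * h t).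
Proof.
move=> [mg [B Bg] cg] [mh [B' Bh] ch]; split; first exact: measurable_funM.
  by exists (B * B') => t; rewrite normrM; exact: ler_pM.
by move=> f cf; under eq_fun do rewrite rmorphM -mulrA; apply/cg/ch.
Qed.

Lemma multiplierZ c g : multiplier g -> multiplier (fun t => c * g t).
Proof. by move=> mg; apply: multiplierM mg; exact: multiplier_cst. Qed.

Lemma multiplierX g n : multiplier g -> multiplier (fun t => g t ^+ n).
Proof.
move=> mg; elim: n => [|n IH]; first by under eq_fun do rewrite expr0; exact: multiplier_cst.
by under eq_fun do rewrite exprS; exact: multiplierM.
Qed.

Lemma multiplier_sum (I : Type) (r : seq I) (g : I -> R -> R) : (forall i, multiplier (g i)) ->
  multiplier (fun t => \sum_(i <- r) g i t).
Proof.
move=> hg; elim: r => [|i r IH].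
  by under eq_fun do rewrite big_nil; exact: multiplier_cst.
by under eq_fun do rewrite big_cons; exact: multiplierD.
Qed.

Lemma measurable_sin_lin s : measurable_fun [set: R] (fun t : R => sin (s * t)).
Proof.
apply: continuous_measurable_fun => t; apply/differentiable_continuous/derivable1_diffP; exact: ex_derive.
Qed.

Lemma measurable_cos_lin s : measurable_fun [set: R] (fun t : R => cos (s * t)).
Proof.
apply: continuous_measurable_fun => t; apply/differentiable_continuous/derivable1_diffP; exact: ex_derive.
Qed.

Lemma multiplier_cos s : multiplier (fun t => cos (s * t)).
Proof.
split; first exact: measurable_cos_lin.
  by exists 1 => t; rewrite ler_norml cos_geN1 cos_le1.
move=> f cf.
have -> : (fun t => (cos (s * t))%:C%C * f t) = (fun t => 2^-1 * (cis s t * f t + cis (- s) t * f t)).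
  apply/funext => t; rewrite -mulrDl mulrA; congr (_ * _).
  apply: (@mulfI _ (2 : R[i])); first by rewrite pnatr_eq0.
  rewrite mulrA mulfV ?pnatr_eq0// mul1r !cisE mulNr cosN sinN.
  by rewrite mulr2n mulrDl mul1r; apply/eqP; rewrite eq_complex /= addr0 subrr !eqxx.
by apply: modclosureZ; apply: modclosureD; exact: modclosure_cis.
Qed.

Lemma multiplier_sin s : multiplier (fun t => sin (s * t)).
Proof.
split; first exact: measurable_sin_lin.
  by exists 1 => t; rewrite ler_norml sin_geN1 sin_le1.
move=> f cf.
have -> : (fun t => (sin (s * t))%:C%C * f t) = (fun t => (2^-1 * 'i%C) * (cis (- s) t * f t + (-1) * (cis s t * f t))).
  apply/funext => t; rewrite mulN1r -mulrBl mulrA; congr (_ * _).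
  apply: (@mulfI _ (2 : R[i])); first by rewrite pnatr_eq0.
  rewrite !mulrA mulfV ?pnatr_eq0// mul1r !cisE mulNr cosN sinN.
  rewrite mulr2n mulrDl mul1r; apply/eqP; rewrite eq_complex /=.
  by apply/andP; split; apply/eqP; ring.
by apply: modclosureZ; apply: modclosureD; [|apply: modclosureZ]; exact: modclosure_cis.
Qed.

Lemma multiplier_lim (G : nat -> R -> R) g (B : R) : (forall n, multiplier (G n)) ->
  (forall n t, `|G n t| <= B) -> (forall t, G n t @[n --> \oo] --> g t) -> multiplier g.
Proof.
move=> mG GB Gg.
have gB t : `|g t| <= B.
  by apply: (cvgr_to_le (cvg_norm (Gg t))); exact: nearW.
have B0 : 0 <= B by exact: le_trans (normr_ge0 _) (gB 0).
have mg : measurable_fun [set: R] g.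
  apply: (measurable_fun_cvg (h := G)) => [n|t _]; first by case: (mG n).
  exact: Gg.
split => //; first by exists B.
move=> f cf; have [Lf _] := cf; have [mf nf] := Lf.
have mgf : cmeasurable_fun (fun t => (g t)%:C%C * f t).
  by apply: cmeasurableM => //; exact: cmeasurable_real.
have LB : Lp (fun t => B%:C%C * f t) by exact: cLpZ.
have dom t x : `|x| <= B -> Normc.normc (x%:C%C * f t) <= Normc.normc (B%:C%C * f t).
  by move=> xB; rewrite !Normc.normcM !normc_real (ger0_norm B0) ler_wpM2r ?normc_ge0.
apply: modclosure_lim; first by apply: (cLp_normc mgf _ LB) => t; exact: dom.
move=> e e0.
have [||||||n hn] := @cLnorm_dominated R p p1 (fun n t => (G n t)%:C%C * f t) _ (fun t => Normc.normc (B%:C%C * f t)) _ mgf _ _ _ _ _ e e0.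
- by move=> n; apply: cmeasurableM => //; apply: cmeasurable_real; case: (mG n).
- by apply: cmeasurable_normc; case: LB.
- exact: cLp_int.
- by move=> n t; exact: dom.
- by move=> t; exact: dom.
- move=> t; under eq_fun do rewrite -mulrBl -rmorphB Normc.normcM normc_real.
  rewrite -(mul0r (Normc.normc (f t))); apply: cvgM; last exact: cvg_cst.
  have := Gg t => /cvgrPdist_lt h; apply/cvgrPdist_lt => d d0.
  by have := h d d0; apply: filterS => n; rewrite sub0r normrN normr_id distrC.
by exists (fun t => (G n t)%:C%C * f t) => //; case: (mG n) => _ _; exact.
Qed.

Lemma multiplier_expR g : multiplier g -> multiplier (fun t => expR (g t)).
Proof.
move=> mg; have [_ [B gB] _] := mg.
apply: (@multiplier_lim (fun n t => series (exp_coeff (g t)) n) _ (expR B)).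
- move=> n; rewrite /series /=; apply: multiplier_sum => i.
  by under eq_fun do rewrite exp_coeffE; apply: multiplierZ; exact: multiplierX.
- move=> n t; apply: le_trans (ler_norm_sum _ _ _) _.
  have B0 : 0 <= B by exact: le_trans (normr_ge0 _) (gB 0).
  apply: (@le_trans _ _ (series (exp_coeff B) n)).
    apply: ler_sum => i _; rewrite !exp_coeffE normrM normrX ger0_norm ?invr_ge0//.
    by rewrite ler_wpM2l ?invr_ge0// lerXn2r ?nnegrE.
  apply: nondecreasing_cvgn_le; last exact: is_cvg_series_exp_coeff.
  by apply: nondecreasing_series => i _ _; exact: exp_coeff_ge0.
- by move=> t; exact: is_cvg_series_exp_coeff.
Qed.

Lemma sin_scaled_cvg (x : R) : m.+1%:R * sin (x / m.+1%:R) @[m --> \oo] --> x.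
Proof.
pose C : R := 2 * x ^+ 2 * expR `|x|.
have C0 : 0 <= C by rewrite mulr_ge0 ?expR_ge0// mulr_ge0 ?sqr_ge0.
have h m : `|x - m.+1%:R * sin (x / m.+1%:R)| <= C * m.+1%:R^-1.
  set y : R := x / m.+1%:R; have mp : 0 < m.+1%:R :> R by rewrite ltr0n.
  have -> : x = m.+1%:R * y by rewrite mulrC divfK// gt_eqF.
  rewrite -mulrBr normrM gtr0_norm// mulrC.
  have := cexp_taylor2 ('i%C * y%:C%C : R[i]); rewrite Normc.normcM normc_i normc_real mul1r => hy.
  have {}hy : `|y - sin y| <= 2 * (`|y| ^+ 2 * expR `|y|).
    apply: le_trans hy; rewrite distrC; apply: le_trans (normr_Im_le _).
    have -> : cexp ('i%C * y%:C%C) = (cos y +i* sin y)%C by have := cisE 1 y; rewrite /cis !mul1r.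
    by rewrite /= mul0r mul1r add0r oppr0 addr0.
  rewrite -ler_pdivlMr//; apply: le_trans hy _.
  rewrite real_normK ?num_real//.
  have -> : C * m.+1%:R^-1 / m.+1%:R = 2 * (y ^+ 2 * expR `|x|).
    by rewrite /C /y; field; rewrite ?gt_eqF.
  rewrite ler_pM2l// ler_wpM2l ?sqr_ge0// ler_expR /y normrM ler_piMr//.
  by rewrite ger0_norm ?invr_ge0// invf_le1// ler1n.
apply/cvgrPdist_le => e e0.
have : C * m.+1%:R^-1 @[m --> \oo] --> C * 0.
  by apply: cvgM; [exact: cvg_cst|exact: cvg_harmonic].
rewrite mulr0 => /cvgrPdist_le/(_ e e0); apply: filterS => m.
by rewrite sub0r normrN (ger0_norm (divr_ge0 C0 (ler0n _ _))); exact: le_trans (h m).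
Qed.

(** [T sin ((t - a) / T)] tends to [t - a] as [T] grows, and
    [exp (- exp (n - n^2 x))] tends to [1] for [x > 0] and to [0] for [x <= 0]; the
    outer exponential keeps everything bounded. *)
Lemma multiplier_ray a : multiplier (\1_`]a, +oo[).
Proof.
apply: (@multiplier_lim (fun n t => expR (- expR (n%:R - n%:R ^+ 2 * (t - a)))) _ 1).
- move=> n; apply: (@multiplier_lim (fun m t => expR (- expR (n%:R - n%:R ^+ 2 * (m.+1%:R * sin ((t - a) / m.+1%:R))))) _ 1).
  + move=> m; apply: multiplier_expR; under eq_fun do rewrite -mulN1r; apply: multiplierZ.
    apply: multiplier_expR; under eq_fun do rewrite -mulNr mulrA; apply: multiplierD; first exact: multiplier_cst.
    apply: multiplierZ; under eq_fun do rewrite mulrBl sinB mulrC [cos _ * _]mulrC [_ / m.+1%:R]mulrC.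
    under eq_fun do rewrite -mulNr ![_ / m.+1%:R]mulrC.
    by apply: multiplierD; apply: multiplierZ; [exact: multiplier_sin|exact: multiplier_cos].
  + by move=> m t; rewrite ger0_norm ?expR_ge0// -expR0 ler_expR oppr_le0 expR_ge0.
  + move=> t; pose X m : R := n%:R - n%:R ^+ 2 * (m.+1%:R * sin ((t - a) / m.+1%:R)).
    have h1 : X m @[m --> \oo] --> n%:R - n%:R ^+ 2 * (t - a).
      by apply: cvgB; [exact: cvg_cst|apply: cvgM; [exact: cvg_cst|exact: sin_scaled_cvg]].
    have h2 : - expR (X m) @[m --> \oo] --> - expR (n%:R - n%:R ^+ 2 * (t - a)).
      by apply: cvgN; exact: (cvg_comp _ _ h1 (@continuous_expR R _)).
    exact: (cvg_comp _ _ h2 (@continuous_expR R _)).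
- by move=> m t; rewrite ger0_norm ?expR_ge0// -expR0 ler_expR oppr_le0 expR_ge0.
move=> t; have expN n : expR (- n%:R) <= n.+1%:R^-1 :> R.
  by rewrite expRN lef_pV2 ?posrE ?ltr0n ?expR_gt0// -natr1 addrC expR_ge1Dx.
apply/cvgrPdist_le => e e0.
have := @cvg_harmonic R => /cvgrPdist_le/(_ e e0) he.
rewrite indicE; case: (ltP a t) => ta; near=> n.
- rewrite mem_set /=; last by rewrite in_itv /= ta.
  set y := expR (_ - _).
  have y0 : 0 <= y by exact: expR_ge0.
  have hy : 1 - expR (- y) <= y by have := expR_ge1Dx (- y); lra.
  have hy0 : 0 <= 1 - expR (- y) by rewrite subr_ge0 -expR0 ler_expR; lra.
  rewrite ger0_norm//; apply: le_trans hy _; apply: (@le_trans _ _ (n.+1%:R^-1)).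
    apply: le_trans (expN n); rewrite ler_expR.
    have h2 : 2 / (t - a) <= n%:R by near: n; exact: nbhs_infty_ger.
    move: h2; rewrite ler_pdivrMr ?subr_gt0// => h2.
    have := ler0n R n; nra.
  have : `|0 - n.+1%:R^-1| <= e by near: n.
  by rewrite sub0r normrN ger0_norm ?invr_ge0.
- rewrite memNset /=; last by rewrite in_itv /= andbT; apply/negP; rewrite -leNgt.
  rewrite sub0r normrN ger0_norm ?expR_ge0//; apply: (@le_trans _ _ (n.+1%:R^-1)).
    apply: le_trans (expN n); rewrite ler_expR lerN2.
    apply: (@le_trans _ _ (expR n%:R)); first by apply: le_trans (expR_ge1Dx _); rewrite lerDr.
    rewrite ler_expR lerDl oppr_ge0 mulr_ge0_le0 ?sqr_ge0// subr_le0//.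
  have : `|0 - n.+1%:R^-1| <= e by near: n.
  by rewrite sub0r normrN ger0_norm ?invr_ge0.
Unshelve. all: by end_near. Qed.

(** Closure under bounded limits makes these sets a sigma-algebra, and it contains
    the rays. *)
Lemma multiplier_indic (A : set R) : measurable A -> multiplier (\1_A).
Proof.
suff h : (@ocitv R).-sigma.-measurable `<=` [set A | multiplier (\1_A)] by move=> mA; exact: h.
rewrite RGenOInfty.measurableE; apply: smallest_sub; last first.
  by move=> _ [x ->]; exact: multiplier_ray.
have hC A' : multiplier (\1_A') -> multiplier (\1_(~` A')).
  move=> hA; have := multiplierD (multiplier_cst 1) (multiplierZ (-1) hA).
  congr multiplier; apply/funext => t; rewrite !indicE in_setC; case: (t \in A') => /=; ring.
split.
- rewrite /= indic0; exact: multiplier_cst.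
- by move=> A' hA; rewrite /= setTD; exact: hC.
move=> F hF /=.
have hU n : multiplier (\1_(\bigcup_(k < n) F k)).
  elim: n => [|n IH]; first by rewrite bigcup_mkord big_ord0 indic0; exact: multiplier_cst.
  have := multiplierD IH (multiplierD (hF n) (multiplierZ (-1) (multiplierM IH (hF n)))).
  congr multiplier; apply/funext => t; rewrite !indicE !bigcup_mkord big_ord_recr /= in_setU.
  by do 2!case: (t \in _) => /=; ring.
apply: (@multiplier_lim (fun n => \1_(\bigcup_(k < n) F k)) _ 1) => //.
- by move=> n t; rewrite indicE; case: (_ \in _); rewrite ?normr1 ?normr0.
move=> t; apply/cvgrPdist_le => e e0; rewrite indicE.
have [|tF] := boolP (t \in \bigcup_k F k).
  rewrite inE => -[k _ Fk]; near=> n.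
  rewrite indicE mem_set ?subrr ?normr0 ?(ltW e0)//; exists k => //=.
  by near: n; exact: nbhs_infty_gt.
near=> n; rewrite indicE memNset ?subrr ?normr0 ?(ltW e0)//.
by move=> [k _ Fk]; move: tF; rewrite mem_set//; exists k.
Unshelve. all: by end_near. Qed.

Lemma multiplier_bounded g (B : R) : measurable_fun [set: R] g -> (forall t, `|g t| <= B) -> multiplier g.
Proof.
have pos (h : R -> R) (B' : R) : measurable_fun [set: R] h -> (forall t, 0 <= h t <= B') -> multiplier h.
  move=> mh hB.
  have mh' : measurable_fun [set: R] (EFin \o h) by exact/measurable_EFinP.
  pose a n : {nnsfun R >-> R} := nnsfun_approx measurableT mh' n.
  have h0 t : [set: R] t -> (0 <= (EFin \o h) t)%E by move=> _; rewrite lee_fin; case/andP: (hB t).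
  have ha t : a n t @[n --> \oo] --> h t.
    have hc := cvg_nnsfun_approx measurableT mh' h0 (I : [set: R] t).
    exact: (fine_cvg hc).
  apply: (@multiplier_lim (fun n => a n) _ B') => //.
  - move=> n; rewrite (funext (fimfunEord (a n))).
    apply: multiplier_sum => i; apply: multiplierZ; apply: multiplier_indic.
    exact: measurable_sfunP.
  - move=> n t; rewrite ger0_norm//; apply: (@le_trans _ _ (h t)); last by case/andP: (hB t).
    by rewrite -lee_fin /a nnsfun_approxE; exact: le_approx.
move=> mg gB; have B0 : 0 <= B by exact: le_trans (normr_ge0 _) (gB 0).
have -> : g = fun t => (g t + B) + (- B) by apply/funext => t; rewrite addrK.
apply: multiplierD; last exact: multiplier_cst.
apply: (pos _ (B + B)); first by apply: measurable_funD => //; exact: measurable_cst.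
by move=> t; have := gB t; rewrite ler_norml => /andP[h1 h2]; apply/andP; split; lra.
Qed.

(** A measurable function is the Gaussian times a measurable function, hence a limit
    of the Gaussian times bounded ones, and these are multipliers. *)
Lemma dist_cgauss_dense f : Lp f -> dist p V f = 0.
Proof.
have phi0 t : expR (- (pi * t ^+ 2)) != 0 :> R by rewrite gt_eqF// expR_gt0.
have real (u : R -> R) : measurable_fun [set: R] u -> Lp (fun t => (u t)%:C%C) -> modclosure (fun t => (u t)%:C%C).
  move=> mu' Lu; pose q t := u t / expR (- (pi * t ^+ 2)).
  have mq : measurable_fun [set: R] q.
    have -> : q = fun t => u t * expR (pi * t ^+ 2) by apply/funext => t; rewrite /q expRN invrK.
    apply: measurable_funM => //; apply: continuous_measurable_fun => t.
    apply/differentiable_continuous/derivable1_diffP; exact: ex_derive.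
  pose A n := [set t | `|q t| <= n%:R].
  have mA n : measurable (A n).
    have := @measurable_fun_le _ _ R setT (fun t => `|q t|) (fun=> n%:R) measurableT (measurableT_comp (@normr_measurable R setT) mq) (measurable_cst _).
    by rewrite setTI.
  pose qn n t := q t * \1_(A n) t.
  have mqn n : multiplier (qn n).
    apply: (@multiplier_bounded _ n%:R).
      by apply: measurable_funM => //; exact: measurable_indic.
    move=> t; rewrite /qn indicE; case: (boolP (t \in A n)); rewrite ?inE /A /= ?mulr1// => _.
    by rewrite mulr0 normr0.
  apply: modclosure_lim => // e e0.
  have [mu1 nu1] := Lu.
  have uE n t : (qn n t)%:C%C * cgauss 0 t = (u t * \1_(A n) t)%:C%C.
    by rewrite -[0]/(0%:C%C) cgauss_real /gaussian subr0 -rmorphM /qn /q mulrAC divfK//.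
  have [||||||n hn] := @cLnorm_dominated R p p1 (fun n t => (qn n t)%:C%C * cgauss 0 t) _ (fun t => Normc.normc (u t)%:C%C) _ mu1 _ _ _ _ _ e e0.
  - by move=> n; under eq_fun do rewrite uE; apply: cmeasurable_real; apply: measurable_funM => //; exact: measurable_indic.
  - exact: cmeasurable_normc.
  - exact: cLp_int.
  - move=> n t; rewrite uE !normc_real indicE; case: (_ \in _); rewrite ?mulr1 ?mulr0 ?normr0//.
  - by [].
  - move=> t; apply/cvgrPdist_le => d d0; near=> n.
    rewrite uE indicE mem_set ?mulr1 ?subrr ?Normc.normc0 ?subrr ?normr0 ?(ltW d0)//.
    rewrite /A /=; near: n; exact: nbhs_infty_ger.
  exists (fun t => (qn n t)%:C%C * cgauss 0 t) => //.
  by case: (mqn n) => _ _; apply; exact: modclosure_cgauss.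
move=> Lf; have [[m1 m2] nf] := Lf.
have : modclosure f.
  have -> : f = fun t => (complex.Re (f t))%:C%C + 'i%C * (complex.Im (f t))%:C%C.
    by apply/funext => t; case: (f t) => a b; apply/eqP; rewrite eq_complex /= !mul0r !mul1r subr0 !add0r addr0 !eqxx.
  apply: modclosureD; last apply: modclosureZ; apply: real => //.
    apply: (cLp_normc _ _ Lf); first exact: cmeasurable_real.
    by move=> t; rewrite normc_real normr_Re_le.
  apply: (cLp_normc _ _ Lf); first exact: cmeasurable_real.
  by move=> t; rewrite normc_real normr_Im_le.
by move=> [_ /(_ 0)]; under eq_fun do rewrite cis0 mul1r.
Unshelve. all: by end_near. Qed.

End Multipliers.

(** * Density above one half *)

Section Counting.
Context {R : realType}.
Implicit Types A : set R.

Lemma counting_seq A : finite_set A -> exists s : seq R,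
  [/\ uniq s, forall x, (x \in s) = (x \in A) & counting A = ((size s)%:R%:E : \bar R)].
Proof.
move=> fA; exists (finmap.enum_fset (fset_set A)); split; first exact: finmap.fset_uniq.
  by move=> x; rewrite -(in_fset_set fA).
by rewrite /counting (asboolT fA).
Qed.

Lemma counting_notin A (s : seq R) : ((size s).+1%:R%:E <= counting A :> \bar R)%E ->
  exists2 x, A x & x \notin s.
Proof.
move=> h; apply: contrapT => hA.
have sA x : A x -> x \in s by move=> Ax; apply: contrapT => /negP xs; apply: hA; exists x.
have fA : finite_set A by apply: (@sub_finite_set _ _ [set` s]) => //; exact: finite_seq.
have [s' [us' ms' cs']] := counting_seq fA; move: h; rewrite cs' lee_fin ler_nat ltnNge.
by rewrite uniq_leq_size// => x; rewrite ms' inE; exact: sA.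
Qed.

(** Greedy choice: the window that contains the admissible values of the [j]-th
    point holds at least [k + j] points, because [d] is below the density, and large
    [k] absorbs the shift [M]. *)
Lemma density_gt_select A (M : R) : 0 <= M -> density_gt A (1 / 2) ->
  exists2 d, 1 / 2 < d & exists k1 : nat, forall k m, (k1 <= k)%N -> exists s : seq R,
  [/\ uniq s, size s = m & forall j, (j < m)%N -> A s`_j /\ (M + `|s`_j|) ^+ 2 <= (k + j)%:R / d].
Proof.
move=> M0 [D hD D2].
have [d0 d02 d0D] : exists2 d0 : R, 1 / 2 < d0 & (d0%:E < D)%E.
  case: D D2 {hD} => [x||] //.
  - by rewrite lte_fin => hx; exists ((1 / 2 + x) / 2); rewrite ?lte_fin; lra.
  - by move=> _; exists 1; rewrite ?ltry//; lra.
pose d := (1 / 2 + d0) / 2.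
have [d1 dd0] : 1 / 2 < d /\ d < d0 by rewrite /d; split; lra.
have dp : 0 < d by lra.
have d0p : 0 < d0 by lra.
have [r0 [r0r hr]] : exists r0 : R, 0 < r0 /\ forall r, r0 <= r -> ((d0 * r ^+ 2)%:E <= counting (A `&` `](- r)%R, r[))%E.
  have : \forall r \near +oo%R, (d0%:E < counting (A `&` `](- r)%R, r[) * ((r ^+ 2)^-1)%:E)%E.
    by have /hD := open_ereal_gt' d0D.
  move=> [r1 [r1r hr1]]; exists (`|r1| + 1); split; first by rewrite ltr_wpDl.
  move=> r hr; have rp : 0 < r by apply: lt_le_trans hr; rewrite ltr_wpDl.
  have /hr1 : r1 < r by apply: lt_le_trans hr; rewrite (le_lt_trans (ler_norm _))// ltrDl.
  by rewrite lte_pdivlMr ?exprn_gt0// EFinM => /ltW.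
pose q := Num.sqrt (d / d0).
have q0 : 0 <= q by exact: sqrtr_ge0.
have q1 : q < 1 by rewrite -sqrtr1 ltr_sqrt// ltr_pdivrMr// mul1r.
have qq : q ^+ 2 = d / d0 by rewrite sqr_sqrtr// divr_ge0 ?ltW.
pose U := M / (1 - q) + M + r0.
have U0 : 0 < U by rewrite ltr_wpDl// addr_ge0// divr_ge0// subr_ge0 ltW.
exists d => //; exists (Num.truncn (d * U ^+ 2)).+1 => k m hk; elim: m => [|m [s [us ss hs]]].
  by exists [::].
pose n := (k + m)%N; pose u := Num.sqrt (n%:R / d); pose r := u - M.
have uu : u ^+ 2 = n%:R / d by rewrite sqr_sqrtr// divr_ge0 ?(ltW dp).
have u0 : 0 <= u by exact: sqrtr_ge0.
have uU : U <= u.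
  rewrite -(@ler_pXn2r _ 2) ?nnegrE ?(ltW U0)// uu ler_pdivlMr// mulrC ltW//.
  apply: lt_le_trans (truncnS_gt _) _.
  by rewrite ler_nat (leq_trans hk)// leq_addr.
have M1 : M <= (1 - q) * u.
  rewrite mulrC -ler_pdivrMr ?subr_gt0//; apply: le_trans uU.
  by rewrite /U -addrA lerDl addr_ge0// ltW.
have rr0 : r0 <= r.
  rewrite /r lerBrDr; apply: le_trans uU; rewrite /U -addrA [r0 + M]addrC lerDr.
  by rewrite divr_ge0// subr_ge0 ltW.
have rq : q * u <= r by rewrite /r; lra.
have cn : (n%:R%:E <= counting (A `&` `](- r)%R, r[) :> \bar R)%E.
  apply: le_trans (hr r rr0); rewrite lee_fin.
  have : (q * u) ^+ 2 <= r ^+ 2 by rewrite lerXn2r ?nnegrE ?mulr_ge0// (le_trans _ rq)// mulr_ge0.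
  rewrite exprMn qq uu => h; have := ler_wpM2l (ltW d0p) h.
  suff -> : d0 * (d / d0 * (n%:R / d)) = n%:R by [].
  by field; rewrite ?gt_eqF.
have [x [Ax xr] xs] : exists2 x, (A `&` `](- r)%R, r[) x & x \notin s.
  apply: counting_notin; apply: le_trans cn; rewrite lee_fin ler_nat ss /n.
  by rewrite -addn1 addnC leq_add2r (leq_trans _ hk).
exists (rcons s x); split; rewrite ?rcons_uniq ?xs ?size_rcons ?ss//.
move=> j; rewrite ltnS leq_eqVlt nth_rcons ss => /orP[/eqP ->|jm]; last by rewrite jm; exact: hs.
rewrite ltnn eqxx; split => //; rewrite -/n -uu lerXn2r ?nnegrE ?addr_ge0//.
move: xr; rewrite /= in_itv /= -ltr_norml /r => /ltW; lra.
Qed.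

End Counting.

Section AffineTransfer.
Context {R : realType}.
Implicit Types (N : R[i] -> R) (z w b : R[i]).

Lemma submean_shift N b : submean N -> submean (fun z => N (z + b)).
Proof.
move=> sN z a1 a2; have [C [r0 [r00 h]]] := sN (z + b) a1 a2.
exists C, r0; split => // r hr; apply: le_trans (h r hr) _; rewrite lerD2r ler_pM2l//.
by apply: ler_sum => k _; rewrite addrAC.
Qed.

(** Replacing [h] by [- h] only permutes the four points [i^k r]. *)
Lemma submean_opp N : submean N -> submean (fun z => N (- z)).
Proof.
move=> sN z a1 a2; have [C [r0 [r00 h]]] := sN (- z) (- a1) a2.
exists C, r0; split => // r hr; apply: le_trans (h r hr) _; rewrite lerD2r ler_pM2l//.
have i2 : ('i%C : R[i]) ^+ 2 = -1 by exact: sqr_i.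
have i3 : ('i%C : R[i]) ^+ 3 = - 'i%C by rewrite exprS i2 mulrN1.
rewrite !big_ord_recl !big_ord0 /= /bump /= !addn0 !add1n i3 i2 !expr0 !expr1.
rewrite !(mulrN, mulNr, mul1r, opprK, opprD, sqrrN).
by apply: le_of_eq; ring.
Qed.

Lemma locally_lipschitz_shift N b : locally_lipschitz N -> locally_lipschitz (fun z => N (z + b)).
Proof.
move=> lN B; have [L hL] := lN (B + Normc.normc b); exists L => z w zB wB.
have -> : z - w = (z + b) - (w + b) by rewrite opprD addrACA subrr addr0.
by apply: hL; apply: le_trans (le_normcD _ _) _; rewrite lerD2r.
Qed.

Lemma locally_lipschitz_opp N : locally_lipschitz N -> locally_lipschitz (fun z => N (- z)).
Proof.
move=> lN B; have [L hL] := lN B; exists L => z w zB wB.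
by have := hL (- z) (- w); rewrite !normcN -opprD normcN; apply.
Qed.

End AffineTransfer.

Section Spanning.
Context {R : realType}.
Variables (p : R) (p1 : 1 <= p).
Notation Lp := (@cLp R p%:E).

Definition lin_span (I : Type) (A : set I) (F : I -> R -> R[i]) : set (R -> R[i]) :=
  [set f | exists n (i : 'I_n -> I) (c : 'I_n -> R[i]),
    (forall k, A (i k)) /\ f = fun t => \sum_(k < n) c k * F (i k) t].

Lemma lin_span_mem I (A : set I) F i : A i -> lin_span A F (F i).
Proof.
move=> Ai; exists 1, (fun=> i), (fun=> 1); split => //.
by apply/funext => t; rewrite big_ord1 mul1r.
Qed.

Lemma lin_span_subspace I (A : set I) F : (forall i, Lp (F i)) -> subspaceLp p (lin_span A F).
Proof.
move=> LF; split.
- by move=> _ [n [i [c [_ ->]]]]; apply: (cLp_sum p1) => k; exact: cLpZ.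
- have f0 : 'I_0 -> I by case.
  exists 0%N, f0, (fun=> 0); split; first by case.
  by apply/funext => t; rewrite big_ord0.
- move=> _ _ [n [i [c [hi ->]]]] [n' [i' [c' [hi' ->]]]].
  exists (n + n')%N, (fun k => match fintype.split k with inl j => i j | inr j => i' j end),
    (fun k => match fintype.split k with inl j => c j | inr j => c' j end); split.
    by move=> k; case: (fintype.split k).
  apply/funext => t; rewrite big_split_ord /=; congr (_ + _); apply: eq_bigr => k _.
    by rewrite (unsplitK (inl k)).
  by rewrite (unsplitK (inr k)).
- move=> a _ [n [i [c [hi ->]]]]; exists n, i, (fun k => a * c k); split => //.
  by apply/funext => t; rewrite mulr_sumr; apply: eq_bigr => k _; rewrite mulrA.
Qed.

Lemma dist0_spans I (A : set I) F : (forall i, Lp (F i)) ->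
  (forall f, Lp f -> dist p (lin_span A F) f = 0) -> spans_Lp p%:E A F.
Proof.
move=> LF h f Lf e e0; have [VL V0 _ _] := lin_span_subspace A LF.
have [v Vv] := dist_lt p f V0 e0; rewrite h// add0r => hv.
have Lv := VL _ Vv; have [n [i [c [hi vE]]]] := Vv; exists n, i, c; split => //.
have -> : (fun t => f t - \sum_(k < n) c k * F (i k) t) = (fun t => f t - v t) by rewrite vE.
by rewrite -rnormK ?lte_fin//; exact: cLpB.
Qed.

Lemma cLp_gaussian (x : R) : Lp (fun t => gaussian (t - x)).
Proof.
have -> : (fun t => gaussian (t - x)) = cgauss x%:C%C by apply/funext => t; rewrite cgauss_real.
exact: cLp_cgauss.
Qed.

(** On either half-line the distance function of the complex Gaussian translates,
    read in the coordinate pointing outwards, satisfies the hypotheses of the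
    uniqueness theorem; the shift puts any given point into the sector. *)
Lemma spans_of_density (A A' : set R) (s : bool) : A' `<=` A ->
  (forall x, A' x -> `|x| = (-1) ^+ s * x) -> density_gt A' (1 / 2) ->
  spans_Lp p%:E A (fun x t : R => gaussian (t - x)).
Proof.
move=> A'A hs hd; have LF := cLp_gaussian; apply: dist0_spans => //.
have hV := lin_span_subspace A LF; set V := lin_span _ _ in hV *.
apply: (dist_cgauss_dense p1 hV) => z0.
pose sg : R[i] := (-1) ^+ s.
have sgsg : sg * sg = 1 by rewrite /sg -expr2 sqrr_sign.
pose N z := dist p V (cgauss z).
have N0 z : 0 <= N z by apply: dist_ge0; case: hV.
pose M := 1 + `|complex.Im z0| + `|complex.Re z0|.
have M1 : 1 <= M by rewrite /M -addrA lerDl addr_ge0.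
have M0 : 0 <= M by lra.
have [d d1 [k1 hk]] := density_gt_select M0 hd.
pose N' z := N (sg * (z - M%:C%C)).
have sN' : submean N'.
  rewrite /N' /sg; case: (s).
    under eq_fun do rewrite expr1 mulN1r.
    exact: (submean_shift _ (submean_opp (dist_cgauss_submean p1 hV))).
  under eq_fun do rewrite expr0 mul1r.
  exact: (submean_shift _ (dist_cgauss_submean p1 hV)).
have lN' : locally_lipschitz N'.
  rewrite /N' /sg; case: (s).
    under eq_fun do rewrite expr1 mulN1r.
    exact: (locally_lipschitz_shift _ (locally_lipschitz_opp (dist_cgauss_lipschitz p1 hV))).
  under eq_fun do rewrite expr0 mul1r.
  exact: (locally_lipschitz_shift _ (dist_cgauss_lipschitz p1 hV)).
have [C hC] := dist_cgauss_growth p1 hV.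
have gN' z : N' z <= C * expR (pi * complex.Im z ^+ 2).
  have := hC (sg * (z - M%:C%C)); suff -> : complex.Im (sg * (z - M%:C%C)) ^+ 2 = complex.Im z ^+ 2 by [].
  rewrite /sg; case: (s); case: (z) => a b.
    by rewrite expr1 mulN1r /= subr0 sqrrN.
  by rewrite expr0 mul1r /= subr0.
have -> : z0 = sg * ((sg * z0 + M%:C%C) - M%:C%C) by rewrite addrK mulrA sgsg mul1r.
apply: (@vanish_sector _ N' C d k1) => //.
- by move=> z; exact: N0.
- move=> k m hkm; have [t [ut st ht]] := hk k m hkm.
  exists [seq M + `|x| | x <- t]; split; rewrite ?size_map//.
    rewrite map_inj_in_uniq// => x y /(nthP 0)[i it <-] /(nthP 0)[j jt <-] /addrI.
    rewrite st in it jt; have [Ai _] := ht i it; have [Aj _] := ht j jt.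
    by rewrite !hs//; apply: mulfI; rewrite signr_eq0.
  move=> j jm; rewrite (nth_map 0) ?st//; have [At ht2] := ht j jm; split => //.
    by rewrite (le_trans M1)// lerDl.
  rewrite /N' rmorphD addrAC subrr add0r hs// rmorphM rmorph_sign mulrA sgsg mul1r /N.
  apply: (dist0 p1 hV).
  have -> : cgauss (t`_j)%:C%C = fun u => gaussian (u - t`_j) by apply/funext => u; rewrite cgauss_real.
  exact: (lin_span_mem (fun x t : R => gaussian (t - x)) (A'A _ At)).
- rewrite /M /sg; case: (s); case: (z0) => a b; rewrite ?expr1 ?mulN1r ?expr0 ?mul1r /= addr0 ?normrN.
  have := ler_norm a; lra.
have := ler_norm (- a); rewrite normrN; lra.
Qed.

End Spanning.

(** * Regular enumeration *)

Section RegularEnumeration.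
Context {R : realType}.
Variables (M : set R) (D d : R).
Hypotheses (D0 : 0 <= D) (Dd : D < d) (hD : has_density M D%:E).

Let d0 : 0 < d. Proof. exact: le_lt_trans Dd. Qed.

Definition window (x : R) : set R := [set y | [/\ M y, y != 0 & `|y| <= x]].

Let win x : seq R := finmap.enum_fset (fset_set (window x)).

(** The counting function of [M], topped up to have density exactly [d]. *)
Definition window_index (x : R) : nat := (size (win x) + Num.truncn ((d - D) * x ^+ 2))%N.

Let count_bounds e : 0 < e -> exists2 r0, 0 < r0 & forall r, r0 <= r -> exists s : seq R,
  [/\ uniq s, forall x, (x \in s) = (x \in M `&` `](- r)%R, r[) &
     (D - e) * r ^+ 2 <= (size s)%:R <= (D + e) * r ^+ 2].
Proof.
move=> e0.
have h1 : (D%:E < (D + e)%:E)%E by rewrite lte_fin ltrDl.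
have h2 : ((D - e)%:E < D%:E)%E by rewrite lte_fin gtrBl.
have /hD [r1 [_ hr1]] := open_ereal_lt' h1.
have /hD [r2 [_ hr2]] := open_ereal_gt' h2.
exists (1 + `|r1| + `|r2|); first by rewrite -addrA ltr_pwDl ?addr_ge0.
move=> r hr; have rp : 0 < r by apply: lt_le_trans hr; rewrite -addrA ltr_pwDl ?addr_ge0.
have r1r : r1 < r by apply: lt_le_trans hr; rewrite (le_lt_trans (ler_norm _))//; have := normr_ge0 r2; lra.
have r2r : r2 < r by apply: lt_le_trans hr; rewrite (le_lt_trans (ler_norm _))//; have := normr_ge0 r1; lra.
have rr : 0 < r ^+ 2 by rewrite exprn_gt0.
have u1 := hr1 _ r1r; have u2 := hr2 _ r2r.
rewrite /= in u1 u2; move: u1 u2; rewrite lte_pdivrMr// lte_pdivlMr// -!EFinM => u1 u2.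
have fin : finite_set (M `&` `](- r)%R, r[).
  apply: contrapT => h; move: u1; rewrite /counting asboolF//.
have [s [us ms cs]] := @counting_seq R _ fin; exists s; split => //.
by move: u1 u2; rewrite cs !lte_fin => /ltW -> /ltW ->.
Qed.

Lemma window_finite x : finite_set (window x).
Proof.
have [r0 r00 h] := count_bounds ltr01.
have [s [_ ms _]] := h _ (ler_wpDr (normr_ge0 x) (lexx r0)).
apply: (@sub_finite_set _ _ [set` s]); last exact: finite_seq.
move=> y [My _ yx] /=; rewrite ms inE; split => //=; rewrite in_itv /= -ltr_norml.
by apply: le_lt_trans yx _; apply: le_lt_trans (ler_norm x) _; rewrite ltrDr.
Qed.

Let mem_win x y : (y \in win x) = (y \in window x).
Proof. exact: (in_fset_set (window_finite x)). Qed.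

Let uniq_win x : uniq (win x). Proof. exact: finmap.fset_uniq. Qed.

Let win_le x y : x <= y -> {subset win x <= win y}.
Proof.
move=> xy z; rewrite !mem_win !inE => -[Mz z0 zx]; split => //; exact: le_trans xy.
Qed.

Lemma window_index_le x y : 0 <= x <= y -> (window_index x <= window_index y)%N.
Proof.
move=> /andP[x0 xy]; apply: leq_add; first exact/uniq_leq_size/win_le.
by apply: le_truncn; rewrite ler_wpM2l ?subr_ge0 ?(ltW Dd)// lerXn2r ?nnegrE// (le_trans x0).
Qed.

Lemma window_index_lt x y : M y -> y != 0 -> 0 <= x < `|y| -> (window_index x < window_index `|y|)%N.
Proof.
move=> My y0 /andP[x0 xy]; rewrite /window_index -addSn; apply: leq_add.
  have ynot : y \notin win x.
    by rewrite mem_win; apply/negP; rewrite inE => -[_ _]; rewrite leNgt xy.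
  have -> : (size (win x)).+1 = size (y :: win x) by [].
  apply: uniq_leq_size; first by rewrite /= ynot uniq_win.
  move=> z; rewrite inE => /orP[/eqP ->|]; last exact: win_le (ltW xy) z.
  by rewrite mem_win inE; split.
by apply: le_truncn; rewrite ler_wpM2l ?subr_ge0 ?(ltW Dd)// lerXn2r ?nnegrE// ltW.
Qed.

Lemma window_index_asymp e : 0 < e -> exists2 X, 0 < X &
  forall x, X <= x -> `|(window_index x)%:R - d * x ^+ 2| <= e * x ^+ 2.
Proof.
move=> e0; pose a := 3 * D + 4; have a0 : 0 < a by rewrite /a; move: D0; lra.
pose e1 := Order.min 1 (e / a).
have [e10 e11 e1a] : [/\ 0 < e1, e1 <= 1 & e1 <= e / a].
  by rewrite lt_min ge_min lexx ltr01 divr_gt0// ge_min lexx orbT.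
have e1e : e1 * a <= e by rewrite -ler_pdivlMr.
have [r0 r00 h] := count_bounds e10.
exists (r0 + (1 + 4 / e)); first by rewrite addr_gt0// ltr_pwDl// divr_ge0// ltW.
move=> x hx; have x1 : 1 + 4 / e <= x by apply: le_trans hx; rewrite lerDr ltW.
have e4 : 0 < 4 / e by rewrite divr_gt0.
have x0 : 0 < x by apply: lt_le_trans x1; rewrite ltr_pwDl// ltW.
have xr : r0 <= x by apply: le_trans hx; rewrite lerDl; lra.
have x2 : 4 <= e * x ^+ 2.
  have : 4 / e <= x ^+ 2.
    apply: (@le_trans _ _ x); first by lra.
    by rewrite expr2 ler_peMr ?ltW//; lra.
  by rewrite ler_pdivrMr// mulrC.
have xx : 0 <= x ^+ 2 by exact: sqr_ge0.
(* upper bound for the count, from the window of radius (1 + e1) x *)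
have up : (size (win x))%:R <= (D + e1) * ((1 + e1) * x) ^+ 2.
  have xs : x < (1 + e1) * x by rewrite mulrDl mul1r ltrDl mulr_gt0.
  have [s [us ms /andP[_ sb]]] := h _ (le_trans xr (ltW xs)).
  apply: le_trans sb; rewrite ler_nat; apply: uniq_leq_size (uniq_win x) _ => y.
  rewrite mem_win ms !inE => -[My _ yx]; split => //=; rewrite in_itv /= -ltr_norml.
  exact: le_lt_trans yx xs.
have lo : (D - e1) * x ^+ 2 <= (size (win x))%:R + 1.
  have [s [us ms /andP[sb _]]] := h _ xr.
  apply: le_trans sb _; rewrite natr1 ler_nat.
  have -> : (size (win x)).+1 = size (0 :: win x) by [].
  apply: uniq_leq_size us _ => y; rewrite ms !inE => -[My]; rewrite /= in_itv /= -ltr_norml => yx.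
  have [//|yn0] := eqVneq y 0; rewrite mem_win inE /=; split => //; exact: ltW.
have b0 : 0 <= (d - D) * x ^+ 2 by rewrite mulr_ge0// subr_ge0 ltW.
have /andP[t1 t2] := truncn_itv b0.
rewrite -natr1 in t2.
have up2 : (D + e1) * ((1 + e1) * x) ^+ 2 <= (D + e1 * a) * x ^+ 2.
  rewrite exprMn mulrA ler_wpM2r//.
  have q : (1 + e1) ^+ 2 <= 1 + 3 * e1 by nra.
  apply: le_trans (ler_wpM2l _ q) _; first by rewrite addr_ge0// ltW.
  by rewrite /a; nra.
have e1x : e1 * a * x ^+ 2 <= e * x ^+ 2 by rewrite ler_wpM2r.
have e4x : 4 * (e1 * x ^+ 2) <= e * x ^+ 2.
  apply: le_trans e1x; rewrite mulrA ler_wpM2r// mulrC ler_wpM2l ?(ltW e10)// /a.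
  by move: D0; lra.
rewrite /window_index natrD ler_norml; apply/andP; split; lra.
Qed.

(** Enumerate the moduli of the points of [M] along their window index, filling
    the unused indices with the model sequence [sqrt ((j + 1) / d)]. *)
Definition regular_enum (j : nat) : R :=
  if pselect (exists y, [/\ M y, y != 0 & window_index `|y| = j.+1]) is left h
  then `|projT1 (cid h)| else Num.sqrt j.+1%:R / Num.sqrt d.

Lemma regular_enum_gt0 j : 0 < regular_enum j.
Proof.
rewrite /regular_enum; case: pselect => [h|_].
  by have [_ h0 _] := projT2 (cid h); rewrite normr_gt0.
by rewrite divr_gt0 ?sqrtr_gt0 ?ltr0n.
Qed.

Lemma regular_enum_onto y : M y -> y != 0 -> exists j, regular_enum j = `|y|.
Proof.
move=> My y0.
have k0 : (0 < window_index `|y|)%N.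
  by apply: leq_ltn_trans (window_index_lt (x := 0) My y0 _); rewrite ?lexx ?normr_gt0.
exists (window_index `|y|).-1; rewrite /regular_enum prednK//.
case: pselect => [h|]; last by case; exists y.
have [Mz z0 hz] := projT2 (cid h); set z := projT1 _ in Mz z0 hz *.
case: (ltgtP `|z| `|y|) => // zy; exfalso.
  by have := window_index_lt My y0 (x := `|z|); rewrite normr_ge0 zy hz ltnn => /(_ isT).
by have := window_index_lt Mz z0 (x := `|y|); rewrite normr_ge0 zy hz ltnn => /(_ isT).
Qed.

Lemma regular_enum_asymp : regular_enum j * (Num.sqrt d / Num.sqrt j.+1%:R) @[j --> \oo] --> (1 : R).
Proof.
apply/cvgrPdist_le => E E0.
pose e := Order.min (d / 2) (E * d / 2).
have [e0 e1 e2] : [/\ 0 < e, e <= d / 2 & e <= E * d / 2].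
  by rewrite lt_min ge_min lexx !divr_gt0 ?mulr_gt0// ge_min lexx orbT.
have [X X0 hX] := window_index_asymp e0.
exists (window_index X) => // j /= jX.
have sd : 0 < Num.sqrt d by rewrite sqrtr_gt0.
have sj : 0 < Num.sqrt j.+1%:R :> R by rewrite sqrtr_gt0 ltr0n.
rewrite distrC; set q := _ * _.
have q0 : 0 < q by rewrite mulr_gt0 ?regular_enum_gt0// divr_gt0.
suff : `|q ^+ 2 - 1| <= E.
  have -> : q ^+ 2 - 1 = (q - 1) * (q + 1) by ring.
  rewrite normrM; apply: le_trans; rewrite ler_peMr// ger0_norm ?addr_ge0 ?(ltW q0)//.
  by rewrite lerDr ltW.
rewrite /q /regular_enum; case: pselect => [h|_]; last first.
  have -> : Num.sqrt j.+1%:R / Num.sqrt d * (Num.sqrt d / Num.sqrt j.+1%:R) = 1 :> R.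
    by field; rewrite !gt_eqF.
  by rewrite expr1n subrr normr0 ltW.
have [My y0 hy] := projT2 (cid h); set y := projT1 _ in My y0 hy *.
rewrite exprMn exprMn exprVn !sqr_sqrtr ?(ltW d0)//; set x := `|y| in hy *.
have x0 : 0 < x by rewrite normr_gt0.
have Xx : X <= x.
  rewrite leNgt; apply/negP => xX.
  have := @window_index_le x X; rewrite (ltW x0) (ltW xX) hy => /(_ isT) h'.
  by move: (leq_trans h' jX); rewrite ltnn.
have := hX x Xx; rewrite hy; set k : R := j.+1%:R => hk.
have k0 : 0 < k by rewrite ltr0n.
have xx : 0 < x ^+ 2 by rewrite exprn_gt0.
have -> : x ^+ 2 * (d / k) - 1 = - (k - d * x ^+ 2) / k by field; rewrite gt_eqF.
rewrite normrM normrN normfV (gtr0_norm k0) ler_pdivrMr//.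
have kd : d / 2 * x ^+ 2 <= k.
  move: (hk); rewrite ler_norml => /andP[hk' _].
  have := ler_wpM2r (ltW xx) e1; lra.
apply: le_trans hk _.
apply: le_trans (ler_wpM2r (ltW xx) e2) _.
by have := ler_wpM2l (ltW E0) kd; lra.
Qed.

End RegularEnumeration.

(** * Canonical products *)

Section CubicTail.
Context {R : realType}.

(** Comparable to [min (S, S^3)]. *)
Definition ctail (S : R) := S ^+ 3 / (1 + S) ^+ 2.

Lemma ctail_ge0 S : 0 <= S -> 0 <= ctail S.
Proof. by move=> S0; rewrite divr_ge0 ?exprn_ge0 ?addr_ge0. Qed.

Lemma expr3_le_ctail S : 0 <= S <= 1 -> S ^+ 3 <= 4 * ctail S.
Proof.
move=> /andP[S0 S1]; rewrite /ctail mulrA ler_pdivlMr ?exprn_gt0 ?ltr_wpDr//.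
by rewrite mulrC ler_wpM2r ?exprn_ge0//; nra.
Qed.

Lemma expr3_le_ctailM B S : 0 <= S <= B -> S ^+ 3 <= (1 + B) ^+ 2 * ctail S.
Proof.
move=> /andP[S0 SB]; rewrite /ctail mulrA ler_pdivlMr ?exprn_gt0 ?ltr_wpDr//.
by rewrite mulrC ler_wpM2r ?exprn_ge0// lerXn2r ?nnegrE ?addr_ge0 ?lerD2l// (le_trans S0).
Qed.

(** Primitive of [ctail (r / sqrt j)] in [j], up to a constant. *)
Definition ctail_prim (r : R) (j : nat) := r ^+ 2 * (Num.sqrt j%:R / (r + Num.sqrt j%:R)).

Lemma ctail_step r j : 0 <= r ->
  ctail (r / Num.sqrt j.+1%:R) <= 2 * (ctail_prim r j.+1 - ctail_prim r j).
Proof.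
rewrite le_eqVlt => /orP[/eqP <-|r0].
  by rewrite /ctail /ctail_prim mul0r !expr0n /= !mul0r subrr mulr0.
rewrite /ctail_prim; set a := Num.sqrt j%:R; set b := Num.sqrt j.+1%:R.
have a0 : 0 <= a by exact: sqrtr_ge0.
have b0 : 0 < b by rewrite sqrtr_gt0 ltr0n.
have ab : b ^+ 2 - a ^+ 2 = 1 by rewrite !sqr_sqrtr// -natr1 addrAC subrr add0r.
have le_ab : a <= b by rewrite ler_wsqrtr// ler_nat.
have ra : r + a != 0 by rewrite gt_eqF// ltr_wpDr.
have rb : r + b != 0 by rewrite gt_eqF// addr_gt0.
have -> : ctail (r / b) = r ^+ 3 / (r + b) ^+ 2 * b^-1.
  by rewrite /ctail; field; rewrite ?rb ?gt_eqF.
have -> : 2 * (r ^+ 2 * (b / (r + b)) - r ^+ 2 * (a / (r + a))) = r ^+ 3 / (r + b) ^+ 2 * (2 * (b - a) * ((r + b) / (r + a))).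
  by field; rewrite ra rb.
apply: ler_wpM2l; first by rewrite divr_ge0 ?exprn_ge0 ?addr_ge0 ?ltW.
apply: (@le_trans _ _ (2 * (b - a))).
  by rewrite -div1r ler_pdivrMr//; nra.
rewrite ler_peMr ?mulr_ge0 ?subr_ge0//.
by rewrite ler_pdivlMr ?ltr_pwDl// mul1r lerD2l.
Qed.

Lemma ctail_prim_ge0 r j : 0 <= r -> 0 <= ctail_prim r j.
Proof. by move=> r0; rewrite mulr_ge0 ?sqr_ge0// divr_ge0 ?addr_ge0 ?sqrtr_ge0. Qed.

Lemma ctail_prim_le r j : 0 <= r -> ctail_prim r j <= r ^+ 2.
Proof.
move=> r0; rewrite ler_piMr ?sqr_ge0//; set a := Num.sqrt _.
have [->|h] := eqVneq (r + a) 0; first by rewrite invr0 mulr0.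
have a0 : 0 <= a by exact: sqrtr_ge0.
by rewrite ler_pdivrMr ?mul1r ?lerDr// lt_neqAle eq_sym h addr_ge0.
Qed.

Lemma ctail_sum r n : 0 <= r -> \sum_(j < n) ctail (r / Num.sqrt j.+1%:R) <= 2 * r ^+ 2.
Proof.
move=> r0; apply: (@le_trans _ _ (2 * (ctail_prim r n - ctail_prim r 0))).
  elim: n => [|n IH]; first by rewrite big_ord0 subrr mulr0.
  by rewrite big_ord_recr /=; have := ctail_step n r0; lra.
by have := ctail_prim_le n r0; have := ctail_prim_ge0 0 r0; lra.
Qed.

Lemma cvg_of_ctail (u : nat -> R) (B C r : R) : 0 <= r -> 0 <= C ->
  (forall n, `|u n| <= B) ->
  (forall n, `|u n.+1 - u n| <= C * ctail (r / Num.sqrt n.+1%:R)) -> cvgn u.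
Proof.
move=> r0 C0 uB uC; pose v n := u n + 2 * C * ctail_prim r n.
have step n : `|u n.+1 - u n| <= 2 * C * (ctail_prim r n.+1 - ctail_prim r n).
  by apply: le_trans (uC n) _; rewrite [2 * C]mulrC -mulrA ler_wpM2l// ctail_step.
have cv : cvgn v.
  apply: nondecreasing_is_cvgn.
    apply/nondecreasing_seqP => n; have := step n; rewrite ler_norml /v => /andP[h _]; lra.
  exists (B + 2 * C * r ^+ 2) => _ [n _ <-]; apply: lerD; first exact: le_trans (ler_norm _) (uB n).
  by rewrite ler_wpM2l ?mulr_ge0// ctail_prim_le.
have cT : cvgn (fun n => 2 * C * ctail_prim r n).
  apply: nondecreasing_is_cvgn.
    apply/nondecreasing_seqP => n; have := step n; have := normr_ge0 (u n.+1 - u n); lra.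
  exists (2 * C * r ^+ 2) => _ [n _ <-].
  by rewrite ler_wpM2l ?mulr_ge0// ctail_prim_le.
have -> : u = (fun n => v n - 2 * C * ctail_prim r n) by apply/funext => n; rewrite /v addrK.
exact: is_cvgB.
Qed.

End CubicTail.

Section CanonicalProduct.
Context {R : realType}.
Variables (d : R) (al ga : nat -> R).
Hypotheses (d0 : 0 < d) (d12 : d < 1 / 2).
Hypotheses (al0 : al n @[n --> \oo] --> (0 : R)) (ga1 : ga n @[n --> \oo] --> (1 : R)).
Implicit Types (z : R[i]) (p q : {poly R}).

Let d1 : d <= 1. Proof. by apply: ltW; apply: lt_le_trans d12 _; rewrite ler_pdivrMr// mul1r ler1n. Qed.
Let d2 : 0 < 1 / 2 - d. Proof. by rewrite subr_gt0. Qed.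

Definition ceval p z : R[i] := (map_poly (real_complex R) p).[z].

Lemma cevalM p q z : ceval (p * q) z = ceval p z * ceval q z.
Proof. by rewrite /ceval rmorphM hornerM. Qed.

Lemma cevalB p q z : ceval (p - q) z = ceval p z - ceval q z.
Proof. by rewrite /ceval rmorphB hornerD hornerN. Qed.

Lemma ceval_monom c k z : ceval (c *: 'X^k) z = c%:C%C * z ^+ k.
Proof. by rewrite /ceval map_polyZ map_polyXn hornerZ hornerXn. Qed.

Lemma ceval_prod (I : Type) (r : seq I) (F : I -> {poly R}) z :
  ceval (\prod_(i <- r) F i) z = \prod_(i <- r) ceval (F i) z.
Proof. by rewrite /ceval rmorph_prod horner_prod. Qed.

Lemma ceval_real p (x : R) : ceval p x%:C%C = (p.[x])%:C%C.
Proof. by rewrite /ceval horner_map. Qed.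

Definition scale j : R := Num.sqrt d / Num.sqrt j.+1%:R.

(** A pair of real zeros of opposite signs, together with two more zeros that cancel
    the terms of order one and two. *)
Definition cfactor j : {poly R} := 1 - (al j * scale j ^+ 3) *: 'X^3 - (ga j * scale j ^+ 4) *: 'X^4.

Definition cprod n : {poly R} := \prod_(j < n) cfactor j.

Lemma scale_ge0 j : 0 <= scale j.
Proof. by rewrite divr_ge0 ?sqrtr_ge0. Qed.

Let radius z j := Normc.normc z * Num.sqrt d / Num.sqrt j.+1%:R.

Let radius_ge0 z j : 0 <= radius z j.
Proof. by rewrite !mulr_ge0 ?normc_ge0 ?invr_ge0 ?sqrtr_ge0. Qed.

Let radius_le z j : radius z j <= Normc.normc z.
Proof.
rewrite /radius -mulrA ler_piMr ?normc_ge0// ler_pdivrMr ?sqrtr_gt0 ?ltr0n// mul1r.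
by rewrite ler_wsqrtr//; apply: (@le_trans _ _ 1); [exact: d1|rewrite ler1n].
Qed.

Lemma cfactor_sub1 j z : Normc.normc (ceval (cfactor j) z - 1) <=
  `|al j| * radius z j ^+ 3 + `|ga j| * radius z j ^+ 4.
Proof.
have -> : ceval (cfactor j) z - 1 = - ((al j)%:C%C * ((scale j)%:C%C * z) ^+ 3 + (ga j)%:C%C * ((scale j)%:C%C * z) ^+ 4).
  have cX (a b : R) k : (a * b ^+ k)%:C%C = a%:C%C * b%:C%C ^+ k :> R[i].
    by rewrite rmorphM (rmorphXn (real_complex R)).
  rewrite /cfactor !cevalB !ceval_monom /ceval rmorph1 hornerC !cX.
  by rewrite !exprMn; ring.
rewrite normcN; apply: le_trans (le_normcD _ _) _.
rewrite !(Normc.normcM, normcX, normc_real) (ger0_norm (scale_ge0 j)).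
have -> : scale j * Normc.normc z = radius z j by rewrite mulrC mulrA.
exact: lexx.
Qed.

Let bounded_coef : exists2 c : R, 0 <= c & forall j, `|al j| <= c /\ `|ga j| <= c.
Proof.
have bnd (u : nat -> R) (l : R) : u n @[n --> \oo] --> l -> exists c, forall j, `|u j| <= c.
  move=> /cvgrPdist_le/(_ 1 ltr01)[K _ hK]; exists (\sum_(i < K) `|u i| + (`|l| + 1)) => j.
  have s0 : 0 <= \sum_(i < K) `|u i| by exact: sumr_ge0.
  case: (ltnP j K) => [jK|/hK h].
    rewrite (bigD1 (Ordinal jK)) //= -!addrA lerDl !addr_ge0//; exact: sumr_ge0.
  have -> : u j = l - (l - u j) by rewrite opprB addrC subrK.
  by apply: le_trans (ler_normB _ _) _; rewrite /= in h; lra.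
have [c1 h1] := bnd _ _ al0; have [c2 h2] := bnd _ _ ga1.
have c10 : 0 <= c1 by apply: le_trans (h1 0%N).
have c20 : 0 <= c2 by apply: le_trans (h2 0%N).
exists (c1 + c2) => [|j]; first exact: addr_ge0.
by split; [apply: le_trans (h1 j) _; rewrite lerDl|apply: le_trans (h2 j) _; rewrite lerDr].
Qed.

(* the finitely many factors where al and ga are not yet close to their limits *)
Let factor_bound (c : R) j z : 0 <= c -> `|al j| <= c -> `|ga j| <= c ->
  Normc.normc (ceval (cfactor j) z) <= 1 + c * (Normc.normc z ^+ 3 + Normc.normc z ^+ 4).
Proof.
move=> c0 h1 h2; set r := Normc.normc z; have r0 : 0 <= r by exact: normc_ge0.
have -> : ceval (cfactor j) z = 1 + (ceval (cfactor j) z - 1) by rewrite addrC subrK.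
apply: le_trans (le_normcD _ _) _; rewrite Normc.normc1 lerD2l.
apply: le_trans (cfactor_sub1 j z) _; rewrite mulrDr.
by apply: lerD; apply: ler_pM => //; rewrite ?exprn_ge0// lerXn2r ?nnegrE// radius_le.
Qed.

Let poly_le_exp (c th : R) : 0 <= c -> 0 < th -> exists2 C, 1 <= C &
  forall r, 0 <= r -> 1 + c * (r ^+ 3 + r ^+ 4) <= C * expR (th * r ^+ 2).
Proof.
move=> c0 th0; exists (1 + c + 4 * c / th ^+ 2).
  by rewrite -addrA lerDl addr_ge0// divr_ge0 ?mulr_ge0 ?exprn_ge0// ltW.
move=> r r0; have e1 : 1 <= expR (th * r ^+ 2) by rewrite -expR0 ler_expR mulr_ge0 ?sqr_ge0 ?ltW.
have e2 : r ^+ 4 <= 2 / th ^+ 2 * expR (th * r ^+ 2).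
  have := powx_le_expR 2 (mulr_ge0 (ltW th0) (sqr_ge0 r)).
  have -> : 2 / th ^+ 2 * expR (th * r ^+ 2) = 2 * expR (th * r ^+ 2) / th ^+ 2 by ring.
  by rewrite ler_pdivlMr ?exprn_gt0//; have -> : r ^+ 4 * th ^+ 2 = (th * r ^+ 2) ^+ 2 by ring.
have e3 : r ^+ 3 <= 1 + r ^+ 4 by have := sqr_ge0 (r - 1); have := sqr_ge0 (r ^+ 2 - r); have := sqr_ge0 (r ^+ 2 - 1); nra.
apply: (@le_trans _ _ (1 + c * (1 + 2 * r ^+ 4))).
  by rewrite lerD2l ler_wpM2l//; lra.
have := ler_wpM2l c0 e2; set E := expR _ in e1 e2 *.
have -> : (1 + c + 4 * c / th ^+ 2) * E = (1 + c) * E + 2 * (c * (2 / th ^+ 2 * E)) by ring.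
have := ler_wpM2l (addr_ge0 ler01 c0) e1; lra.
Qed.

Let tail_bound (dl : R) j z : 0 < dl -> `|al j| <= dl -> `|ga j| <= 1 + dl ->
  Normc.normc (ceval (cfactor j) z) <=
  expR (ln (1 + ((1 + dl) * (Normc.normc z ^+ 2 * d)) ^+ 2 / j.+1%:R ^+ 2) + 4 * dl * ctail (radius z j)).
Proof.
move=> dl0 h1 h2; set S := radius z j; have S0 : 0 <= S by exact: radius_ge0.
have S4 : S ^+ 4 = (Normc.normc z ^+ 2 * d) ^+ 2 / j.+1%:R ^+ 2.
  rewrite /S /radius -mulrA !exprMn exprVn (exprM (Num.sqrt d) 2 2) (exprM (Num.sqrt _) 2 2) !sqr_sqrtr ?(ltW d0)//.
  by ring.
have -> : ((1 + dl) * (Normc.normc z ^+ 2 * d)) ^+ 2 / j.+1%:R ^+ 2 = (1 + dl) ^+ 2 * S ^+ 4.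
  by rewrite S4; ring.
have q0 : 0 < 1 + (1 + dl) ^+ 2 * S ^+ 4 by rewrite ltr_pwDl// mulr_ge0 ?sqr_ge0 ?exprn_ge0.
rewrite expRD lnK ?posrE//.
have w0 := ctail_ge0 S0.
have hf : Normc.normc (ceval (cfactor j) z) <= 1 + (dl * S ^+ 3 + (1 + dl) * S ^+ 4).
  have -> : ceval (cfactor j) z = 1 + (ceval (cfactor j) z - 1) by rewrite addrC subrK.
  apply: le_trans (le_normcD _ _) _; rewrite Normc.normc1 lerD2l.
  apply: le_trans (cfactor_sub1 j z) _.
  by apply: lerD; apply: ler_wpM2r => //; rewrite exprn_ge0.
apply: le_trans hf _.
have S40 : 0 <= S ^+ 4 by exact: exprn_ge0.
have S30 : 0 <= S ^+ 3 by exact: exprn_ge0.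
have dS4 : dl * S ^+ 4 + (1 + dl) * S ^+ 4 <= (1 + dl) ^+ 2 * S ^+ 4.
  by rewrite -mulrDl ler_wpM2r//; nra.
have d20 : 0 <= dl ^+ 2 * S ^+ 4 by rewrite mulr_ge0 ?sqr_ge0.
have [S1|S1] := leP S 1.
  apply: (@le_trans _ _ ((1 + (1 + dl) ^+ 2 * S ^+ 4) * (1 + dl * S ^+ 3))).
    have : 0 <= dl * S ^+ 3 by rewrite mulr_ge0// ltW.
    have : 0 <= dl * S ^+ 4 by rewrite mulr_ge0// ltW.
    by move=> x1 x2; have := mulr_ge0 (mulr_ge0 (sqr_ge0 (1 + dl)) S40) x2; nra.
  rewrite ler_wpM2l ?(ltW q0)//; apply: le_trans (expR_ge1Dx _); rewrite lerD2l.
  have := @expr3_le_ctail _ S; rewrite S0 S1 => /(_ isT) h3.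
  by rewrite [4 * dl]mulrC -mulrA ler_wpM2l// ltW.
apply: (@le_trans _ _ (1 + (1 + dl) ^+ 2 * S ^+ 4)).
  rewrite lerD2l; apply: le_trans dS4; rewrite lerD2r ler_wpM2l ?(ltW dl0)//.
  by rewrite [leRHS]exprSr ler_peMr// ltW.
rewrite ler_peMr ?(ltW q0)// -[X in X <= _]expR0 ler_expR.
exact: mulr_ge0 (mulr_ge0 (ler0n _ 4) (ltW dl0)) w0.
Qed.

(** The product is dominated by [prod (1 + |z|^4 d^2 / j^2)], which is at most
    [exp (pi d |z|^2)]: the cubic terms have small coefficients and their sum is
    [O (|z|^2)] by [ctail_sum]. *)
Lemma cprod_growth : exists2 eta, 0 < eta & exists C : R, forall n z,
  Normc.normc (ceval (cprod n) z) <= C * expR ((pi / 2 - eta) * Normc.normc z ^+ 2).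
Proof.
have pp := @pi_gt0 R.
pose g := pi / 2 - pi * d; have g0 : 0 < g by have := mulr_gt0 pp d2; rewrite /g; lra.
pose dl := Order.min 1 (g / 24).
have [dl0 dl1 dlg] : [/\ 0 < dl, dl <= 1 & dl <= g / 24].
  by rewrite lt_min ge_min lexx ltr01 divr_gt0// ge_min lexx orbT.
exists (g / 2); first by rewrite divr_gt0.
have [c c0 hc] := bounded_coef.
have [K hK] : exists K, forall j, (K <= j)%N -> `|al j| <= dl /\ `|ga j| <= 1 + dl.
  have /cvgrPdist_le/(_ dl dl0) [K1 _ h1] := al0.
  have /cvgrPdist_le/(_ dl dl0) [K2 _ h2] := ga1.
  exists (maxn K1 K2) => j; rewrite geq_max => /andP[/h1 j1 /h2 j2]; split.
    by move: j1; rewrite /= sub0r normrN.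
  have -> : ga j = 1 - (1 - ga j) by rewrite opprB addrC subrK.
  by apply: le_trans (ler_normB _ _) _; rewrite normr1 lerD2l.
have th0 : 0 < g / 4 / K.+1%:R by rewrite !divr_gt0// ltr0n.
have [C C1 hC] := poly_le_exp c0 th0.
exists (C ^+ K) => n z; set r := Normc.normc z; have r0 : 0 <= r by exact: normc_ge0.
set b : R := 1 + c * (r ^+ 3 + r ^+ 4).
have b1 : 1 <= b by rewrite /b lerDl mulr_ge0 ?addr_ge0 ?exprn_ge0.
pose s := (1 + dl) * (r ^+ 2 * d).
have s0 : 0 <= s by rewrite !mulr_ge0 ?sqr_ge0 ?addr_ge0 // ltW.
pose E (j : nat) := ln (1 + s ^+ 2 / j.+1%:R ^+ 2) + 4 * dl * ctail (radius z j).
have E0 j : 0 <= E j.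
  apply: addr_ge0; first by rewrite ln_ge0// lerDl divr_ge0 ?sqr_ge0.
  exact: mulr_ge0 (mulr_ge0 (ler0n _ 4) (ltW dl0)) (ctail_ge0 (radius_ge0 z j)).
have fb (j : nat) : Normc.normc (ceval (cfactor j) z) <= (if (j < K)%N then b else 1) * expR (E j).
  case: ltnP => jK.
    have [h1 h2] := hc j; apply: le_trans (factor_bound z c0 h1 h2) _.
    by rewrite -/r -/b ler_peMr ?(le_trans ler01)// -expR0 ler_expR.
  by rewrite mul1r; have [h1 h2] := hK j jK; exact: tail_bound.
rewrite /cprod ceval_prod normc_prod.
apply: (@le_trans _ _ (\prod_(j < n) ((if (j < K)%N then b else 1) * expR (E j)))).
  by apply: ler_prod => j _; rewrite normc_ge0 /= fb.
rewrite big_split /=.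
have p1 : \prod_(j < n) (if (j < K)%N then b else 1) <= b ^+ K.
  have -> : \prod_(j < n) (if (j < K)%N then b else 1) = b ^+ minn n K.
    elim: n => [|n IH]; first by rewrite big_ord0 min0n expr0.
    rewrite big_ord_recr /= IH; case: ltnP => h.
      by rewrite (minn_idPl h) exprSr.
    by rewrite mulr1 (minn_idPr (leqW h)).
  by apply: ler_weXn2l; rewrite ?geq_minr.
have p2 : \prod_(j < n) expR (E j) <= expR (pi * s + 4 * dl * (2 * (r ^+ 2 * d))).
  rewrite -expR_sum ler_expR big_split /= -mulr_sumr; apply: lerD.
    apply: le_trans (sum_ln_le n s0); rewrite big_add1 /= big_mkord; exact: lexx.
  rewrite ler_wpM2l ?mulr_ge0 ?(ltW dl0)//.
  have -> : r ^+ 2 * d = (r * Num.sqrt d) ^+ 2 by rewrite exprMn sqr_sqrtr// ltW.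
  by apply: ctail_sum; rewrite mulr_ge0 ?sqrtr_ge0.
have p3 : b ^+ K <= C ^+ K * expR (g / 4 * r ^+ 2).
  have h := hC r r0; apply: (@le_trans _ _ ((C * expR (g / 4 / K.+1%:R * r ^+ 2)) ^+ K)).
    by rewrite lerXn2r ?nnegrE ?(le_trans _ b1)// (le_trans _ h)// (le_trans _ b1).
  rewrite exprMn -expRM_natl ler_wpM2l ?exprn_ge0 ?(le_trans _ C1)// ler_expR mulrA.
  rewrite ler_wpM2r ?sqr_ge0// mulrCA ler_piMr ?divr_ge0 ?(ltW g0)//.
  by rewrite ler_pdivrMr ?ltr0n// mul1r ler_nat.
apply: le_trans (ler_pM _ _ (le_trans p1 p3) p2) _.
- by apply: prodr_ge0 => j _; case: ifP => _ //; exact: le_trans b1.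
- by apply: prodr_ge0 => j _; exact: expR_ge0.
rewrite -(mulrA (C ^+ K)) ler_wpM2l ?exprn_ge0 ?(le_trans _ C1)// -expRD ler_expR.
have -> : g / 4 * r ^+ 2 + (pi * s + 4 * dl * (2 * (r ^+ 2 * d))) = (g / 4 + pi * d + dl * (pi * d + 8 * d)) * r ^+ 2 by rewrite /s; ring.
rewrite ler_wpM2r ?sqr_ge0//.
have pd : pi * d + 8 * d <= 6.
  have p4 : 0 < 4 - pi :> R by have := @pihalf_lt2 R; lra.
  by have := mulr_gt0 d0 p4; move: d2; lra.
have := ler_wpM2l (ltW dl0) pd; rewrite /g in g0 dlg *; lra.
Qed.

Lemma cprod_cvg z : cvgn (fun n => complex.Re (ceval (cprod n) z)) /\
  cvgn (fun n => complex.Im (ceval (cprod n) z)).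
Proof.
have [eta _ [C hC]] := cprod_growth; have [c c0 hc] := bounded_coef.
set r := Normc.normc z; have r0 : 0 <= r by exact: normc_ge0.
pose B := C * expR ((pi / 2 - eta) * r ^+ 2).
have hB n : Normc.normc (ceval (cprod n) z) <= B by exact: hC.
have B0 : 0 <= B by apply: le_trans (hB 0%N); exact: normc_ge0.
have R0 : 0 <= r * Num.sqrt d by rewrite mulr_ge0 ?sqrtr_ge0.
have step n : Normc.normc (ceval (cprod n.+1) z - ceval (cprod n) z) <=
    B * (c * (1 + r) ^+ 3) * ctail (r * Num.sqrt d / Num.sqrt n.+1%:R).
  rewrite /cprod big_ord_recr /= -/(cprod n) cevalM -{2}[ceval (cprod n) z]mulr1 -mulrBr Normc.normcM.
  rewrite -mulrA; apply: ler_pM; rewrite ?normc_ge0//.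
  apply: le_trans (cfactor_sub1 _ _) _; have [h1 h2] := hc n.
  set S := radius z n; have S0 : 0 <= S by exact: radius_ge0.
  have Sr : S <= r by exact: radius_le.
  apply: (@le_trans _ _ (c * (1 + r) * S ^+ 3)).
    rewrite mulrDr mulr1 mulrDl; apply: lerD; first by rewrite ler_wpM2r ?exprn_ge0.
    rewrite -mulrA; apply: ler_pM => //; first exact: exprn_ge0.
    by rewrite exprS ler_wpM2r ?exprn_ge0.
  rewrite -/(radius z n) -/S; have -> : c * (1 + r) ^+ 3 * ctail S = c * (1 + r) * ((1 + r) ^+ 2 * ctail S) by ring.
  rewrite ler_wpM2l ?mulr_ge0 ?addr_ge0//.
  by apply: expr3_le_ctailM; rewrite S0.
have C'0 : 0 <= B * (c * (1 + r) ^+ 3) by exact: mulr_ge0 B0 (mulr_ge0 c0 (exprn_ge0 _ (addr_ge0 ler01 r0))).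
split.
- apply: (cvg_of_ctail R0 C'0) => n; first exact: le_trans (normr_Re_le _) (hB n).
  by rewrite -ReN -ReD; exact: le_trans (normr_Re_le _) (step n).
- apply: (cvg_of_ctail R0 C'0) => n; first exact: le_trans (normr_Im_le _) (hB n).
  by rewrite -ImN -ImD; exact: le_trans (normr_Im_le _) (step n).
Qed.

(** The factors differ from [1] by summable amounts that shrink with [x]. *)
Lemma cprod_ge_half : exists2 x0 : R, 0 < x0 & forall x n, 0 < x <= x0 -> 1 / 2 <= (cprod n).[x].
Proof.
have [c c0 hc] := bounded_coef.
have c1 : 0 < 1 + 16 * c by rewrite ltr_pwDl// mulr_ge0.
exists (1 + 16 * c)^-1; first by rewrite invr_gt0.
move=> x n /andP[x0 xc].
have x1 : x <= 1 by apply: le_trans xc _; rewrite invf_le1// lerDl mulr_ge0.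
pose S j := x * Num.sqrt d / Num.sqrt j.+1%:R.
pose e j := 2 * c * S j ^+ 3.
have SE j : radius x%:C%C j = S j by rewrite /radius normc_real gtr0_norm.
have S0 j : 0 <= S j by rewrite -SE radius_ge0.
have Sx j : S j <= x by rewrite -SE (le_trans (radius_le _ _))// normc_real gtr0_norm.
have fe j : `|(cfactor j).[x] - 1| <= e j.
  have -> : `|(cfactor j).[x] - 1| = Normc.normc (ceval (cfactor j) x%:C%C - 1).
    by rewrite ceval_real -(rmorph1 (real_complex R)) -rmorphB normc_real.
  apply: le_trans (cfactor_sub1 _ _) _.
  rewrite SE; have [h1 h2] := hc j; rewrite /e [2 * c]mulrC -mulrA [2 * S j ^+ 3]mulrDl mul1r mulrDr.
  have S4 : S j ^+ 4 <= S j ^+ 3 by rewrite [leLHS]exprSr ler_piMr ?exprn_ge0// (le_trans (Sx j)).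
  by apply: lerD; apply: ler_pM; rewrite ?exprn_ge0.
have se m : \sum_(j < m) e j <= 1 / 2.
  rewrite -mulr_sumr.
  have h : \sum_(j < m) S j ^+ 3 <= 4 * (2 * (x * Num.sqrt d) ^+ 2).
    apply: le_trans (ler_wpM2l _ (@ctail_sum R (x * Num.sqrt d) m _)); rewrite ?mulr_ge0 ?sqrtr_ge0 ?(ltW x0)//.
    rewrite mulr_sumr; apply: ler_sum => j _; apply: expr3_le_ctail.
    by rewrite S0 (le_trans (Sx j)).
  have xx : x ^+ 2 * (1 + 16 * c) <= 1.
    have h2 : x * (1 + 16 * c) <= 1 by rewrite -ler_pdivlMr// div1r.
    by rewrite expr2 -mulrA mulr_ile1// ?ltW// mulr_gt0.
  have := ler_wpM2l c0 h; rewrite exprMn sqr_sqrtr ?(ltW d0)// => {}h.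
  have := mulr_ge0 (mulr_ge0 c0 (sqr_ge0 x)) (ltW d2); nra.
suff : 1 - \sum_(j < n) e j <= (cprod n).[x] by have := se n; lra.
elim: n => [|n IH]; first by rewrite /cprod !big_ord0 subr0 hornerE.
rewrite /cprod !big_ord_recr /= -/(cprod n) hornerM.
have := fe n; rewrite ler_norml => /andP[f1 _].
have sn := se n; have sn1 := se n.+1; rewrite big_ord_recr /= in sn1.
have e0 j : 0 <= e j by exact: mulr_ge0 (mulr_ge0 (ler0n _ 2) c0) (exprn_ge0 _ (S0 j)).
have sp : 0 <= \sum_(j < n) e j by exact: sumr_ge0.
have := e0 n; nra.
Qed.

End CanonicalProduct.

(** * Gaussian means of polynomials *)

Section GaussianMean.
Context {R : realType}.
Notation mu := (@lebesgue_measure R).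
Implicit Types (p q : {poly R}).

Definition phi (x t : R) : R := expR (- (pi * (t - x) ^+ 2)).

Lemma measurable_phi x : measurable_fun [set: R] (phi x).
Proof. exact: measurable_gauss. Qed.

Lemma measurable_poly q : measurable_fun [set: R] (fun t => q.[t]).
Proof. by apply: continuous_measurable_fun => t; exact: continuous_horner. Qed.

Lemma poly_le_expR q : exists2 C : R, 0 <= C & exists n : nat, forall t, `|q.[t]| <= C * expR (n%:R * `|t|).
Proof.
elim/poly_ind: q => [|q c [C C0 [n h]]].
  by exists 0 => //; exists 0%N => t; rewrite horner0 normr0 mul0r.
exists (C + `|c|); first exact: addr_ge0.
exists n.+1 => t; rewrite hornerMXaddC -natr1 (mulrDl n%:R) mul1r expRD.
have t1 : `|t| <= expR `|t| by apply: le_trans (expR_ge1Dx _); rewrite lerDr.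
have e1 : 1 <= expR (n%:R * `|t|) by rewrite -expR0 ler_expR mulr_ge0.
have e2 : 1 <= expR `|t| by rewrite -expR0 ler_expR.
apply: le_trans (ler_normD _ _) _; rewrite normrM mulrDl; apply: lerD.
  by rewrite mulrA; apply: ler_pM.
by rewrite ler_peMr// -[X in X <= _]mulr1; apply: ler_pM.
Qed.

Lemma integrable_gauss (a x K : R) (g : R -> R) : 0 < a -> measurable_fun [set: R] g ->
  (forall t, `|g t| <= K * expR (- (a * (t - x) ^+ 2))) -> mu.-integrable [set: R] (EFin \o g).
Proof.
move=> a0 mg hg.
have K0 : 0 <= K.
  have := le_trans (normr_ge0 _) (hg x); rewrite subrr expr0n /= mulr0 oppr0 expR0 mulr1.
  exact.
apply/integrableP; split; first exact/measurable_EFinP.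
apply: (@le_lt_trans _ _ (\int[mu]_t (K%:E * (expR (- (a * (t - x) ^+ 2)))%:E))%E).
  apply: ge0_le_integral => //.
  - by apply: measurableT_comp => //; exact/measurable_EFinP.
  - by apply/measurable_EFinP; apply: measurable_funM => //; exact: measurable_gauss.
  - by move=> t _; rewrite /= -EFinM lee_fin.
rewrite ge0_integralZl_EFin//; last by apply/measurable_EFinP; exact: measurable_gauss.
by rewrite gauss_integral// -EFinM ltry.
Qed.

Lemma poly_phi_le q x : exists K : R, forall t, `|q.[t] * phi x t| <= K * expR (- (1 * (t - 0) ^+ 2)).
Proof.
have [C C0 [n hC]] := poly_le_expR q.
have [K K0 hK] := gauss_absorb (normr_ge0 x) (ler0n R n).
exists (C * K) => t; rewrite normrM (ger0_norm (expR_ge0 _)).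
apply: le_trans (ler_wpM2r (expR_ge0 _) (hC t)) _; rewrite -mulrA -mulrA ler_wpM2l//.
by rewrite -expRD addrC; exact: hK.
Qed.

Lemma integrable_poly_phi q x : mu.-integrable [set: R] (EFin \o (fun t => q.[t] * phi x t)).
Proof.
have [K hK] := poly_phi_le q x; apply: integrable_gauss hK => //.
by apply: measurable_funM; [exact: measurable_poly|exact: measurable_phi].
Qed.

Definition gmean (x : R) q : R := (\int[mu]_t (q.[t] * phi x t))%R.

Lemma gmeanD x p q : gmean x (p + q) = gmean x p + gmean x q.
Proof.
rewrite /gmean -RintegralD//; try exact: integrable_poly_phi.
by apply: eq_Rintegral => t _; rewrite hornerD mulrDl.
Qed.

Lemma gmeanZ x (a : R) p : gmean x (a *: p) = a * gmean x p.
Proof.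
rewrite /gmean -RintegralZl//; last exact: integrable_poly_phi.
by apply: eq_Rintegral => t _; rewrite hornerZ mulrA.
Qed.

Lemma gmean0 x : gmean x 0 = 0.
Proof. by rewrite -(scale0r (0 : {poly R})) gmeanZ mul0r. Qed.

Lemma gmeanB x p q : gmean x (p - q) = gmean x p - gmean x q.
Proof. by rewrite -[- q]scaleN1r gmeanD gmeanZ mulN1r. Qed.

Lemma gmean1 x : gmean x 1 = 1.
Proof.
rewrite /gmean /Rintegral; under eq_integral do rewrite hornerC mul1r.
by rewrite gauss_integral ?pi_gt0// mulfV ?gt_eqF ?pi_gt0// sqrtr1.
Qed.

Lemma derive_poly_phi q x (t : R) : is_derive t 1 (fun t => q.[t] * phi x t)
  ((q^`() - (2 * pi) *: (('X - x%:P) * q)).[t] * phi x t).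
Proof.
have hq : is_derive t 1 (fun t => q.[t]) (q^`()).[t].
  exact: is_derive_poly.
have hp : is_derive t 1 (phi x) (- (2 * pi * (t - x)) * phi x t).
  rewrite /phi; apply: is_derive_eq; rewrite !scaleRE; ring.
apply: is_derive_eq; rewrite !scaleRE hornerD hornerN hornerZ hornerM hornerD hornerN hornerX hornerC; ring.
Qed.

(** Integration by parts: the total integral of a decaying derivative vanishes. *)
Lemma gmean_derive q x : gmean x (q^`() - (2 * pi) *: (('X - x%:P) * q)) = 0.
Proof.
set r := (X in gmean x X); pose g t := q.[t] * phi x t; pose h t := r.[t] * phi x t.
have dg (t : R) : is_derive t 1 g (h t) by exact: derive_poly_phi.
have cg : continuous g.
  by move=> t; apply/differentiable_continuous/derivable1_diffP; case: (dg t).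
have ch : continuous h.
  move=> t; apply: cvgM; first exact: continuous_horner.
  by apply/differentiable_continuous/derivable1_diffP; exact: ex_derive.
have mh : measurable_fun [set: R] h by exact: continuous_measurable_fun.
have ih : mu.-integrable [set: R] (EFin \o h) by exact: integrable_poly_phi.
pose I n := `[(- n.+1%:R : R), n.+1%:R]%classic.
pose G n : R -> \bar R := ((EFin \o h) \_ (I n)).
have GE n : (\int[mu]_t G n t = (g n.+1%:R - g (- n.+1%:R))%:E)%E.
  rewrite -integral_mkcond EFinB; apply: (@continuous_FTC2 R h g).
  - by apply: (@lt_trans _ _ 0); rewrite ?oppr_lt0 ltr0n.
  - exact: continuous_subspaceT.
  - by split => [t _||]; [case: (dg t)|exact/cvg_at_right_filter/cg|exact/cvg_at_left_filter/cg].
  - by move=> t _; rewrite derive1E; case: (dg t).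
have mG n : measurable_fun [set: R] (G n).
  apply/(measurable_restrictT _ _).1 => //; first exact: measurable_itv.
  by apply/measurable_EFinP; exact: measurable_funTS.
have G1 : {ae mu, forall t, setT t -> G ^~ t @ \oo --> (EFin \o h) t}.
  apply: aeW => t _; apply: cvg_near_cst; near=> n.
  rewrite /G patchE mem_set// /I /= in_itv /= -ler_norml.
  apply: (@le_trans _ _ n%:R); last by rewrite ler_nat.
  by near: n; exact: nbhs_infty_ger.
have G2 : {ae mu, forall t n, setT t -> (`|G n t| <= `|(EFin \o h) t|)%E}.
  by apply: aeW => t n _; rewrite /G patchE; case: ifP => _ //; rewrite abse0.
have [_ _] := @dominated_convergence _ _ R mu setT measurableT G (EFin \o h) _ mG
  ((measurable_EFinP _ _).2 mh) G1 (integrable_abse ih) G2.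
have -> : (fun n => (\int[mu]_t G n t)%E) = (fun n => (g n.+1%:R - g (- n.+1%:R))%:E) by apply/funext => n; exact: GE.
have [K hK] := poly_phi_le q x.
have gn : (g n.+1%:R - g (- n.+1%:R))%:E @[n --> \oo] --> (0%:E : \bar R).
  apply: cvg_EFin; first exact: nearW.
  have gb n (t : R) : `|t| = n.+1%:R -> `|g t| <= K * harmonic n.
    move=> tn; have K0 : 0 <= K.
      have := le_trans (normr_ge0 _) (hK 0); rewrite subrr expr0n /= mulr0 oppr0 expR0 mulr1.
      exact.
    apply: le_trans (hK t) _; rewrite ler_wpM2l// subr0 mul1r -(real_normK (num_real t)) tn.
    rewrite expRN lef_pV2 ?posrE ?expR_gt0 ?ltr0n//.
    apply: le_trans (expR_ge1Dx _); rewrite -natrX -[1]/(1%:R) -natrD ler_nat.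
    by rewrite expnS expn1 mulnS add1n ltnS (leq_trans (leqnSn n))// leq_addr.
  apply/cvgrPdist_le => e e0.
  have : 2 * K * harmonic n @[n --> \oo] --> 2 * K * 0.
    by apply: cvgM; [exact: cvg_cst|exact: cvg_harmonic].
  rewrite mulr0 => /cvgrPdist_le/(_ e e0); apply: filterS => n hn.
  rewrite sub0r normrN; apply: le_trans (ler_normB _ _) _.
  apply: le_trans (lerD (gb n _ _) (gb n _ _)) _; rewrite ?normrN ?ger0_norm//.
  by move: hn; rewrite sub0r normrN => /(le_trans (ler_norm _)); lra.
move=> h1; have := cvg_unique _ h1 gn.
rewrite /gmean /Rintegral -/h; by move=> ->.
Unshelve. all: by end_near. Qed.

Lemma gmeanXM x q : gmean x ('X * q) = x * gmean x q + (2 * pi)^-1 * gmean x q^`().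
Proof.
have p2 : 2 * pi != 0 :> R by rewrite mulf_neq0// gt_eqF// pi_gt0.
have := gmean_derive q x; rewrite gmeanB gmeanZ mulrBl gmeanB mul_polyC gmeanZ.
by move/eqP; rewrite subr_eq0 => /eqP ->; rewrite (mulKf p2); ring.
Qed.

(** The Hermite-type polynomials [int (t + i y)^k phi(y) dy]. *)
Fixpoint hermite k : {poly R} :=
  if k is k'.+1 then 'X * hermite k' - (2 * pi)^-1 *: (hermite k')^`() else 1.

Lemma gmean_hermite x k : gmean x (hermite k) = x ^+ k.
Proof.
elim: k => [|k IH]; first by rewrite gmean1.
by rewrite /= gmeanB gmeanZ gmeanXM IH exprS; ring.
Qed.

Lemma deriv_hermite k : (hermite k.+1)^`() = k.+1%:R *: hermite k.
Proof.
elim: k => [|k IH].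
  by rewrite /= derivB derivM derivX derivZ derivC !(mulr0, scaler0, deriv0, subr0, addr0) mulr1 scale1r.
have -> : hermite k.+2 = 'X * hermite k.+1 - (2 * pi)^-1 *: (hermite k.+1)^`() by [].
rewrite derivB derivM derivX mul1r derivZ IH derivZ.
have -> : hermite k.+1 = 'X * hermite k - (2 * pi)^-1 *: (hermite k)^`() by [].
rewrite -!mul_polyC -[k.+2%:R]natr1 !polyCD; ring.
Qed.

(* real and imaginary parts of (t + i y)^k as polynomials in y *)
Fixpoint powRe (t : R) k : {poly R} := if k is k'.+1 then t *: powRe t k' - 'X * powIm t k' else 1
with powIm (t : R) k : {poly R} := if k is k'.+1 then 'X * powRe t k' + t *: powIm t k' else 0.

Lemma pow_ReIm t k (y : R) : ((t +i* y)%C : R[i]) ^+ k = ((powRe t k).[y] +i* (powIm t k).[y])%C.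
Proof.
elim: k => [|k IH] /=; first by rewrite expr0 hornerC horner0.
rewrite exprS IH !hornerE; apply/eqP; rewrite eq_complex /=.
by apply/andP; split; apply/eqP; ring.
Qed.

Lemma deriv_pow t k : (powRe t k.+1)^`() = - (k.+1%:R *: powIm t k) /\
  (powIm t k.+1)^`() = k.+1%:R *: powRe t k.
Proof.
elim: k => [|k [IH1 IH2]].
  by rewrite /= derivB derivD !derivM !derivZ derivX derivC deriv0 !(mulr0, scaler0, subr0, addr0, oppr0, mul1r, scale1r).
have e1 : powRe t k.+2 = t *: powRe t k.+1 - 'X * powIm t k.+1 by [].
have e2 : powIm t k.+2 = 'X * powRe t k.+1 + t *: powIm t k.+1 by [].
rewrite e1 e2 derivB derivD !derivM !derivZ derivX !mul1r IH1 IH2.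
have e3 : powRe t k.+1 = t *: powRe t k - 'X * powIm t k by [].
have e4 : powIm t k.+1 = 'X * powRe t k + t *: powIm t k by [].
by rewrite e3 e4 -!mul_polyC -[k.+2%:R]natr1 !polyCD; split; ring.
Qed.

(** Both sides satisfy the same recurrence, by integration by parts in [y]. *)
Lemma gmean_pow t k : gmean 0 (powRe t k) = (hermite k).[t].
Proof.
suff : gmean 0 (powRe t k) = (hermite k).[t] /\ gmean 0 (powRe t k.+1) = (hermite k.+1).[t] by case.
elim: k => [|k [IH1 IH2]].
  rewrite gmean1 hornerC; split => //.
  rewrite /= mulr0 subr0 gmeanZ gmean1 derivC scaler0 subr0 !hornerE//.
split => //.
have -> : powRe t k.+2 = t *: powRe t k.+1 - 'X * powIm t k.+1 by [].
have -> : hermite k.+2 = 'X * hermite k.+1 - (2 * pi)^-1 *: (hermite k.+1)^`() by [].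
have [_ dI] := deriv_pow t k.
rewrite gmeanB gmeanZ gmeanXM mul0r add0r dI gmeanZ IH1 IH2 deriv_hermite.
move: (hermite k.+1) (hermite k) => a b.
by rewrite hornerD hornerN hornerM hornerX !hornerZ.
Qed.

Definition hermite_sum p : {poly R} := \sum_(k < size p) p`_k *: hermite k.

Lemma gmean_hermite_sum x p : gmean x (hermite_sum p) = p.[x].
Proof.
rewrite /hermite_sum horner_coef; elim: (size p) => [|n IH].
  by rewrite !big_ord0 gmean0.
by rewrite !big_ord_recr /= gmeanD gmeanZ IH gmean_hermite.
Qed.

Lemma Re_ceval p (t y : R) :
  complex.Re (ceval p (t +i* y)%C) = (\sum_(k < size p) p`_k *: powRe t k).[y].
Proof.
rewrite /ceval horner_coef size_map_poly horner_sum Re_sum; apply: eq_bigr => k _.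
by rewrite coef_map /= pow_ReIm hornerZ /= mul0r subr0.
Qed.

(** Together with [gmean_hermite_sum] this is the mean value property of [p] for the
    Gaussian measure on the plane, as an iterated integral; comparing moments avoids
    polar coordinates. *)
Lemma ceval_hermite_sum p t : (\int[mu]_y (complex.Re (ceval p (t +i* y)%C) * phi 0 y))%R = (hermite_sum p).[t].
Proof.
have -> : (\int[mu]_y (complex.Re (ceval p (t +i* y)%C) * phi 0 y))%R = gmean 0 (\sum_(k < size p) p`_k *: powRe t k).
  by apply: eq_Rintegral => y _; rewrite Re_ceval.
rewrite /hermite_sum; elim: (size p) => [|n IH].
  by rewrite !big_ord0 gmean0 horner0.
by rewrite !big_ord_recr /= gmeanD gmeanZ IH gmean_pow hornerD hornerZ.
Qed.

End GaussianMean.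

(** * A function orthogonal to the translates *)

Section GaussianDomination.
Context {R : realType}.
Notation mu := (@lebesgue_measure R).

Lemma Rintegral_gauss_le (a x K : R) (g : R -> R) : 0 < a -> measurable_fun [set: R] g ->
  (forall t, `|g t| <= K * expR (- (a * (t - x) ^+ 2))) ->
  `|(\int[mu]_t g t)%R| <= K * Num.sqrt (pi / a).
Proof.
move=> a0 mg hg; have ig := integrable_gauss a0 mg hg.
have K0 : 0 <= K.
  have := le_trans (normr_ge0 _) (hg x); rewrite subrr expr0n /= mulr0 oppr0 expR0 mulr1.
  exact.
apply: le_trans (le_normr_Rintegral measurableT ig) _.
rewrite -lee_fin /Rintegral fineK.
  rewrite EFinM -(gauss_integral x a0) -ge0_integralZl_EFin//.
    apply: ge0_le_integral => //.
    - by apply/measurable_EFinP; exact: measurableT_comp.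
    - by apply/measurable_EFinP; apply: measurable_funM => //; exact: measurable_gauss.
    - by move=> t _; rewrite -EFinM lee_fin.
  by apply/measurable_EFinP; exact: measurable_gauss.
exact: (integrable_fin_num measurableT (integrable_norm ig)).
Qed.

Lemma gauss_dominated (a x K : R) (G : nat -> R -> R) (g : R -> R) : 0 < a ->
  (forall n, measurable_fun [set: R] (G n)) ->
  (forall t, G n t @[n --> \oo] --> g t) ->
  (forall n t, `|G n t| <= K * expR (- (a * (t - x) ^+ 2))) ->
  measurable_fun [set: R] g /\
  (\int[mu]_t G n t)%R @[n --> \oo] --> (\int[mu]_t g t)%R.
Proof.
move=> a0 mG Gg hG.
have mg : measurable_fun [set: R] g.
  by apply: (measurable_fun_cvg (h := G)) => [n|t _]; [exact: mG|exact: Gg].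
split => //.
have hg t : `|g t| <= K * expR (- (a * (t - x) ^+ 2)).
  by apply: (cvgr_to_le (cvg_norm (Gg t))); exact: nearW.
have ig := integrable_gauss a0 mg hg.
have mH : measurable_fun [set: R] (fun t => K * expR (- (a * (t - x) ^+ 2))).
  by apply: measurable_funM => //; exact: measurable_gauss.
have hH t : `|K * expR (- (a * (t - x) ^+ 2))| <= K * expR (- (a * (t - x) ^+ 2)).
  by rewrite ger0_norm// (le_trans _ (hg t)).
have iH := integrable_gauss a0 mH hH.
have G1 : {ae mu, forall t, setT t -> (EFin \o G n) t @[n --> \oo] --> (EFin \o g) t}.
  by apply: aeW => t _; apply: cvg_EFin; [exact: nearW|exact: Gg].
have G2 : {ae mu, forall t n, setT t -> (`|(EFin \o G n) t| <= (K * expR (- (a * (t - x) ^+ 2)))%R%:E)%E}.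
  by apply: aeW => t n _; rewrite /= lee_fin.
have [_ _] := @dominated_convergence _ _ R mu setT measurableT (fun n => EFin \o G n) (EFin \o g) _
  (fun n => (measurable_EFinP _ _).2 (mG n)) ((measurable_EFinP _ _).2 mg) G1 iH G2.
have fg : (\int[mu]_t (EFin \o g) t)%E = ((\int[mu]_t g t)%R)%:E.
  by rewrite /Rintegral fineK//; exact: (integrable_fin_num measurableT ig).
by rewrite fg => h; exact: (fine_cvg h).
Qed.

End GaussianDomination.

Section Annihilator.
Context {R : realType}.
Notation mu := (@lebesgue_measure R).
Variables (d : R) (al ga : nat -> R).
Hypotheses (d0 : 0 < d) (d12 : d < 1 / 2).
Hypotheses (al0 : al n @[n --> \oo] --> (0 : R)) (ga1 : ga n @[n --> \oo] --> (1 : R)).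
Implicit Types (z : R[i]).
Local Notation G n := (cprod d al ga n).

Let glim z : R[i] := (limn (fun n => complex.Re (ceval (G n) z)) +i*
  limn (fun n => complex.Im (ceval (G n) z)))%C.

Let dec z : R[i] := - ((pi / 2)%:C%C * z ^+ 2).

(** Polynomials, so that the Gaussian mean value property applies; they converge to
    [annihilated]. *)
Definition approximant n : {poly R} := (1 - (pi / 2 / n.+1%:R) *: 'X^2) ^+ n.+1 * 'X * G n.

(** On [z = t + i y] the factor [exp (- pi z^2 / 2)] has modulus
    [exp (pi (y^2 - t^2) / 2)]: it turns the growth of the canonical product into decay
    in [t] and leaves a growth in [y] that the Gaussian weight absorbs. The factor [z]
    adds a zero at the origin. *)
Definition annihilated z : R[i] := cexp (dec z) * z * glim z.

Let cvalE n z : ceval (approximant n) z = (1 + dec z / n.+1%:R) ^+ n.+1 * z * ceval (G n) z.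
Proof.
have cX q k : ceval (q ^+ k) z = ceval q z ^+ k by rewrite /ceval rmorphXn horner_exp.
rewrite /approximant !cevalM cX; congr (_ ^+ _ * _ * _); last by rewrite /ceval map_polyX hornerX.
rewrite cevalB ceval_monom /ceval rmorph1 hornerC.
by rewrite /dec rmorphM fmorphV rmorph_nat; ring.
Qed.

Let glim_cvg z : Normc.normc (ceval (G n) z - glim z) @[n --> \oo] --> (0 : R).
Proof.
have [c1 c2] := cprod_cvg d0 d12 al0 ga1 z.
apply/cvgrPdist_le => e e0; have e2 : 0 < e / 2 by rewrite divr_gt0.
have /cvgrPdist_le/(_ _ e2) h1 := c1; have /cvgrPdist_le/(_ _ e2) h2 := c2.
near=> n; rewrite sub0r normrN ger0_norm ?normc_ge0//.
apply: le_trans (normc_le_ReIm _) _; rewrite ReD ReN ImD ImN [e]splitr.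
by apply: lerD; rewrite distrC; near: n.
Unshelve. all: by end_near. Qed.

Let norm_dec z : Normc.normc (dec z) = pi / 2 * Normc.normc z ^+ 2.
Proof. by rewrite normcN Normc.normcM normc_real normcX ger0_norm// divr_ge0// pi_ge0. Qed.

Let r_le (eta r : R) : 0 < eta -> 0 <= r -> r <= (1 + 2 / eta) * expR (eta / 2 * r ^+ 2).
Proof.
move=> eta0 r0; set E := expR _.
have h1 : 1 + eta / 2 * r ^+ 2 <= E by exact: expR_ge1Dx.
have h2 : 0 <= r ^+ 2 by exact: sqr_ge0.
have h3 : r <= 1 + r ^+ 2 by have := sqr_ge0 (r - 1); nra.
apply: le_trans h3 _; rewrite mulrDl mul1r; apply: lerD.
  by apply: le_trans h1; rewrite lerDl mulr_ge0// divr_ge0 ?ltW.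
have -> : r ^+ 2 = 2 / eta * (eta / 2 * r ^+ 2) by field; rewrite gt_eqF.
by rewrite ler_wpM2l ?divr_ge0 ?(ltW eta0)//; lra.
Qed.

Let approx_bound : exists2 eta, 0 < eta & exists2 C, 0 <= C & forall z,
  (forall n, Normc.normc (ceval (approximant n) z) <= C * expR ((pi - eta) * Normc.normc z ^+ 2)) /\
  Normc.normc (annihilated z) <= C * expR (complex.Re (dec z) + (pi / 2 - eta) * Normc.normc z ^+ 2).
Proof.
have [eta eta0 [C hC]] := cprod_growth d0 d12 al0 ga1.
have C0 : 0 <= C.
  have := le_trans (normc_ge0 _) (hC 0%N 0); rewrite pmulr_lge0//; exact: expR_gt0.
exists (eta / 2); first by rewrite divr_gt0.
have C'0 : 0 <= C * (1 + 2 / eta) by rewrite mulr_ge0// addr_ge0// divr_ge0// ltW.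
exists (C * (1 + 2 / eta)) => // z; set r := Normc.normc z.
have r0 : 0 <= r by exact: normc_ge0.
have hr := r_le eta0 r0.
have rG x : x <= C * expR ((pi / 2 - eta) * r ^+ 2) ->
    r * x <= C * (1 + 2 / eta) * expR ((pi / 2 - eta / 2) * r ^+ 2).
  move=> hx; apply: le_trans (ler_wpM2l r0 hx) _.
  apply: le_trans (ler_wpM2r _ hr) _; first by rewrite mulr_ge0// expR_ge0.
  have -> : (pi / 2 - eta / 2) * r ^+ 2 = eta / 2 * r ^+ 2 + (pi / 2 - eta) * r ^+ 2 by field.
  by rewrite expRD; apply: le_of_eq; ring.
split.
  move=> n; rewrite cvalE !Normc.normcM normcX -/r -mulrA.
  have -> : (pi - eta / 2) * r ^+ 2 = pi / 2 * r ^+ 2 + (pi / 2 - eta / 2) * r ^+ 2 by field.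
  rewrite expRD [leRHS]mulrCA; apply: ler_pM; rewrite ?exprn_ge0 ?mulr_ge0 ?normc_ge0//; last exact: rG (hC n z).
  apply: (@le_trans _ _ (expR (pi / 2 * r ^+ 2 / n.+1%:R) ^+ n.+1)).
    rewrite lerXn2r ?nnegrE ?normc_ge0 ?expR_ge0//; apply: le_trans (le_normcD _ _) _.
    rewrite Normc.normc1 Normc.normcM Normc.normcV normc_natr norm_dec; exact: expR_ge1Dx.
  by rewrite -expRM_natl ler_expR mulrC divfK// pnatr_eq0.
have gl : Normc.normc (glim z) <= C * expR ((pi / 2 - eta) * r ^+ 2).
  apply/ler_addgt0Pr => e e0.
  have /cvgrPdist_le/(_ _ e0)[n _ hn] := glim_cvg z.
  have h : Normc.normc (glim z - ceval (G n) z) <= e.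
    by have := hn n (leqnn n); rewrite /= sub0r normrN ger0_norm ?normc_ge0// normc_distC.
  have -> : glim z = ceval (G n) z + (glim z - ceval (G n) z) by rewrite addrC subrK.
  by apply: le_trans (le_normcD _ _) _; apply: lerD => //; exact: hC.
rewrite /annihilated !Normc.normcM normc_cexp -/r -mulrA expRD [leRHS]mulrCA.
by rewrite ler_wpM2l ?expR_ge0//; exact: rG.
Qed.

Let approx_cvg z : Normc.normc (ceval (approximant n) z - annihilated z) @[n --> \oo] --> (0 : R).
Proof.
have [eta _ [C hC]] := cprod_growth d0 d12 al0 ga1.
set r := Normc.normc z; have r0 : 0 <= r by exact: normc_ge0.
pose B := C * expR ((pi / 2 - eta) * r ^+ 2).
pose K := 2 * Normc.normc (dec z) ^+ 2 * expR (2 * Normc.normc (dec z)).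
pose A := expR (complex.Re (dec z)).
have B0 : 0 <= B by apply: le_trans (hC 0%N z); exact: normc_ge0.
have K0 : 0 <= K by rewrite /K -mulrA mulr_ge0// mulr_ge0 ?expR_ge0 ?sqr_ge0.
have bound n : Normc.normc (ceval (approximant n) z - annihilated z) <=
    K * harmonic n * (r * B) + A * r * Normc.normc (ceval (G n) z - glim z).
  rewrite cvalE /annihilated; set an := (1 + _) ^+ _; set g := ceval _ _.
  have -> : an * z * g - cexp (dec z) * z * glim z =
    - ((cexp (dec z) - an) * (z * g)) + cexp (dec z) * z * (g - glim z) by ring.
  apply: le_trans (le_normcD _ _) _; rewrite normcN !Normc.normcM normc_cexp -/r -/A; apply: lerD => //.
  apply: ler_pM; rewrite ?mulr_ge0 ?normc_ge0//; last by rewrite ler_wpM2l//; exact: hC.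
  by apply: le_trans (@cexp_lim _ _ n.+1 _) _.
apply: (@squeeze_cvgr _ _ _ _ (fun=> 0) (fun n => K * harmonic n * (r * B) + A * r * Normc.normc (ceval (G n) z - glim z))).
- by apply: nearW => n; rewrite normc_ge0 bound.
- exact: cvg_cst.
have -> : (0 : R) = K * 0 * (r * B) + A * r * 0 by rewrite !mulr0 mul0r addr0.
apply: cvgD; apply: cvgM; try exact: cvg_cst; last exact: glim_cvg.
by apply: cvgM; [exact: cvg_cst|exact: cvg_harmonic].
Qed.

Let Re_approx_cvg z : complex.Re (ceval (approximant n) z) @[n --> \oo] --> complex.Re (annihilated z).
Proof.
have /cvgrPdist_le h := approx_cvg z; apply/cvgrPdist_le => e e0.
have := h e e0; apply: filterS => n; rewrite sub0r normrN ger0_norm ?normc_ge0//; apply: le_trans.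
by rewrite distrC -ReN -ReD; exact: normr_Re_le.
Qed.

Definition annihilator (t : R) : R := (\int[mu]_y (complex.Re (annihilated (t +i* y)%C) * phi 0 y))%R.

Let sqr_norm (t y : R) : Normc.normc (t +i* y)%C ^+ 2 = t ^+ 2 + y ^+ 2.
Proof. by rewrite normc_sqr. Qed.

Let Re_dec (t y : R) : complex.Re (dec (t +i* y)%C) = - (pi / 2 * (t ^+ 2 - y ^+ 2)).
Proof. by rewrite /dec [_ ^+ 2]expr2 /=; ring. Qed.

Let annihilator_props : exists2 eta : R, 0 < eta & exists2 C : R, 0 <= C &
  [/\ forall n t, `|(hermite_sum (approximant n)).[t]| <= C * expR ((pi - eta) * t ^+ 2),
   forall t, (hermite_sum (approximant n)).[t] @[n --> \oo] --> annihilator t &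
   forall t, `|annihilator t| <= C * expR (- (eta * t ^+ 2))].
Proof.
have [eta eta0 [C C0 hC]] := approx_bound.
exists eta => //; exists (C * Num.sqrt (pi / eta)); first by rewrite mulr_ge0 ?sqrtr_ge0.
pose u n t y : R := complex.Re (ceval (approximant n) (t +i* y)%C) * phi 0 y.
pose v t y : R := complex.Re (annihilated (t +i* y)%C) * phi 0 y.
have uE n t : (hermite_sum (approximant n)).[t] = (\int[mu]_y u n t y)%R by rewrite ceval_hermite_sum.
have mu_ n t : measurable_fun [set: R] (u n t).
  apply: measurable_funM; last exact: measurable_phi.
  by under eq_fun do rewrite Re_ceval; exact: measurable_poly.
have ub n t y : `|u n t y| <= (C * expR ((pi - eta) * t ^+ 2)) * expR (- (eta * (y - 0) ^+ 2)).
  rewrite /u normrM (ger0_norm (expR_ge0 _)).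
  have [h _] := hC (t +i* y)%C; have {h} := le_trans (normr_Re_le _) (h n); rewrite sqr_norm => h.
  apply: le_trans (ler_wpM2r (expR_ge0 _) h) _; rewrite -!mulrA ler_wpM2l// -!expRD ler_expR !subr0.
  by apply: le_of_eq; ring.
have uv t y : u n t y @[n --> \oo] --> v t y.
  by apply: cvgM; [exact: Re_approx_cvg|exact: cvg_cst].
have dct t := gauss_dominated eta0 (fun n => mu_ n t) (uv t) (fun n => ub n t).
have vb t y : `|v t y| <= (C * expR (- (eta * t ^+ 2))) * expR (- (eta * (y - 0) ^+ 2)).
  rewrite /v normrM (ger0_norm (expR_ge0 _)).
  have [_ h] := hC (t +i* y)%C; have {}h := le_trans (normr_Re_le _) h; rewrite sqr_norm in h.
  apply: le_trans (ler_wpM2r (expR_ge0 _) h) _; rewrite -!mulrA ler_wpM2l// -!expRD ler_expR !subr0.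
  by rewrite Re_dec; apply: le_of_eq; field.
split.
- move=> n t; rewrite uE mulrAC; exact: (Rintegral_gauss_le eta0 (mu_ n t) (ub n t)).
- by move=> t; have [_] := dct t; under eq_fun do rewrite -uE.
- move=> t; rewrite mulrAC; have [mv _] := dct t.
  exact: (Rintegral_gauss_le eta0 mv (vb t)).
Qed.

(** Dominated convergence carries the mean value property from the approximants to
    their limit. *)
Lemma annihilator_spec : exists2 eta : R, 0 < eta & exists C : R,
  [/\ measurable_fun [set: R] annihilator,
   forall t, `|annihilator t| <= C * expR (- (eta * t ^+ 2)) &
   forall x, (\int[mu]_t (annihilator t * phi x t))%R = complex.Re (annihilated x%:C%C)].
Proof.
have [eta eta0 [C C0 [h1 h2 h3]]] := annihilator_props.
have mf : measurable_fun [set: R] annihilator.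
  by apply: (measurable_fun_cvg (h := fun n t => (hermite_sum (approximant n)).[t])) => [n|t _]; [exact: measurable_poly|exact: h2].
exists eta => //; exists C; split => // x.
have e2 : 0 < eta / 2 by rewrite divr_gt0.
pose c : R := 2 * pi ^+ 2 * x ^+ 2 / eta; pose K := C * expR c.
have [|||_ lim] := @gauss_dominated R (eta / 2) 0 K
    (fun n t => (hermite_sum (approximant n)).[t] * phi x t) (fun t => annihilator t * phi x t) e2.
- by move=> n; apply: measurable_funM; [exact: measurable_poly|exact: measurable_phi].
- by move=> t; apply: cvgM; [exact: h2|exact: cvg_cst].
- move=> n t; rewrite normrM (ger0_norm (expR_ge0 _)).
  apply: le_trans (ler_wpM2r (expR_ge0 _) (h1 n t)) _.
  rewrite /K -!(mulrA C) -!expRD ler_wpM2l// ler_expR subr0.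
  have ce : c * eta = 2 * pi ^+ 2 * x ^+ 2 by rewrite divfK// gt_eqF.
  have sq := sqr_ge0 (eta * t - 2 * pi * x).
  have h : 2 * pi * x * t <= eta / 2 * t ^+ 2 + c.
    by rewrite -(ler_pM2r eta0) [leRHS]mulrDl ce; nra.
  have : 0 <= pi * x ^+ 2 by rewrite mulr_ge0 ?pi_ge0 ?sqr_ge0.
  nra.
have lim2 : (approximant n).[x] @[n --> \oo] --> complex.Re (annihilated x%:C%C).
  have := @Re_approx_cvg x%:C%C; under eq_fun do rewrite ceval_real; exact.
move: lim; have -> : (fun n => (\int[mu]_t ((hermite_sum (approximant n)).[t] * phi x t))%R) = (fun n => (approximant n).[x]).
  by apply/funext => n; exact: gmean_hermite_sum.
by move=> lim; exact: (cvg_unique _ lim lim2).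
Qed.

Lemma annihilated0 (x : R) (n0 : nat) : (forall n, (n0 <= n)%N -> (approximant n).[x] = 0) ->
  complex.Re (annihilated x%:C%C) = 0.
Proof.
move=> h; have := @Re_approx_cvg x%:C%C; under eq_fun do rewrite ceval_real /=.
have lim0 : (approximant n).[x] @[n --> \oo] --> (0 : R) by apply: cvg_near_cst; exists n0.
by move=> lim; exact: (cvg_unique _ lim lim0).
Qed.

Lemma annihilated_neq0 : exists x : R, complex.Re (annihilated x%:C%C) != 0.
Proof.
have [x0 x00 hx] := cprod_ge_half d0 d12 al0 ga1.
exists x0; rewrite /annihilated.
have gl : 1 / 2 <= complex.Re (glim x0%:C%C).
  have [c1 _] := cprod_cvg d0 d12 al0 ga1 x0%:C%C.
  rewrite /glim /=; apply: limr_ge => //; apply: nearW => n.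
  by rewrite ceval_real /=; apply: hx; rewrite x00 lexx.
have -> : dec x0%:C%C = (- (pi / 2 * x0 ^+ 2))%:C%C by rewrite /dec -rmorphXn -rmorphM -rmorphN.
rewrite cexp_real -rmorphM ReM /= mul0r subr0 gt_eqF//.
apply: mulr_gt0; first exact: mulr_gt0 (expR_gt0 _) x00.
by apply: lt_le_trans gl; rewrite divr_gt0.
Qed.

End Annihilator.

(** * Density below one half *)

Section DensityValue.
Context {R : realType}.

Lemma density_lt_real (M : set R) (a : R) : density_lt M a ->
  exists D : R, [/\ 0 <= D, D < a & has_density M D%:E].
Proof.
move=> [D hD Da].
have D0 : (0 <= D)%E.
  rewrite leNgt; apply/negP => h.
  have /hD [r1 [_ hr1]] := open_ereal_lt' h.
  have /hr1 : r1 < `|r1| + 1 by rewrite (le_lt_trans (ler_norm _))// ltrDl.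
  by rewrite /= ltNge mule_ge0.
case: D hD Da D0 => [D||] // hD Da D0.
by exists D; rewrite -lee_fin -lte_fin.
Qed.

End DensityValue.

Section NotSpanning.
Context {R : realType}.
Variables (p : R) (p1 : 1 <= p).
Notation mu := (@lebesgue_measure R).
Notation Lp := (@cLp R p%:E).

Let p0 : 0 < p. Proof. exact: lt_le_trans p1. Qed.

Let young (b t : R) : 0 <= b -> 0 < t -> b <= t + t * t^-1 `^ p * b `^ p.
Proof.
move=> b0 t0; have t10 : 0 <= t^-1 by rewrite invr_ge0 ltW.
rewrite -mulrA -powRM//; have [bt|tb] := leP b t.
  by apply: le_trans bt _; rewrite lerDl mulr_ge0 ?powR_ge0 ?(ltW t0).
have h : 1 <= t^-1 * b by rewrite mulrC ler_pdivlMr// mul1r ltW.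
apply: (@le_trans _ _ (t * (t^-1 * b))); first by rewrite mulrA mulfV ?mul1r// gt_eqF.
apply: (@le_trans _ _ (t * (t^-1 * b) `^ p)); last by rewrite lerDr ltW.
by rewrite ler_wpM2l ?(ltW t0)// -[leLHS]powRr1 ?(le_trans ler01 h)// ler_powR.
Qed.

(** A Gaussian-decaying function lies in every dual space; splitting at height [t]
    replaces Hoelder's inequality uniformly in the exponent. *)
Lemma gauss_pairing_le (f : R -> R) (C eta : R) (g : R -> R[i]) (t e : R) : 0 < eta -> 0 < t -> 0 < e ->
  measurable_fun [set: R] f -> (forall x, `|f x| <= C * expR (- (eta * x ^+ 2))) ->
  Lp g -> (cLnorm p%:E g < e%:E)%E ->
  `|(\int[mu]_x (f x * complex.Re (g x)))%R| <=
    t * (C * Num.sqrt (pi / eta)) + C * (t * t^-1 `^ p) * e `^ p.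
Proof.
move=> eta0 t0 e0 mf hf Lg ge; have [[mg1 mg2] _] := Lg.
have C0 : 0 <= C.
  by have := le_trans (normr_ge0 _) (hf 0); rewrite expr0n /= mulr0 oppr0 expR0 mulr1.
set K := t * t^-1 `^ p; have K0 : 0 <= K by rewrite mulr_ge0 ?powR_ge0 ?(ltW t0).
have fC x : `|f x| <= C.
  apply: le_trans (hf x) _; rewrite ler_piMr// -expR0 ler_expR oppr_le0.
  by rewrite mulr_ge0 ?sqr_ge0 ?ltW.
pose I := (\int[mu]_x (Normc.normc (g x) `^ p)%:E)%E.
have Ifin : (I < +oo)%E by exact: (cLp_int p1).
have I0 : (0 <= I)%E by apply: integral_ge0 => x _; rewrite lee_fin powR_ge0.
have Ie : (I <= (e `^ p)%:E)%E.
  have If : I \is a fin_num by rewrite ge0_fin_numE.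
  move: ge; rewrite cLnormE -/I -(fineK If) poweR_EFin !lte_fin lee_fin => ge.
  have r0 : 0 <= fine I by exact: fine_ge0.
  have -> : fine I = (fine I `^ p^-1) `^ p by rewrite -powRrM mulVf ?gt_eqF// powRr1.
  by apply: ge0_ler_powR; rewrite ?nnegrE ?powR_ge0 ?(ltW p0) ?(ltW e0) ?(ltW ge).
have mfg : measurable_fun [set: R] (fun x => f x * complex.Re (g x)) by exact: measurable_funM.
have mE : measurable_fun [set: R] (fun x => expR (- (eta * (x - 0) ^+ 2))) by exact: measurable_gauss.
have mgp : measurable_fun [set: R] (fun x => (Normc.normc (g x) `^ p)%:E).
  apply/measurable_EFinP.
  apply: (measurableT_comp (f := fun x => x `^ p)); first exact: measurable_powR.
  exact: cmeasurable_normc.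
have bound : (\int[mu]_x `|(f x * complex.Re (g x))%:E| <=
    (t * (C * Num.sqrt (pi / eta)) + C * K * e `^ p)%:E)%E.
  apply: (@le_trans _ _ (\int[mu]_x ((t * C)%:E * (expR (- (eta * (x - 0) ^+ 2)))%:E + (C * K)%:E * (Normc.normc (g x) `^ p)%:E))%E).
    apply: ge0_le_integral => //.
    - by apply: measurableT_comp => //; exact/measurable_EFinP.
    - by apply: emeasurable_funD; apply: measurable_funeM => //; exact/measurable_EFinP.
    - move=> x _; rewrite -!EFinM -EFinD lee_fin normrM subr0.
      have h1 := normr_Re_le (g x); have h2 := young (normc_ge0 (g x)) t0.
      have h3 := le_trans h1 h2; apply: le_trans (ler_wpM2l (normr_ge0 _) h3) _.
      rewrite mulrDr; apply: lerD.
        by rewrite mulrC -mulrA ler_wpM2l ?(ltW t0).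
      by rewrite -/K mulrA ler_wpM2r ?powR_ge0// ler_wpM2r.
  rewrite ge0_integralD//; last 4 first.
  - by move=> x _; rewrite -EFinM lee_fin !mulr_ge0 ?expR_ge0 ?(ltW t0).
  - by apply: measurable_funeM; exact/measurable_EFinP.
  - by move=> x _; apply: mule_ge0; rewrite lee_fin ?powR_ge0// mulr_ge0.
  - exact: measurable_funeM.
  rewrite ge0_integralZl_EFin ?mulr_ge0 ?(ltW t0)//; last exact/measurable_EFinP.
  have -> : (\int[mu]_x ((C * K)%:E * (Normc.normc (g x) `^ p)%:E) = (C * K)%:E * I)%E.
    by apply: ge0_integralZl_EFin; rewrite ?(mulr_ge0 C0 K0)// => x _; rewrite lee_fin powR_ge0.
  rewrite gauss_integral// -EFinM EFinD; apply: leeD; first by rewrite lee_fin mulrA.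
  by rewrite [leRHS]EFinM lee_wpmul2l// lee_fin mulr_ge0.
have ifg : mu.-integrable [set: R] (EFin \o (fun x => f x * complex.Re (g x))).
  apply/integrableP; split; first exact/measurable_EFinP.
  by apply: le_lt_trans bound _; rewrite ltry.
apply: le_trans (le_normr_Rintegral measurableT ifg) _.
rewrite -lee_fin /Rintegral fineK//.
exact: (integrable_fin_num measurableT (integrable_norm ifg)).
Qed.

Lemma not_spans_of_annihilator (A : set R) (f : R -> R) (C eta x0 : R) : 0 < eta ->
  measurable_fun [set: R] f -> (forall t, `|f t| <= C * expR (- (eta * t ^+ 2))) ->
  (forall x, A x -> (\int[mu]_t (f t * phi x t))%R = 0) ->
  (\int[mu]_t (f t * phi x0 t))%R != 0 ->
  ~ spans_Lp p%:E A (fun x t : R => gaussian (t - x)).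
Proof.
move=> eta0 mf hf hA; set v := (X in X != 0) => v0 hs.
have C0 : 0 <= C.
  by have := le_trans (normr_ge0 _) (hf 0); rewrite expr0n /= mulr0 oppr0 expR0 mulr1.
have vp : 0 < `|v| by rewrite normr_gt0.
pose B := C * Num.sqrt (pi / eta); have B0 : 0 <= B by rewrite mulr_ge0 ?sqrtr_ge0.
pose t := `|v| / (4 * (B + 1)).
have t0 : 0 < t by rewrite divr_gt0// mulr_gt0// ltr_wpDl.
pose K := C * (t * t^-1 `^ p); have K0 : 0 <= K by rewrite mulr_ge0// mulr_ge0 ?powR_ge0// ltW.
pose ep := `|v| / (4 * (K + 1)).
have ep0 : 0 < ep by rewrite divr_gt0// mulr_gt0// ltr_wpDl.
pose e := ep `^ p^-1; have e0 : 0 < e by exact: powR_gt0.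
have eE : e `^ p = ep by rewrite -powRrM mulVf ?gt_eqF// powRr1// ltW.
have Lx0 := cLp_gaussian p1 x0.
have [n [i [c [hi hn]]]] := hs _ Lx0 e e0.
have LG x := cLp_gaussian p1 x.
have Lg : Lp (fun t => gaussian (t - x0) - \sum_(k < n) c k * gaussian (t - i k)).
  by apply: (cLpB p1) => //; apply: (cLp_sum p1) => k; exact: (cLpZ p1).
have := gauss_pairing_le eta0 t0 e0 mf hf Lg hn; rewrite eE -/B -/K.
have ifx x : mu.-integrable [set: R] (EFin \o (fun t => f t * phi x t)).
  apply: (integrable_gauss (x := 0) (K := C) eta0).
    by apply: measurable_funM => //; exact: measurable_phi.
  move=> u; rewrite normrM (ger0_norm (expR_ge0 _)) subr0; apply: le_trans (hf u).
  rewrite ler_piMr// -expR0 ler_expR oppr_le0 mulr_ge0 ?sqr_ge0 ?pi_ge0//.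
have Egau (x u : R) : complex.Re (gaussian (u - x)) = phi x u by [].
have int0 (r : seq 'I_n) : mu.-integrable [set: R]
     (EFin \o (fun u => f u * (phi x0 u - \sum_(k <- r) complex.Re (c k) * phi (i k) u))) /\
   (\int[mu]_u (f u * (phi x0 u - \sum_(k <- r) complex.Re (c k) * phi (i k) u)))%R = v.
  elim: r => [|k r [ih1 ih2]].
    have -> : (fun u => f u * (phi x0 u - \sum_(k <- [::]) complex.Re (c k) * phi (i k) u)) = (fun u => f u * phi x0 u).
      by apply/funext => u; rewrite big_nil subr0.
    by split; [exact: ifx|].
  have E : (fun u => f u * (phi x0 u - \sum_(k <- k :: r) complex.Re (c k) * phi (i k) u)) =
    (fun u => f u * (phi x0 u - \sum_(k <- r) complex.Re (c k) * phi (i k) u) - complex.Re (c k) * (f u * phi (i k) u)).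
    by apply/funext => u; rewrite big_cons; ring.
  have ik : mu.-integrable [set: R] (EFin \o (fun u => complex.Re (c k) * (f u * phi (i k) u))).
    have -> : (EFin \o (fun u => complex.Re (c k) * (f u * phi (i k) u))) =
      (fun u => (complex.Re (c k))%:E * ((f u * phi (i k) u)%R)%:E)%E.
      by apply/funext => u; rewrite /= EFinM.
    exact: (integrableZl measurableT _ (ifx (i k))).
  rewrite E; split.
    exact: (integrableB measurableT ih1 ik).
  rewrite RintegralB// ih2 RintegralZl// hA// mulr0 subr0//.
have [_ hv] := int0 (index_enum 'I_n).
have -> : (\int[mu]_u (f u * complex.Re (gaussian (u - x0) - \sum_(k < n) c k * gaussian (u - i k))))%R = v.
  rewrite -[RHS]hv; apply: eq_Rintegral => u _; rewrite ReD ReN Re_sum Egau.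
  by congr (_ * (_ - _)); apply: eq_bigr => k _; rewrite ReM /= mulr0 subr0 -/(phi _ _).
have quarter b : 0 <= b -> `|v| / (4 * (b + 1)) * b <= `|v| / 4.
  move=> b0; have b1 : b + 1 != 0 by rewrite gt_eqF// ltr_wpDl.
  have -> : `|v| / (4 * (b + 1)) * b = `|v| / 4 * (b / (b + 1)) by field.
  by rewrite ler_piMr ?divr_ge0// ler_pdivrMr ?ltr_wpDl// mul1r lerDl.
have h1 : t * B <= `|v| / 4 by exact: quarter.
have h2 : K * ep <= `|v| / 4 by rewrite mulrC; exact: quarter.
move: vp h1 h2; lra.
Qed.

(** The positive and the negative points are paired off along [sqrt ((j + 1) / d)],
    filling gaps. A pair of zeros [1 / (X tau)], [- 1 / (X' tau)] with
    [tau = sqrt (d / (j + 1))] enters through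
    [(1 - X v) (1 + X' v) (1 + e v + (m + e^2) v^2)], where [v = tau z], [e = X - X'],
    [m = X X'], which has no terms of order one and two in [v]. *)
Lemma not_spans_of_density (A Ap Am : set R) (Dp Dm d : R) :
  (forall x, A x -> [\/ x = 0, x > 0 /\ Ap x | x < 0 /\ Am x]) ->
  0 <= Dp < d -> 0 <= Dm < d -> d < 1 / 2 ->
  has_density Ap Dp%:E -> has_density Am Dm%:E ->
  ~ spans_Lp p%:E A (fun x t : R => gaussian (t - x)).
Proof.
move=> hA /andP[Dp0 Dpd] /andP[Dm0 Dmd] d12 hp hm.
have d0 : 0 < d by exact: le_lt_trans Dpd.
pose l := regular_enum Ap Dp d; pose l' := regular_enum Am Dm d.
have l0 j : 0 < l j by exact: (regular_enum_gt0 _ Dp0 Dpd).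
have l'0 j : 0 < l' j by exact: (regular_enum_gt0 _ Dm0 Dmd).
have s0 j : 0 < scale d j by rewrite divr_gt0 ?sqrtr_gt0 ?ltr0n.
pose X j := (l j * scale d j)^-1; pose X' j := (l' j * scale d j)^-1.
have X1 : X j @[j --> \oo] --> (1 : R).
  by rewrite -invr1; apply: cvgV; [exact: oner_neq0|exact: (regular_enum_asymp Dp0 Dpd hp)].
have X'1 : X' j @[j --> \oo] --> (1 : R).
  by rewrite -invr1; apply: cvgV; [exact: oner_neq0|exact: (regular_enum_asymp Dm0 Dmd hm)].
pose e j := X j - X' j; pose m j := X j * X' j.
have e0 : e j @[j --> \oo] --> (0 : R) by rewrite -(subrr (1 : R)); exact: cvgB.
have m1 : m j @[j --> \oo] --> (1 : R) by rewrite -(mulr1 (1 : R)); exact: cvgM.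
pose al j := 2 * e j * m j + e j * e j * e j.
pose ga j := m j * (m j + e j * e j).
have al0 : al j @[j --> \oo] --> (0 : R).
  have -> : (0 : R) = 2 * 0 * 1 + 0 * 0 * 0 by ring.
  apply: cvgD; last by apply: cvgM => //; exact: cvgM.
  by apply: cvgM => //; apply: cvgM => //; exact: cvg_cst.
have ga1 : ga j @[j --> \oo] --> (1 : R).
  have -> : (1 : R) = 1 * (1 + 0 * 0) by ring.
  by apply: cvgM => //; apply: cvgD => //; exact: cvgM.
have [eta eta0 [C [mf hf val]]] := annihilator_spec d0 d12 al0 ga1.
have [x0 hx0] := annihilated_neq0 d0 d12 al0 ga1.
apply: (not_spans_of_annihilator (x0 := x0) eta0 mf hf); last by rewrite val.
move=> x Ax; rewrite val.
have fac j (w : R) : (cfactor d al ga j).[w] =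
   (1 - X j * scale d j * w) * (1 + X' j * scale d j * w) *
   (1 + e j * scale d j * w + (m j + e j * e j) * (scale d j * w) ^+ 2).
  by rewrite /cfactor !(hornerD, hornerN, hornerZ, hornerXn, hornerC) /al /ga /e /m; ring.
have prod0 j (w : R) : (cfactor d al ga j).[w] = 0 -> forall n, (j < n)%N -> (cprod d al ga n).[w] = 0.
  move=> h n jn; rewrite /cprod horner_prod (bigD1 (Ordinal jn)) //= h mul0r//.
have [->|[xp Apx]|[xn Amx]] := hA x Ax.
- by apply: (annihilated0 d0 d12 al0 ga1 (n0 := 0%N)) => n _; rewrite /approximant !hornerM hornerX mulr0 mul0r.
- have [j hj] := regular_enum_onto Dpd hp Apx (negbT (gt_eqF xp)).
  apply: (annihilated0 d0 d12 al0 ga1 (n0 := j.+1)) => n jn; rewrite /approximant hornerM (prod0 j) ?mulr0//.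
  have -> : x = l j by rewrite /l hj gtr0_norm.
  have h1 : X j * scale d j * l j = 1 by rewrite /X -mulrA [scale d j * _]mulrC mulVf// mulf_neq0// gt_eqF.
  by rewrite fac h1 subrr !mul0r.
- have [j hj] := regular_enum_onto Dmd hm Amx (negbT (lt_eqF xn)).
  apply: (annihilated0 d0 d12 al0 ga1 (n0 := j.+1)) => n jn; rewrite /approximant hornerM (prod0 j) ?mulr0//.
  have -> : x = - l' j by rewrite /l' hj ltr0_norm// opprK.
  have h1 : X' j * scale d j * l' j = 1 by rewrite /X' -mulrA [scale d j * _]mulrC mulVf// mulf_neq0// gt_eqF.
  by rewrite fac [X' j * _ * _]mulrN h1 subrr mulr0 mul0r.
Qed.

End NotSpanning.

Theorem theorem1p1 (R : realType) (Lambda : set R) (p : R) :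
  discrete_set Lambda ->
  p = 2 \/ p = 1 ->
  let Lambda_plus := Lambda `&` `[0, +oo[ in
  let Lambda_minus := Lambda `&` `]-oo, 0] in
  let translates := fun lambda t : R => gaussian (t - lambda) in
  (density_lt Lambda_plus (1 / 2) /\ density_lt Lambda_minus (1 / 2) ->
     ~ spans_Lp p%:E Lambda translates) /\
  (density_gt Lambda_plus (1 / 2) \/ density_gt Lambda_minus (1 / 2) ->
     spans_Lp p%:E Lambda translates).
Proof.
move=> _ hp Lp Lm translates.
have p1 : 1 <= p by case: hp => ->; rewrite ?lexx// ler1n.
split.
  move=> [/density_lt_real[Dp [Dp0 Dp2 hDp]] /density_lt_real[Dm [Dm0 Dm2 hDm]]].
  pose d := (Num.max Dp Dm + 1 / 2) / 2.
  have [h1 h2] : Dp <= Num.max Dp Dm /\ Dm <= Num.max Dp Dm by rewrite !le_max !lexx orbT.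
  have h3 : Num.max Dp Dm < 1 / 2 by rewrite gt_max Dp2.
  apply: (not_spans_of_density p1 (d := d) _ _ _ _ hDp hDm).
  - move=> x Lx; case: (ltgtP x 0) => [xn|xp|->].
    + by apply: Or33; split => //; split => //=; rewrite in_itv /= ltW.
    + by apply: Or32; split => //; split => //=; rewrite in_itv /= andbT ltW.
    + exact: Or31.
  - by rewrite Dp0 /d; lra.
  - by rewrite Dm0 /d; lra.
  - by rewrite /d; lra.
move=> [hd|hd].
- apply: (spans_of_density p1 (s := false) _ _ hd) => x [Lx //=].
  by rewrite in_itv /= andbT expr0 mul1r => x0; rewrite ger0_norm.
- apply: (spans_of_density p1 (s := true) _ _ hd) => x [Lx //=].
  by rewrite in_itv /= expr1 mulN1r => x0; rewrite ler0_norm.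
Qed.
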